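(* Let $(M,P_1,P_2)$ be a real analytic path geometry on a $3$-manifold $M$. Then for every point $p\in M$ there exist a neighbourhood $U_p\subset M$ of $p$ and a real analytic embedding $\varphi:U_p\to\mathbb{C}^2$ such that the path geometry induced on $U_p$ (via $\varphi$) by the splitting $(\{\omega_0\},\{\phi_0\})$, where $\omega_0=\operatorname{Re}(\mathrm{d}z^1\wedge \mathrm{d}z^2)$ and $\phi_0=\operatorname{Im}(\mathrm{d}z^1\wedge \mathrm{d}z^2)$, is $(P_1,P_2)$ on $U_p$.
   Context: A path geometry on a $3$-manifold $M$ is a pair of line subbundles $(P_1,P_2)$ of $TM$ which span a contact plane field, i.e. $P_1\oplus P_2\subset TM$ is a rank $2$ subbundle that is nowhere integrable. It is real analytic if $M$ is a real analytic manifold and $P_1,P_2$ are real analytic line subbundles. Let $z=(z^1,z^2)$ be the standard coordinates on $\mathbb{C}^2\simeq\mathbb{R}^4$ and write $z^1=x^1+\mathrm{i}x^2$, $z^2=x^3+\mathrm{i}x^4$. Then $\omega_0=\mathrm{d}x^1\wedge \mathrm{d}x^3-\mathrm{d}x^2\wedge \mathrm{d}x^4$ and $\phi_0=\mathrm{d}x^1\wedge \mathrm{d}x^4+\mathrm{d}x^2\wedge \mathrm{d}x^3$. Here $\{\cdot\}$ denotes the linear span (over smooth real-valued functions), so $\{\omega_0\}$, $\{\phi_0\}$ are line subbundles of $\Lambda^2T^*\mathbb{C}^2$. Induced structure: let $\varphi:U\to\mathbb{C}^2$ be an embedding of a $3$-manifold $U$. The $2$-forms $\varphi^*\omega_0,\varphi^*\phi_0$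 are linearly independent at each point of $U$, and near each point of $U$ there is a local coframing $(\eta_1,\eta_2,\eta_3)$ (three linearly independent $1$-forms) with $\varphi^*\omega_0=\eta_2\wedge\eta_1$ and $\varphi^*\phi_0=\eta_2\wedge\eta_3$. The line subbundles of $TU$ given locally by $\{\eta_1,\eta_2\}^{\perp}$ (the common kernel of $\eta_1,\eta_2$) and $\{\eta_2,\eta_3\}^{\perp}$ (the common kernel of $\eta_2,\eta_3$) do not depend on the choice of such coframing. If they span a contact plane field, the pair consisting of $\{\eta_1,\eta_2\}^{\perp}$ (first) and $\{\eta_2,\eta_3\}^{\perp}$ (second) is the path geometry on $U$ induced by the splitting $(\{\omega_0\},\{\phi_0\})$ via $\varphi$. *)

(* Defs.v *)
From HB Require Import structures.
From mathcomp Require Import all_boot all_order all_algebra.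
From mathcomp Require Import all_classical all_reals all_analysis.
From mathcomp Require Import complex.

Set Implicit Arguments.
Unset Strict Implicit.
Unset Printing Implicit Defensive.

Import Order.TTheory GRing.Theory Num.Theory.
Import numFieldNormedType.Exports.

Local Open Scope classical_set_scope.
Local Open Scope ring_scope.

Section Regularity.
Context {R : realType} {n : nat}.
Implicit Types (f : 'rV[R]_n.+1 -> R) (W : set 'rV[R]_n.+1).

(* Partial sums, over the multi-indices with all entries < N, of the power
   series with coefficients [a] at the increment [h]. *)
Definition mpsum (a : ('I_n.+1 -> nat) -> R) (h : 'rV[R]_n.+1) (N : nat) : R :=
  \sum_(k : {ffun 'I_n.+1 -> 'I_N})
    a (fun i => val (k i)) * \prod_(i < n.+1) h 0 i ^+ val (k i).

Definition abs_mpsum (a : ('I_n.+1 -> nat) -> R) (h : 'rV[R]_n.+1) (N : nat) : R :=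
  \sum_(k : {ffun 'I_n.+1 -> 'I_N})
    `|a (fun i => val (k i)) * \prod_(i < n.+1) h 0 i ^+ val (k i)|.

Definition real_analytic_at f (x : 'rV[R]_n.+1) : Prop :=
  exists (a : ('I_n.+1 -> nat) -> R) (r : R), 0 < r /\
    forall h : 'rV[R]_n.+1, (forall i, `|h 0 i| < r) ->
      cvgn (abs_mpsum a h) /\ mpsum a h @ \oo --> f (x + h).

Definition real_analytic_on W f : Prop :=
  forall x, W x -> real_analytic_at f x.

Fixpoint Ck_on (k : nat) W f : Prop :=
  (forall x, W x -> {for x, continuous f}) /\
  match k with
  | 0 => True
  | k'.+1 => forall i : 'I_n.+1,
      (forall x, W x -> derivable f x (delta_mx 0 i)) /\
      Ck_on k' W (fun x => 'D_(delta_mx 0 i) f x)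
  end.

Definition smooth_on W f : Prop := forall k, Ck_on k W f.

End Regularity.

(* The map [chart_inv] is only meaningful on the open set [chart_map @` chart_dom]. *)
Record chart (R : realType) (M : topologicalType) := Chart {
  chart_dom : set M;
  chart_map : M -> 'rV[R]_3;
  chart_inv : 'rV[R]_3 -> M;
  chart_dom_open : open chart_dom;
  chart_image_open : open (chart_map @` chart_dom);
  chart_mapK : forall p, chart_dom p -> chart_inv (chart_map p) = p;
  chart_map_continuous : {within chart_dom, continuous chart_map};
  chart_inv_continuous : {within chart_map @` chart_dom, continuous chart_inv} }.

Section Manifold.
Context {R : realType} {M : topologicalType}.
Implicit Types (A : set (chart R M)) (c d : chart R M) (p q : M) (U V : set M).

Definition transition c d : 'rV[R]_3 -> 'rV[R]_3 := chart_map d \o chart_inv c.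

Definition analytic_manifold A : Prop :=
  [/\ hausdorff_space M,
      @second_countable M,
      forall p, exists2 c, A c & chart_dom c p &
      forall c d, A c -> A d -> forall p, chart_dom c p -> chart_dom d p -> forall j,
        real_analytic_at (fun x => transition c d x 0 j) (chart_map c p)].

Definition charts_at A p : set (chart R M) := [set c | A c /\ chart_dom c p].

(* A tangent vector at p is the family of its components in the charts of the
   atlas around p, which are related by the differentials of the transition
   maps; the family is 0 at all other charts, so that [tangent A p] is a
   3-dimensional subspace of the space of all families. *)
Local Notation family := (chart R M -> 'rV[R]_3).

Definition tangent A p : set family :=
  [set v | (forall c d, charts_at A p c -> charts_at A p d ->
              v d = 'd (transition c d) (chart_map c p) (v c)) /\
           (forall c, ~ charts_at A p c -> v c = 0)].

(* The tangent vector at p with components u in the chart c. *)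
Definition tangent_of A c p (u : 'rV[R]_3) : family :=
  patch (fun=> 0) (charts_at A p)
        (fun d => 'd (transition c d) (chart_map c p) u).

(* A regularity class of real functions on open subsets of coordinate space:
   below, [smooth_on] or [real_analytic_on]. *)
Definition regularity : Type := set 'rV[R]_3 -> ('rV[R]_3 -> R) -> Prop.
Implicit Types reg : regularity.

Definition vector_field reg A V (X : M -> family) : Prop :=
  (forall q, V q -> tangent A q (X q)) /\
  (forall c, A c -> forall j,
     reg (chart_map c @` (V `&` chart_dom c)) (fun x => X (chart_inv c x) c 0 j)).

(* In the chart c, the components of [X, Y] are dY(X) - dX(Y). *)
Definition lie_bracket A (X Y : M -> family) (q : M) : family :=
  patch (fun=> 0) (charts_at A q) (fun c =>
    'd (fun x => Y (chart_inv c x) c) (chart_map c q) (X q c)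
    - 'd (fun x => X (chart_inv c x) c) (chart_map c q) (Y q c)).

Definition line_subbundle reg A U (P : M -> set family) : Prop :=
  forall p, U p -> exists (V : set M) (X : M -> family),
    [/\ open V, V p, V `<=` U, vector_field reg A V X &
        forall q, V q -> X q <> 0 /\
          P q = [set v | exists t : R, v = t *: X q]].

Definition independent2 (v w : family) : Prop :=
  forall s t : R, s *: v + t *: w = 0 -> s = 0 /\ t = 0.

Definition plane_subbundle reg A U (D : M -> set family) : Prop :=
  forall p, U p -> exists (V : set M) (X Y : M -> family),
    [/\ open V, V p, V `<=` U,
        vector_field reg A V X /\ vector_field reg A V Y &
        forall q, V q -> independent2 (X q) (Y q) /\
          D q = [set v | exists s t : R, v = s *: X q + t *: Y q]].

Definition nowhere_integrable A U (D : M -> set family) : Prop :=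
  forall (V : set M) (X Y : M -> family), open V -> V `<=` U ->
    vector_field smooth_on A V X -> vector_field smooth_on A V Y ->
    (forall q, V q -> [/\ D q (X q), D q (Y q) & independent2 (X q) (Y q)]) ->
    forall q, V q -> ~ D q (lie_bracket A X Y q).

Definition contact_plane_field A U (D : M -> set family) : Prop :=
  plane_subbundle smooth_on A U D /\ nowhere_integrable A U D.

Definition span_lines (P1 P2 : M -> set family) (q : M) : set family :=
  [set v | exists v1 v2, [/\ P1 q v1, P2 q v2 & v = v1 + v2]].

Definition path_geometry A U (P1 P2 : M -> set family) : Prop :=
  [/\ line_subbundle smooth_on A U P1, line_subbundle smooth_on A U P2 &
      contact_plane_field A U (span_lines P1 P2)].

Definition analytic_path_geometry A U (P1 P2 : M -> set family) : Prop :=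
  [/\ path_geometry A U P1 P2, line_subbundle real_analytic_on A U P1 &
      line_subbundle real_analytic_on A U P2].

(* Regularity of a 1-form is regularity of its coefficients in each chart,
   i.e. of its values on the vector fields with constant components u. *)
Definition one_form reg A V (eta : M -> family -> R) : Prop :=
  (forall q, V q -> forall (t : R) v w, tangent A q v -> tangent A q w ->
     eta q (t *: v + w) = t * eta q v + eta q w) /\
  (forall c, A c -> forall u : 'rV[R]_3,
     reg (chart_map c @` (V `&` chart_dom c))
         (fun x => eta (chart_inv c x) (tangent_of A c (chart_inv c x) u))).

Definition coframing reg A V (eta1 eta2 eta3 : M -> family -> R) : Prop :=
  [/\ one_form reg A V eta1, one_form reg A V eta2, one_form reg A V eta3 &
      forall q, V q -> forall s1 s2 s3 : R,
        (forall v, tangent A q v ->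
           s1 * eta1 q v + s2 * eta2 q v + s3 * eta3 q v = 0) ->
        [/\ s1 = 0, s2 = 0 & s3 = 0]].

Definition wedge (alpha beta : M -> family -> R) (q : M) (v w : family) : R :=
  alpha q v * beta q w - alpha q w * beta q v.

Definition common_kernel A (alpha beta : M -> family -> R) (q : M) : set family :=
  [set v | [/\ tangent A q v, alpha q v = 0 & beta q v = 0]].

(* The differential at q of a map to R^m, computed in a chart c around q; on
   [tangent A q] it does not depend on c when the map is differentiable. *)
Definition differential (m : nat) (phi : M -> 'rV[R]_m.+1) c (q : M)
    (v : family) : 'rV[R]_m.+1 :=
  'd (phi \o chart_inv c) (chart_map c q) (v c).

Definition analytic_embedding (m : nat) A U (phi : M -> 'rV[R]_m.+1) : Prop :=
  [/\ (forall c, A c -> forall j,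
         real_analytic_on (chart_map c @` (U `&` chart_dom c))
           (fun x => phi (chart_inv c x) 0 j)),
      (forall q c, U q -> charts_at A q c -> forall v, tangent A q v ->
         differential phi c q v = 0 -> v = 0),
      {in U &, injective phi} &
      (* phi is open onto its image with the subspace topology *)
      forall V, open V -> V `<=` U ->
        exists2 W, open W & phi @` V = phi @` U `&` W].

End Manifold.

Section ComplexPlane.
Context {R : realType}.

(* C^2 is identified with R^4 by z1 = x1 + i x2, z2 = x3 + i x4. These
   coordinates being R-linear, they are also their own differentials. *)
Definition z1 (x : 'rV[R]_4) : R[i] := Complex (x 0 0) (x 0 1).
Definition z2 (x : 'rV[R]_4) : R[i] := Complex (x 0 2) (x 0 3).

Definition dz1_dz2 (v w : 'rV[R]_4) : R[i] := z1 v * z2 w - z1 w * z2 v.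
Definition omega0 (v w : 'rV[R]_4) : R := complex.Re (dz1_dz2 v w).
Definition phi0 (v w : 'rV[R]_4) : R := complex.Im (dz1_dz2 v w).

End ComplexPlane.

Section InducedStructure.
Context {R : realType} {M : topologicalType}.
Local Notation family := (chart R M -> 'rV[R]_3).

(* [theta] is a constant-coefficient 2-form on R^4. *)
Definition pullback_eq (A : set (chart R M)) (V : set M) (phi : M -> 'rV[R]_4)
    (theta : 'rV[R]_4 -> 'rV[R]_4 -> R)
    (beta : M -> family -> family -> R) : Prop :=
  forall q c, V q -> charts_at A q c ->
    forall v w, tangent A q v -> tangent A q w ->
      theta (differential phi c q v) (differential phi c q w) = beta q v w.

Definition induced_path_geometry (A : set (chart R M)) (U : set M)
    (phi : M -> 'rV[R]_4) (P1 P2 : M -> set (family)) : Prop :=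
  path_geometry A U P1 P2 /\
  forall p, U p -> exists (V : set M) (eta1 eta2 eta3 : M -> family -> R),
    [/\ open V, V p & V `<=` U] /\
    [/\ coframing smooth_on A V eta1 eta2 eta3,
        pullback_eq A V phi omega0 (wedge eta2 eta1),
        pullback_eq A V phi phi0 (wedge eta2 eta3) &
        forall q, V q -> P1 q = common_kernel A eta1 eta2 q /\
                         P2 q = common_kernel A eta2 eta3 q].

End InducedStructure.

(* Main.v *)
Require Import Defs.
From HB Require Import structures.
From mathcomp Require Import all_boot all_order all_algebra.
From mathcomp Require Import all_classical all_reals all_analysis.
From mathcomp Require Import complex ring lra.

(* Let X1, X2 span the two line fields near a point of R^3.  A closed complex
   2-form on a 3-manifold is i_Z vol for a divergence free complex vector field
   Z; its real part has kernel X1 and its imaginary part has kernel X2 exactly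
   when Z = f X1 + i g X2.  Real functions f, g making Z divergence free solve
   two linear transport equations.  In the analytic category Z has two first
   integrals z1, z2, whose initial values on a surface {t = 0} transverse to Z
   can be chosen so that dz1 /\ dz2 = i_Z vol there; both forms being closed
   with kernel Z, they agree everywhere.  Then (z1, z2) is the embedding: its
   differential kills only the intersection of the kernels of the real and
   imaginary parts of i_Z vol, which is 0.

   The only PDE involved is a scalar complex equation L u = 0 of first order,
   normalised by [L, t] = 1.  It is solved by the Lie series
   sum_k (-t)^k / k! L^k u0, which converges because in a weighted l1 norm of
   power series k derivatives cost a factor (C k)^k <= (4 C)^k k!. *)

Set Implicit Arguments.
Unset Strict Implicit.
Unset Printing Implicit Defensive.

Import Order.TTheory GRing.Theory Num.Theory.
Import numFieldNormedType.Exports.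

Local Open Scope classical_set_scope.
Local Open Scope ring_scope.

(** * Unordered sums *)

(** That dz1 /\ dz2 agrees with i_Z vol is a uniqueness statement for transport along a complex
    field, which has no integral curves to argue with. Both forms are multiples, by m and by f + i
    g, of the contraction of the volume with W = Z / (Z t), and closedness makes both factors solve
    (W + div W) u = 0. Uniqueness is proved for solutions t k with k analytic, so m - (f + i g) is
    written explicitly as t times an analytic germ instead of being divided by t. Linear Cauchy data
    make this possible: on t = 0, z1 = (1 + i) l1 and z2 = l2 with det(tau, l1, l2) = 1, where tau
    is the gradient of t. This gives m = 1 + i there, matching f = g = 1. The covector tau must be
    transverse to both X1 and X2, because the two real transport equations are normalised
    separately.

    The norm, the sum of |c_k| rho^(al_k), is submultiplicative: products and substitutions are
    immediate, and differentiation costs only radius. Convergence of the Lie series is then a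
    computation with constants. *)

Section FiniteSums.
Context {R : realType} {I : eqType}.
Implicit Types (s t : seq I) (a F : I -> R).

Lemma sum_diff s t F : uniq s -> uniq t -> {subset s <= t} ->
  \sum_(i <- t) F i = \sum_(i <- s) F i + \sum_(i <- t | i \notin s) F i.
Proof.
move=> us ut st; rewrite (bigID (mem s)) /=; congr (_ + _).
rewrite -big_filter; apply: perm_big; apply: uniq_perm; rewrite ?filter_uniq //.
by move=> i; rewrite mem_filter andbC; apply/andP/idP => [[]|si] //; rewrite st.
Qed.

Lemma sum_subset s t F : uniq s -> uniq t -> {subset s <= t} ->
  (forall i, 0 <= F i) -> \sum_(i <- s) F i <= \sum_(i <- t) F i.
Proof.
by move=> us ut st F0; rewrite (sum_diff _ us ut st) lerDl sumr_ge0.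
Qed.

(** Convergence along the net of finite subsets, represented by duplicate-free lists. The threshold
    [s0] may have repetitions, hence the calls to [undup] where it serves as a finite set. *)
Definition hsum a (S : R) := forall e, 0 < e -> exists s0 : seq I, forall s,
  uniq s -> {subset s0 <= s} -> `|\sum_(i <- s) a i - S| <= e.

(** Bounding the finite partial sums leaves the sum of absolute values unnamed: norms are estimated,
    never computed. *)
Definition abs_le a (C : R) := forall s, uniq s -> \sum_(i <- s) `|a i| <= C.

Lemma eq_hsum a b S : a =1 b -> hsum a S -> hsum b S.
Proof. by move=> /funext ->. Qed.

Lemma eq_abs_le a b C : a =1 b -> abs_le a C -> abs_le b C.
Proof. by move=> /funext ->. Qed.

Lemma abs_le_ge0 a C : abs_le a C -> 0 <= C.
Proof. by move=> /(_ [::] isT); rewrite big_nil. Qed.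

Lemma abs_leW a b C D : (forall i, `|a i| <= `|b i|) -> C <= D ->
  abs_le b C -> abs_le a D.
Proof. by move=> ab CD bC s us; rewrite (le_trans (le_trans _ (bC s us)) CD) ?ler_sum. Qed.

Lemma hsum_finite a s : uniq s -> (forall i, i \notin s -> a i = 0) ->
  hsum a (\sum_(i <- s) a i).
Proof.
move=> us a0 e e0; exists s => t ut st.
rewrite (sum_diff _ us ut st) addrAC subrr add0r big1 ?normr0; first exact: ltW.
by move=> i /a0.
Qed.

Lemma hsumD a b S T : hsum a S -> hsum b T -> hsum (fun i => a i + b i) (S + T).
Proof.
move=> aS bT e e0; have e2 : 0 < e / 2 by lra.
have [s Hs] := aS _ e2; have [t Ht] := bT _ e2.
exists (s ++ t) => u uu stu; rewrite big_split /= opprD addrACA (splitr e).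
by rewrite (le_trans (ler_normD _ _)) // lerD // (Hs,Ht) // => i it;
  apply: stu; rewrite mem_cat it ?orbT.
Qed.

Lemma hsumZ a S c : hsum a S -> hsum (fun i => c * a i) (c * S).
Proof.
move=> aS e e0; have c0 : 0 < `|c| + 1 by rewrite ltr_wpDl.
have [s Hs] := aS _ (divr_gt0 e0 c0); exists s => t ut st.
rewrite -big_distrr /= -mulrBr normrM.
apply: le_trans (ler_wpM2l _ (Hs _ ut st)) _ => //.
by rewrite mulrA ler_pdivrMr // mulrC ler_pM2l // lerDl.
Qed.

Lemma hsum_le a C S : abs_le a C -> hsum a S -> `|S| <= C.
Proof.
move=> aC aS; apply/ler_addgt0Pr => e e0; have [s Hs] := aS _ e0.
have us := undup_uniq s; have := Hs _ us _.
set X := \sum_(i <- _) _ => h.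
have -> : S = X - (X - S) by ring.
rewrite (le_trans (ler_normB _ _)) // lerD //.
  by rewrite (le_trans (ler_norm_sum _ _ _)) // aC.
by apply: h => i; rewrite mem_undup.
Qed.

Lemma ler_norm_hsum a b S T : (forall i, `|a i| <= b i) -> hsum a S -> hsum b T ->
  `|S| <= T.
Proof.
move=> ab aS bT; apply/ler_addgt0Pr => e e0; have e2 : 0 < e / 2 by lra.
have [s Hs] := aS _ e2; have [t Ht] := bT _ e2.
have us := undup_uniq (s ++ t); have := Hs _ us; have := Ht _ us.
have : `|\sum_(i <- undup (s ++ t)) a i| <= \sum_(i <- undup (s ++ t)) b i.
  by rewrite (le_trans (ler_norm_sum _ _ _)) // ler_sum.
move: (\sum_(i <- _) a i) (\sum_(i <- _) b i) => x y xy h1 h2.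
have {}h1 : `|y - T| <= e / 2 by apply: h1 => i; rewrite mem_undup mem_cat orbC => ->.
have {}h2 : `|x - S| <= e / 2 by apply: h2 => i; rewrite mem_undup mem_cat => ->.
move: h1 (ler_normB x (x - S)); rewrite subKr ler_norml => /andP[_ ?] ?; lra.
Qed.

Lemma abs_le_hsum_ge0 a C : (forall i, 0 <= a i) -> abs_le a C ->
  exists S, hsum a S.
Proof.
move=> a0 aC; pose E := [set x | exists2 s, uniq s & x = \sum_(i <- s) a i].
have hE : has_sup E.
  split; first by exists 0, [::] => //; rewrite big_nil.
  exists C => _ [s us ->]; rewrite (le_trans _ (aC s us)) // ler_sum // => i _.
  exact: ler_norm.
exists (sup E) => e e0; have [_ [s us ->] hs] := sup_adherent e0 hE.
exists s => t ut st; rewrite distrC ger0_norm ?subr_ge0.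
  have := sum_subset us ut st a0; lra.
by apply: sup_upper_bound => //; exists t.
Qed.

(** The family is the difference of the nonnegative families [|a|] and [|a| - a], with partial sums
    bounded by [C] and [C + C]. *)
Lemma abs_le_hsum a C : abs_le a C -> exists S, hsum a S.
Proof.
move=> aC; have [S1 h1] : exists S, hsum (fun i => `|a i|) S.
  by apply: (@abs_le_hsum_ge0 _ C) => // s us; under eq_bigr do rewrite normr_id; exact: aC.
have [S2 h2] : exists S, hsum (fun i => `|a i| - a i) S.
  apply: (@abs_le_hsum_ge0 _ (C + C)) => [i|s us]; first by rewrite subr_ge0 ler_norm.
  apply: (le_trans _ (lerD (aC s us) (aC s us))); rewrite -big_split ler_sum // => i _.
  by rewrite (le_trans (ler_normB _ _)) // normr_id.
exists (S1 + (-1) * S2); apply: eq_hsum (hsumD h1 (hsumZ (-1) h2)) => i /=; ring.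
Qed.

(** A finite set that determines the sum of [|a|] up to [e / 2] works: adjoining a disjoint list
    keeps the partial sum in the same window of width [e]. *)
Lemma abs_le_tail a C : abs_le a C -> forall e, 0 < e -> exists2 s0, uniq s0 &
  forall s, uniq s -> {in s, forall i, i \notin s0} -> \sum_(i <- s) `|a i| <= e.
Proof.
move=> aC e e0; have [S hS] : exists S, hsum (fun i => `|a i|) S.
  by apply: (@abs_le_hsum _ C) => s us; under eq_bigr do rewrite normr_id; exact: aC.
have e2 : 0 < e / 2 by lra.
have [s0 Hs] := hS _ e2; exists (undup s0); rewrite ?undup_uniq // => s us ds.
have us0 := undup_uniq s0.
have uc : uniq (undup s0 ++ s).
  by rewrite cat_uniq us0 us andbT /=; apply/hasPn => i /ds.
have := Hs _ us0; have := Hs _ uc; rewrite big_cat /= => h1 h2.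
have {}h1 := h1 _; have {}h2 := h2 _.
have : {subset s0 <= undup s0} by move=> i; rewrite mem_undup.
move=> /h2; have : {subset s0 <= undup s0 ++ s}.
  by move=> i; rewrite mem_cat mem_undup => ->.
move=> /h1; rewrite !ler_norml => /andP[? ?] /andP[? ?]; lra.
Qed.

End FiniteSums.

Lemma hsum_series {R : realType} (a : nat -> R) (S : R) :
  hsum a S -> series a @ \oo --> S.
Proof.
move=> aS; apply/cvgrPdist_le => e e0; have [s Hs] := aS _ e0.
exists (\max_(i <- s) i).+1 => //= n /= ln; rewrite distrC /series /=.
rewrite Hs ?iota_uniq // => i si; rewrite mem_index_iota /=.
by apply: leq_ltn_trans ln; rewrite (big_rem i) //= leq_maxl.
Qed.

Section DoubleSums.
Context {R : realType} {I J : eqType}.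
Variables (a : J -> I -> R) (C : J -> R) (D : R).
Hypotheses (aC : forall j, abs_le (a j) (C j)) (CD : abs_le C D).

Lemma abs_le_pair : abs_le (fun p : J * I => a p.1 p.2) D.
Proof.
move=> s us; pose t := [seq (j, i) | j <- undup (map fst s), i <- undup (map snd s)].
have ut : uniq t by rewrite allpairs_uniq ?undup_uniq //; case=> ? ? [].
have st : {subset s <= t}.
  by move=> p ps; apply/allpairsP; exists p; rewrite !mem_undup !map_f; case: p ps.
apply: le_trans (sum_subset (F := fun p : J * I => `|a p.1 p.2|) us ut st _) _ => //.
rewrite big_allpairs /=; apply: (le_trans _ (CD (undup_uniq (map fst s)))).
apply: ler_sum => j _; apply: le_trans (@aC j _ (undup_uniq _)) _; exact: ler_norm.
Qed.

(** Fubini. A large finite set [u] of pairs is completed to a rectangle [r], which differs from [u]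
    by a tail of the absolutely convergent double family, from the row sums by a small error per
    row, and whose row sums add up to nearly [T]. *)
Lemma hsum_pair (S : J -> R) (T : R) : (forall j, hsum (a j) (S j)) -> hsum S T ->
  hsum (fun p : J * I => a p.1 p.2) T.
Proof.
move=> aS ST e e0; have e3 : 0 < e / 3 by lra.
have [t0 ut0 tail] := abs_le_tail (@abs_le_pair) e3.
have [s0 Hs0] := ST _ e3.
exists t0 => u uu t0u.
pose s := undup (s0 ++ map fst u); have us : uniq s := undup_uniq _.
(* The error [e / 3] is shared among the rows of the rectangle; the [+ 1] keeps the denominator
   positive when [s] is empty. *)
have e4 : 0 < e / 3 / ((size s)%:R + 1) by rewrite divr_gt0 // ltr_wpDl.
have [f Hf] := choice (fun j => aS j _ e4).
pose t := undup (flatten (map f s) ++ map snd u).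
have utt : uniq t := undup_uniq _.
pose r := [seq (j, i) | j <- s, i <- t].
have ur : uniq r by rewrite allpairs_uniq //; case=> ? ? [].
have u_r : {subset u <= r}.
  move=> p pu; apply/allpairsP; exists p; rewrite !mem_undup !mem_cat !map_f ?orbT //.
  by case: p pu.
have h1 : `|\sum_(p <- r) a p.1 p.2 - \sum_(p <- u) a p.1 p.2| <= e / 3.
  rewrite (sum_diff _ uu ur u_r) addrC addKr (le_trans (ler_norm_sum _ _ _)) //.
  rewrite -big_filter tail ?filter_uniq // => p; rewrite mem_filter => /andP[pu _].
  by apply: contra pu => /t0u.
have h2 : `|\sum_(p <- r) a p.1 p.2 - \sum_(j <- s) S j| <= e / 3.
  rewrite big_allpairs /= -sumrB (le_trans (ler_norm_sum _ _ _)) //.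
  apply: (@le_trans _ _ (\sum_(j <- s) (e / 3 / ((size s)%:R + 1)))).
    rewrite !big_seq ler_sum // => j js; apply: Hf => // i fi.
    rewrite mem_undup mem_cat; apply/orP; left; apply/flattenP.
    by exists (f j) => //; rewrite map_f.
  rewrite big_const_seq count_predT iter_addr_0 -(mulr_natr (e / 3 / _)) -mulrA ger_pMr // mulrC.
  by rewrite ler_pdivrMr ?mul1r ?lerDl // ltr_wpDl.
have h3 : `|\sum_(j <- s) S j - T| <= e / 3.
  by apply: Hs0 => // j js; rewrite mem_undup mem_cat js.
move: h1 h2 h3; rewrite !ler_norml => /andP[? ?] /andP[? ?] /andP[? ?].
apply/andP; split; lra.
Qed.

End DoubleSums.

Section Reindex.
Context {R : realType} {I : countType}.
Variable a : I -> R.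

(** Moves a family over a countable type to [nat], the index type of the series in [ana]; numbers
    that encode nothing receive the neutral value [z]. *)
Definition on_codes {T} (z : T) (b : I -> T) (n : nat) : T :=
  if @pickle_inv I n is Some i then b i else z.

Lemma sum_codes (b : I -> R) s :
  \sum_(n <- s) on_codes 0 b n = \sum_(i <- pmap (@pickle_inv I) s) b i.
Proof.
elim: s => [|n s IH]; rewrite ?big_nil //= big_cons IH /on_codes.
by case: pickle_inv => [i|] /=; rewrite ?big_cons ?add0r.
Qed.

Lemma pmap_codes_uniq s : uniq s -> uniq (pmap (@pickle_inv I) s).
Proof. exact/pmap_uniq/pickle_invK. Qed.

Lemma abs_le_codes C : abs_le a C -> abs_le (on_codes 0 a) C.
Proof.
move=> aC s us; apply: (le_trans _ (aC _ (pmap_codes_uniq us))).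
rewrite -sum_codes ler_sum // => n _; rewrite /on_codes.
by case: pickle_inv => //; rewrite normr0.
Qed.

Lemma hsum_codes S : hsum a S -> hsum (on_codes 0 a) S.
Proof.
move=> aS e e0; have [s Hs] := aS _ e0; exists (map pickle s) => t ut st.
rewrite sum_codes Hs ?pmap_codes_uniq // => i si.
by rewrite mem_pmap -(@pickleK_inv I i) map_f // st // map_f.
Qed.

End Reindex.

(** * Power series on polydiscs *)

Definition monom {R : realType} {V : finType} (x : V -> R) (al : V -> nat) : R :=
  \prod_i x i ^+ al i.

Section Monomials.
Context {R : realType} {V : finType}.
Implicit Types (x y : V -> R) (al : V -> nat).

Lemma monomD x al be : monom x (fun i => al i + be i)%N = monom x al * monom x be.
Proof. by rewrite /monom -big_split; apply: eq_bigr => i _; rewrite exprD. Qed.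

Lemma norm_monom x al : `|monom x al| = monom (fun i => `|x i|) al.
Proof. by rewrite /monom normr_prod; apply: eq_bigr => i _; rewrite normrX. Qed.

Lemma monom_ge0 x al : (forall i, 0 <= x i) -> 0 <= monom x al.
Proof. by move=> x0; rewrite prodr_ge0 // => i _; rewrite exprn_ge0. Qed.

Lemma ler_monom x y al : (forall i, `|x i| <= y i) -> `|monom x al| <= monom y al.
Proof.
move=> xy; rewrite norm_monom ler_prod // => i _.
by rewrite exprn_ge0 //= lerXn2r ?nnegrE // (le_trans _ (xy i)).
Qed.

Lemma monom_cst (r : R) al : monom (fun=> r) al = r ^+ (\sum_i al i)%N.
Proof. by rewrite /monom prodrXr. Qed.

Lemma monom_1 x i : monom x (fun j => (j == i) : nat) = x i.
Proof.
rewrite /monom (bigD1 i) //= eqxx expr1 big1 ?mulr1 // => j /negbTE ->.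
by rewrite expr0.
Qed.

Lemma monom_0 x : monom x (fun=> 0%N) = 1.
Proof. by rewrite /monom big1 // => i _; rewrite expr0. Qed.

End Monomials.

(* [f] is the sum of a power series in the coordinate functions [X], with
   weighted l1 norm at most [C] on the polydisc of radii [rho].  The monomials
   are listed with possible repetitions, which makes sums and products of such
   series free of any bookkeeping on multi-indices. *)
Definition ana {R : realType} {T : Type} {V : finType} (X : T -> V -> R)
    (rho : V -> R) (C : R) (f : T -> R) : Prop :=
  exists (c : nat -> R) (al : nat -> V -> nat),
    abs_le (fun k => c k * monom rho (al k)) C /\
    forall p, (forall i, `|X p i| <= rho i) ->
      hsum (fun k => c k * monom (X p) (al k)) (f p).

Section Ana.
Context {R : realType} {T : Type} {V : finType}.
Variables (X : T -> V -> R) (rho : V -> R).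
Implicit Types (f g : T -> R) (C : R).
Local Notation dom p := (forall i, `|X p i| <= rho i).
Local Notation ana := (ana X rho).

Lemma ler_term p c al : dom p -> `|c * monom (X p) al| <= `|c * monom rho al|.
Proof.
move=> dp; rewrite !normrM ler_wpM2l // (le_trans (ler_monom _ dp)) //.
exact: ler_norm.
Qed.

Lemma ana_intro (I : countType) (c : I -> R) (al : I -> V -> nat) C f :
  abs_le (fun k => c k * monom rho (al k)) C ->
  (forall p, dom p -> hsum (fun k => c k * monom (X p) (al k)) (f p)) ->
  ana C f.
Proof.
move=> cC cf; exists (on_codes 0 c), (on_codes (fun=> 0%N) al).
have E x : on_codes 0 (fun k => c k * monom x (al k)) =1
    (fun n => on_codes 0 c n * monom x (on_codes (fun=> 0%N) al n)).
  by move=> n; rewrite /on_codes; case: pickle_inv => //; rewrite mul0r.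
split=> [|p dp]; first exact: eq_abs_le (E _) (abs_le_codes cC).
by apply: eq_hsum (E _) (hsum_codes (cf p dp)).
Qed.

Lemma ana_bound C f p : ana C f -> dom p -> `|f p| <= C.
Proof.
case=> c [al [cC cf]] dp; apply: hsum_le (cf p dp).
by apply: abs_leW cC => // k; apply: ler_term.
Qed.

Lemma ana_ge0 C f : ana C f -> 0 <= C.
Proof. by case=> c [al [cC _]]; apply: abs_le_ge0 cC. Qed.

Lemma ana_le C D f : C <= D -> ana C f -> ana D f.
Proof.
move=> CD [c [al [cC cf]]]; exists c, al; split => //.
exact: abs_leW cC.
Qed.

Lemma eq_ana C f g : (forall p, dom p -> f p = g p) -> ana C f -> ana C g.
Proof.
by move=> fg [c [al [cC cf]]]; exists c, al; split => // p dp; rewrite -fg //; apply: cf.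
Qed.

(** By Fubini a summable family of series is one series indexed by [J * nat]. The closure under
    sums, products, substitution and geometric limits all comes from this. *)
Lemma ana_hsum (J : countType) (f : J -> T -> R) (C : J -> R) D g :
  (forall j, ana (C j) (f j)) -> abs_le C D ->
  (forall p, dom p -> hsum (fun j => f j p) (g p)) -> ana D g.
Proof.
move=> fC CD fg.
have [c /choice [al H]] := choice fC.
apply: (@ana_intro (J * nat)%type (fun q => c q.1 q.2) (fun q => al q.1 q.2)).
  by apply: (@abs_le_pair _ _ _ (fun j k => c j k * monom rho (al j k)) _ _ _ CD) => j;
    have [] := H j.
move=> p dp; apply: (@hsum_pair _ _ _ (fun j k => c j k * monom (X p) (al j k)) C D) (fg p dp) => //.
  move=> j; have [hj _] := H j; apply: abs_leW hj => // k; exact: ler_term.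
by move=> j; have [_] := H j; apply.
Qed.

Lemma ana_term c al : ana `|c * monom rho al| (fun p => c * monom (X p) al).
Proof.
apply: (@ana_intro unit (fun=> c) (fun=> al)) => [s us|p _].
  case: s us => [|[] [|[] s]] //= _; first by rewrite big_nil.
  by rewrite big_seq1.
have := @hsum_finite _ _ (fun _ : unit => c * monom (X p) al) [:: tt] isT.
by rewrite big_seq1; apply; case.
Qed.

Lemma ana_cst c : ana `|c| (fun=> c).
Proof. by have := ana_term c (fun=> 0%N); rewrite monom_0 mulr1; apply: eq_ana => p _; rewrite monom_0 mulr1. Qed.

Lemma ana_0 : ana 0 (fun=> 0).
Proof. by have := ana_cst 0; rewrite normr0. Qed.

Lemma anaM_term c al C f : ana C f ->
  ana (`|c * monom rho al| * C) (fun p => c * monom (X p) al * f p).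
Proof.
move=> [d [be [dC df]]].
exists (fun k => c * d k), (fun k i => al i + be k i)%N; split=> [s us|p dp].
  apply: (le_trans _ (ler_wpM2l _ (dC s us))) => //.
  rewrite big_distrr ler_sum //= => k _.
  by rewrite monomD -normrM le_eqVlt mulrACA eqxx.
apply: eq_hsum (hsumZ (c * monom (X p) al) (df p dp)) => k.
by rewrite monomD mulrACA.
Qed.

Lemma anaM C D f g : ana C f -> ana D g -> ana (C * D) (fun p => f p * g p).
Proof.
move=> [c [al [cC cf]]] Dg.
apply: (ana_hsum (fun k => anaM_term (c k) (al k) Dg)) => [s us|p dp].
  apply: (le_trans _ (ler_wpM2r (ana_ge0 Dg) (cC s us))).
  rewrite big_distrl ler_sum //= => k _.
  by rewrite normrM normr_id ger0_norm // (ana_ge0 Dg).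
by rewrite mulrC; apply: eq_hsum (hsumZ (g p) (cf p dp)) => k; rewrite mulrC.
Qed.

Lemma anaZ C c f : ana C f -> ana (`|c| * C) (fun p => c * f p).
Proof. by move/(anaM (ana_cst c)). Qed.

Lemma anaD C D f g : ana C f -> ana D g -> ana (C + D) (fun p => f p + g p).
Proof.
move=> Cf Dg.
apply: (@ana_hsum bool (fun b : bool => if b then f else g) (fun b : bool => if b then C else D)) => [[]||p dp] //.
  move=> s us; have ut : uniq [:: true; false] by [].
  apply: le_trans (sum_subset (F := fun b : bool => `|if b then C else D|) us ut _ _) _ => //.
    by case.
  by rewrite big_cons big_seq1 /= !ger0_norm // (ana_ge0 Cf, ana_ge0 Dg).
have := @hsum_finite _ _ (fun b : bool => (if b then f else g) p) [:: true; false] isT.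
by rewrite big_cons big_seq1 /=; apply; case.
Qed.

Lemma anaN C f : ana C f -> ana C (fun p => - f p).
Proof.
move/(anaZ (-1)); rewrite normrN1 mul1r; apply: eq_ana => p _; exact: mulN1r.
Qed.

Lemma anaB C D f g : ana C f -> ana D g -> ana (C + D) (fun p => f p - g p).
Proof. by move=> Cf /anaN; apply: anaD. Qed.

Lemma ana_sum (I : Type) (s : seq I) (C : I -> R) (f : I -> T -> R) :
  (forall i, ana (C i) (f i)) ->
  ana (\sum_(i <- s) C i) (fun p => \sum_(i <- s) f i p).
Proof.
move=> Cf; elim: s => [|i s IH].
  by rewrite big_nil; apply: eq_ana ana_0 => p _; rewrite big_nil.
by rewrite big_cons; apply: eq_ana (anaD (Cf i) IH) => p _; rewrite big_cons.
Qed.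

Lemma anaX C f n : ana C f -> ana (C ^+ n) (fun p => f p ^+ n).
Proof.
move=> Cf; elim: n => [|n IH].
  by have := ana_cst 1; rewrite normr1.
rewrite exprS; apply: eq_ana (anaM Cf IH) => p _; by rewrite exprS.
Qed.

Lemma ana_prod (I : Type) (s : seq I) (C : I -> R) (f : I -> T -> R) :
  (forall i, ana (C i) (f i)) ->
  ana (\prod_(i <- s) C i) (fun p => \prod_(i <- s) f i p).
Proof.
move=> Cf; elim: s => [|i s IH].
  by rewrite big_nil; have := ana_cst 1; rewrite normr1; apply: eq_ana => p _; rewrite big_nil.
by rewrite big_cons; apply: eq_ana (anaM (Cf i) IH) => p _; rewrite big_cons.
Qed.

Lemma ana_coord i : 0 <= rho i -> ana (rho i) (fun p => X p i).
Proof.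
move=> ri; have := ana_term 1 (fun j => (j == i) : nat).
rewrite monom_1 mul1r ger0_norm //; apply: eq_ana => p _.
by rewrite monom_1 mul1r.
Qed.

(** Density of polynomials for the weighted norm, used to extend an identity from polynomials to
    series. *)
Lemma ana_truncate C f e : ana C f -> 0 < e -> exists (c : nat -> R) (al : nat -> V -> nat) s,
  ana e (fun p => f p - \sum_(k <- s) c k * monom (X p) (al k)).
Proof.
move=> [c [al [cC cf]]] e0; have [s us tail] := abs_le_tail cC e0.
exists c, al, s.
apply: (@ana_intro nat (fun k => if k \in s then 0 else c k) al) => [t ut|p dp].
  apply: (le_trans _ (tail [seq k <- t | k \notin s] _ _)); last 2 first.
  - exact: filter_uniq.
  - by move=> k; rewrite mem_filter => /andP[].
  rewrite big_filter [X in _ <= X]big_mkcond ler_sum // => k _.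
  by case: (k \in s); rewrite ?mul0r ?normr0.
have h : hsum (fun k => if k \in s then c k * monom (X p) (al k) else 0)
    (\sum_(k <- s) c k * monom (X p) (al k)).
  have := @hsum_finite _ _ (fun k => if k \in s then c k * monom (X p) (al k) else 0) s us.
  rewrite (eq_big_seq (fun k => c k * monom (X p) (al k))); last by move=> k /= ->.
  by apply=> k /negbTE ->.
rewrite -mulN1r; apply: eq_hsum (hsumD (cf p dp) (hsumZ (-1) h)) => k /=.
case: (k \in s); ring.
Qed.

End Ana.

Lemma ana_radius {R : realType} {T : Type} {V : finType} (X : T -> V -> R)
    (rho sigma : V -> R) C f :
  (forall i, 0 <= sigma i <= rho i) -> ana X rho C f -> ana X sigma C f.
Proof.
move=> sr [c [al [cC cf]]]; exists c, al; split=> [|p dp].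
  apply: abs_leW cC => // k; rewrite !normrM ler_wpM2l //.
  have h i : `|sigma i| <= rho i by have /andP[? ?] := sr i; rewrite ger0_norm.
  by rewrite (le_trans (ler_monom _ h)) // ler_norm.
by apply: cf => i; have /andP[_] := sr i; apply: le_trans.
Qed.

(** The norm is submultiplicative, so substituting functions of norm at most [rho i] turns each
    monomial into a function of norm at most its value at [rho]; the norm bound [C] is unchanged. *)
Lemma ana_comp {R : realType} {T T' : Type} {V V' : finType} (X : T -> V -> R)
    (rho : V -> R) (X' : T' -> V' -> R) (rho' : V' -> R) (G : T' -> T) C f :
  (forall i, ana X' rho' (rho i) (fun p => X (G p) i)) ->
  ana X rho C f -> ana X' rho' C (f \o G).
Proof.
move=> XG [c [al [cC cf]]].
apply: (@ana_hsum _ _ _ X' rho' nat (fun k p => c k * monom (X (G p)) (al k)) (fun k => `|c k * monom rho (al k)|)).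
- move=> k; rewrite normrM (ger0_norm (monom_ge0 _ _)); last first.
    by move=> i; apply: ana_ge0 (XG i).
  by apply: anaZ; apply: ana_prod => i; apply: anaX; apply: XG.
- by move=> s us; under eq_bigr do rewrite normr_id; apply: cC.
- by move=> p dp; apply: cf => i; apply: (ana_bound (XG i) dp).
Qed.

(** * Taylor expansion *)

Definition coords {R : realType} {n : nat} (h : 'rV[R]_n) (i : 'I_n) : R := h 0 i.

Definition pana {R : realType} {n : nat} (r : R) := ana (@coords R n) (fun=> r).

Definition in_polydisc {R : realType} {n : nat} (r : R) (h : 'rV[R]_n) :=
  forall i, `|h 0 i| <= r.

(** The boolean [[forall j, b j == (j == i)]] says that [b] is the [i]-th unit multi-index, so the
    constant and linear parts are subtracted. Nothing remains in degree at most 1; in degree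
    [k >= 2] the bound is [eta ^ k <= (eta / d) ^ 2 * d ^ k], as [eta <= d]. *)
Lemma monom_taylor {R : realType} {V : finType} (v : V -> R) (b : V -> nat) (eta d : R) :
  0 < d -> eta <= d -> (forall i, `|v i| <= eta) ->
  `|monom v b - monom (fun=> 0) b - \sum_i v i * [forall j, b j == (j == i)]%:R|
    <= (eta / d) ^+ 2 * monom (fun=> d) b.
Proof.
move=> d0 etad veta.
case: (pickP (fun i => b i != 0)%N) => [i bi|b0]; last first.
  have {}b0 : b = (fun=> 0%N) by apply/funext => i; have /negbT/negPn/eqP := b0 i.
  rewrite b0 !monom_0 subrr big1 ?subrr ?normr0 ?mulr1 ?sqr_ge0 // => i _.
  case: forallP => [/(_ i)|]; first by rewrite eqxx.
  by rewrite mulr0.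
have eta0 : 0 <= eta by apply: le_trans (veta i).
have -> : monom (fun=> 0) b = 0 :> R.
  by apply/eqP/prodf_eq0; exists i => //; rewrite expr0n (negbTE bi).
case: (pickP (fun i => [forall j, b j == (j == i)])) => [k bk|b1].
  have -> : monom v b = v k.
    rewrite -[RHS](monom_1 v k); congr monom; apply/funext => j.
    by have /forallP/(_ j)/eqP := bk.
  rewrite (bigD1 k) //= bk mulr1 big1 ?addr0 ?subr0 ?subrr ?normr0.
    by rewrite mulr_ge0 ?sqr_ge0 // monom_ge0 // => _; exact: ltW.
  move=> j jk; case: forallP => [/(_ k)|]; last by rewrite mulr0.
  by have /forallP/(_ k) := bk; rewrite eqxx => /eqP->; rewrite (eq_sym k) (negbTE jk).
rewrite big1 ?subr0; last by move=> j _; rewrite b1 mulr0.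
have deg2 : (1 < \sum_i b i)%N.
  rewrite ltn_neqAle lt0n; apply/andP; split; last first.
    by rewrite sum_nat_eq0; apply/forall_inPn; exists i.
  rewrite eq_sym; apply/negP => /sum_nat_eq1[k [_ bk bj]].
  have /negP := negbT (b1 k); apply; apply/forallP => j.
  case: (eqVneq j k) => [->|jk]; rewrite ?bk ?bj //.
rewrite (le_trans (ler_monom _ veta)) // !monom_cst.
move: deg2; case: (\sum_i b i)%N => [//|[//|m _]].
have -> : (eta / d) ^+ 2 * d ^+ m.+2 = d ^+ m * eta ^+ 2.
  by rewrite !exprS; field; rewrite gt_eqF.
rewrite -[m.+2]addn2 exprD ler_wpM2r ?sqr_ge0 // lerXn2r ?nnegrE //; exact: ltW.
Qed.

Section Taylor.
Context {R : realType} {n : nat}.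
Implicit Types (f : 'rV[R]_n -> R) (h v : 'rV[R]_n).

(** Since [s + d <= r], the function [f (h + v)] is a power series of norm at most [C] in twice as
    many variables, with radii [s] for [h] and [d] for [v]. The [g i] collect the terms of degree
    one in [v]; such a term carries a factor [d] in its weight, whence the bound [C / d]. *)
Lemma pana_taylor f (r C s d : R) : pana r C f -> 0 <= s -> 0 < d -> s + d <= r ->
  exists g : 'I_n -> 'rV[R]_n -> R, (forall i, pana s (C / d) (g i)) /\
    forall h v eta, in_polydisc s h -> in_polydisc eta v -> 0 <= eta -> eta <= d ->
      `|f (h + v) - f h - \sum_i v 0 i * g i h| <= C * (eta / d) ^+ 2.
Proof.
move=> fC s0 d0 sdr.
pose X (p : 'rV[R]_n * 'rV[R]_n) (i : 'I_n + 'I_n) : R :=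
  match i with inl i => p.1 0 i | inr i => p.2 0 i end.
pose rho (i : 'I_n + 'I_n) : R := match i with inl _ => s | inr _ => d end.
have rho0 i : 0 <= rho i by case: i => i //=; apply: ltW.
have [c [al [cC cf]]] : ana X rho C (f \o (fun p => p.1 + p.2)).
  apply: ana_comp fC => i; apply: (ana_le sdr).
  have := anaD (ana_coord X (rho0 (inl i))) (ana_coord X (rho0 (inr i))).
  by apply: eq_ana => p _; rewrite /coords mxE.
pose aL k i := al k (inl i); pose aR k i := al k (inr i).
have E p k : monom (X p) (al k) = monom (p.1 0) (aL k) * monom (p.2 0) (aR k).
  by rewrite /monom big_sumType.
have Er k : monom rho (al k) = monom (fun=> s) (aL k) * monom (fun=> d) (aR k).
  by rewrite /monom big_sumType.
pose e (i : 'I_n) k : R := [forall j, aR k j == (j == i)]%:R.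
have gC i : abs_le (fun k => c k * e i k * monom (fun=> s) (aL k)) (C / d).
  move=> t ut; rewrite ler_pdivlMr // big_distrl /= (le_trans _ (cC t ut)) //.
  apply: ler_sum => k _; rewrite Er /e; case: forallP => [ak|_].
    have -> : monom (fun=> d) (aR k) = d.
      have -> : aR k = (fun j => (j == i) : nat).
        by apply/funext => j; apply/eqP; apply: ak.
      exact: monom_1.
    by rewrite mulr1 !normrM (gtr0_norm d0) mulrA.
  by rewrite mulr0 mul0r normr0 mul0r.
have [g Hg] : exists g : 'I_n -> 'rV[R]_n -> R, forall i h, in_polydisc s h ->
    hsum (fun k => c k * e i k * monom (h 0) (aL k)) (g i h).
  suff /choice[g Hg] : forall ih : 'I_n * 'rV[R]_n, exists S, in_polydisc s ih.2 ->
    hsum (fun k => c k * e ih.1 k * monom (ih.2 0) (aL k)) S.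
    by exists (fun i h => g (i, h)) => i h; apply: (Hg (i, h)).
  case=> i h /=; case: (pselect (in_polydisc s h)) => [sh|]; last by exists 0.
  have [S HS] : exists S, hsum (fun k => c k * e i k * monom (h 0) (aL k)) S.
    apply: (@abs_le_hsum _ _ _ (C / d)); apply: abs_leW (gC i) => // k.
    by apply: (@ler_term _ _ _ (@coords R n)).
  by exists S.
exists g; split=> [i|h v eta sh etav eta0 etad].
  by exists (fun k => c k * e i k), aL; split => [|h /Hg] //; apply: gC.
have dom w eta' : eta' <= d -> in_polydisc eta' w -> forall i, `|X (h, w) i| <= rho i.
  by move=> ed hw [i|i] /=; [apply: sh|apply: le_trans (hw i) ed].
have h1 := cf (h, v) (dom _ _ etad etav).
have h2 : hsum (fun k => c k * monom (X (h, 0)) (al k)) (f h).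
  have -> : f h = (f \o (fun p => p.1 + p.2)) (h, 0) by rewrite /= addr0.
  by apply: cf; apply: (@dom _ 0 (ltW d0)) => i; rewrite mxE normr0.
have h3 : hsum (fun k => \sum_i v 0 i * (c k * e i k * monom (h 0) (aL k)))
    (\sum_i v 0 i * g i h).
  elim: (index_enum _) => [|i t IH].
    have := @hsum_finite R nat (fun=> 0) [::] isT; rewrite big_nil => /(_ (fun _ _ => erefl)).
    by rewrite big_nil; apply: eq_hsum => k; rewrite big_nil.
  rewrite big_cons; apply: eq_hsum (hsumD (hsumZ (v 0 i) (Hg i h sh)) IH) => k.
  by rewrite big_cons.
have h4 := hsumD (hsumD h1 (hsumZ (-1) h2)) (hsumZ (-1) h3).
rewrite /= !mulN1r in h4; apply: hsum_le h4 => t ut.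
rewrite mulrC; apply: (le_trans _ (ler_wpM2l _ (cC t ut))); last exact: sqr_ge0.
rewrite big_distrr /= ler_sum // => k _.
rewrite !E /= Er.
have -> : \sum_i v 0 i * (c k * e i k * monom (h 0) (aL k)) =
    c k * monom (h 0) (aL k) * \sum_i v 0 i * e i k.
  by rewrite big_distrr; apply: eq_bigr => i _ /=; ring.
have -> : monom ((0 : 'rV[R]_n) 0) (aR k) = monom (fun=> 0) (aR k).
  by congr monom; apply/funext => i; rewrite mxE.
have -> (x y z u w : R) : x * (y * z) + -1 * (x * (y * u)) + -1 * (x * y * w) = x * y * (z - u - w).
  by ring.
have hS : `|c k * monom (h 0) (aL k)| <= `|c k * monom (fun=> s) (aL k)|.
  exact: (@ler_term _ _ _ (@coords R n)).
have hD := monom_taylor (aR k) d0 etad etav.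
rewrite normrM (le_trans (ler_pM _ _ hS hD)) // (mulrA (c k)) (normrM _ (monom _ (aR k))).
by rewrite mulrCA (@ger0_norm _ (monom (fun=> d) _)) // monom_ge0 // => _; exact: ltW.
Qed.

End Taylor.

(** * Analyticity and absolutely convergent power series *)

Lemma norm_coord {R : realType} {n : nat} (v : 'rV[R]_n) i : `|v 0 i| <= `|v|.
Proof.
rewrite [leRHS]/Num.norm /= mx_normrE.
exact: (le_bigmax _ (fun ij => `|v ij.1 ij.2|) (0, i)).
Qed.

Lemma diff_epsilon {R : realType} {V W : normedModType R} (f : V -> W)
    (L : {linear V -> W}) x : continuous L ->
  (forall e, 0 < e -> \forall v \near 0, `|f (v + x) - f x - L v| <= e * `|v|) ->
  differentiable f x /\ 'd f x = L :> (V -> W).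
Proof.
move=> cL H.
have dL : f \o shift x = cst (f x) + L +o_ 0 id.
  apply/eqaddoP => e e0; apply: filterS (H e e0) => v.
  by rewrite !fctE /= opprD addrA.
have D := diff_unique cL dL; split => //.
by apply/diff_locallyP; rewrite D.
Qed.

Definition pd {R : realType} {n : nat} (i : 'I_n.+1) (f : 'rV[R]_n.+1 -> R) :
  'rV[R]_n.+1 -> R := fun h => 'D_(delta_mx 0 i) f h.

Section Diff.
Context {R : realType} {n : nat}.
Implicit Types (f : 'rV[R]_n.+1 -> R) (h v : 'rV[R]_n.+1).

Lemma diff_quadratic f h (g : 'I_n.+1 -> R) (K d : R) : 0 < d ->
  (forall v eta, in_polydisc eta v -> 0 <= eta -> eta <= d ->
    `|f (h + v) - f h - \sum_i v 0 i * g i| <= K * eta ^+ 2) ->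
  differentiable f h /\ forall v, 'd f h v = \sum_i v 0 i * g i.
Proof.
move=> d0 fg; pose L v : R := \sum_i v 0 i * g i.
have Llin : linear (L : _ -> R^o).
  move=> a u v; rewrite /L scaler_sumr -big_split; apply: eq_bigr => i _.
  by rewrite !mxE mulrDl -mulrA.
pose LM := GRing.isLinear.Build _ _ _ _ _ Llin.
pose Ll : {linear 'rV[R]_n.+1 -> R^o} := HB.pack (L : _ -> R^o) LM.
have cL : continuous (Ll : 'rV[R]_n.+1 -> R^o).
  have @hc i : continuous (fun v : 'rV[R]_n.+1 => v 0 i * g i : R^o).
    by move=> v; exact: (cvgMr_tmp (@coord_continuous R 1 n.+1 0 i v)).
  exact: (@continuous_big R^o _ +%R 0 xpredT add_continuous _ (index_enum _) _ (fun i _ => hc i)).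
have [df D] : differentiable (f : _ -> R^o) h /\ 'd (f : _ -> R^o) h = Ll :> (_ -> _).
  apply: diff_epsilon => // e e0; near=> v.
  have vd : `|v| <= d.
    by near: v; apply/nbhs_ballP; exists d => //= v; rewrite -ball_normE /= sub0r normrN => /ltW.
  have ve : `|v| <= e / (`|K| + 1).
    near: v; apply/nbhs_ballP; exists (e / (`|K| + 1)) => /=.
      by rewrite divr_gt0 // ltr_wpDl.
    by move=> v; rewrite -ball_normE /= sub0r normrN => /ltW.
  rewrite (addrC v); apply: (@le_trans _ _ (K * `|v| ^+ 2)).
    exact: (fg v `|v| (norm_coord v) (normr_ge0 _) vd).
  rewrite expr2 mulrA ler_wpM2r //.
  apply: le_trans (ler_norm _) _; rewrite normrM normr_id.
  apply: le_trans (ler_wpM2l (normr_ge0 _) ve) _.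
  by rewrite mulrA ler_pdivrMr ?ltr_wpDl // mulrC ler_wpM2l ?lerDl // ltW.
by split => // v; rewrite D.
Unshelve. all: by end_near. Qed.

Lemma diff_pd f h v : differentiable f h -> 'd f h v = \sum_i v 0 i * pd i f h.
Proof.
move=> df; rewrite {1}(row_sum_delta v) linear_sum; apply: eq_bigr => i _.
by rewrite linearZ /pd deriveE.
Qed.

(** The Cauchy estimate: a derivative costs the radius [d] and the factor [1 / d]. The quadratic
    remainder identifies the linear coefficients of the Taylor expansion as partial derivatives. *)
Lemma pana_pd f (r C s d : R) : pana r C f -> 0 <= s -> 0 < d -> s + d <= r ->
  [/\ forall h, in_polydisc s h -> differentiable f h,
      forall i, pana s (C / d) (pd i f) &
      forall h v eta, in_polydisc s h -> in_polydisc eta v -> 0 <= eta -> eta <= d ->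
        `|f (h + v) - f h - \sum_i v 0 i * pd i f h| <= C * (eta / d) ^+ 2].
Proof.
move=> fC s0 d0 sdr; have [g [gC Hg]] := pana_taylor fC s0 d0 sdr.
have H h : in_polydisc s h ->
    differentiable f h /\ forall v, 'd f h v = \sum_i v 0 i * g i h.
  move=> sh; apply: (@diff_quadratic f h (g^~ h) (C / d ^+ 2) d) => // v eta etav e0 ed.
  apply: le_trans (Hg _ _ _ sh etav e0 ed) _.
  by rewrite expr_div_n mulrA mulrAC.
have gE i h : in_polydisc s h -> pd i f h = g i h.
  move=> /H[df E]; rewrite /pd deriveE // E (bigD1 i) //= mxE !eqxx mul1r.
  by rewrite big1 ?addr0 // => j ji; rewrite mxE (negbTE ji) mul0r.
split=> [h /H[]//|i|h v eta sh etav e0 ed].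
  by apply: eq_ana (gC i) => h sh; rewrite gE.
have := Hg h v eta sh etav e0 ed.
by under [X in _ - X]eq_bigr do rewrite -gE //.
Qed.

End Diff.

Section Definition_of_analyticity.
Context {R : realType} {n : nat}.
Implicit Types (f : 'rV[R]_n.+1 -> R) (h x : 'rV[R]_n.+1).
Local Notation multi := {ffun 'I_n.+1 -> nat}.

(** The index set of [mpsum] as a list. Boxes are cofinal among the finite sets of multi-indices,
    which links limits of box sums to [hsum]. *)
Definition box (N : nat) : seq multi :=
  [seq [ffun i => val (k i)] | k : {ffun 'I_n.+1 -> 'I_N}].

Lemma box_uniq N : uniq (box N).
Proof.
rewrite map_inj_uniq ?enum_uniq // => k l /ffunP kl; apply/ffunP => i.
by have := kl i; rewrite !ffunE => /val_inj.
Qed.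

Lemma mem_box N (b : multi) : (b \in box N) = [forall i, (b i < N)%N].
Proof.
apply/mapP/forallP => [[k _ ->] i|bN]; first by rewrite ffunE ltn_ord.
pose k : {ffun 'I_n.+1 -> 'I_N} := [ffun i => Ordinal (bN i)].
exists k; first by rewrite mem_enum.
by apply/ffunP => i; rewrite !ffunE.
Qed.

Lemma sum_box (F : ('I_n.+1 -> nat) -> R) N :
  \sum_(b <- box N) F b = \sum_(k : {ffun 'I_n.+1 -> 'I_N}) F (fun i => val (k i)).
Proof.
rewrite big_map big_enum; apply: eq_bigr => k _; congr F.
by apply/funext => i; rewrite ffunE.
Qed.

Lemma box_cofinal (s : seq multi) : exists N0, forall N, (N0 <= N)%N ->
  {subset s <= box N}.
Proof.
exists (\max_(b <- s) \max_i (b i).+1)%N => N sN b bs; rewrite mem_box.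
apply/forallP => i; apply: leq_trans sN.
rewrite (big_rem b) //= leq_max; apply/orP; left.
exact: (leq_bigmax i).
Qed.

Lemma real_analytic_pana f x : real_analytic_at f x ->
  exists r C, 0 < r /\ pana r C (fun h => f (x + h)).
Proof.
move=> [a [r [r0 H]]]; pose r' := r / 2; have r'0 : 0 < r' by rewrite divr_gt0.
have r'r : r' < r by rewrite /r'; lra.
(* At this corner of the smaller polydisc the absolute box sums are the weighted norms of the
   partial sums. The strict [r' < r] is needed because convergence is given on an open polydisc. *)
pose k0 : 'rV[R]_n.+1 := const_mx r'.
have [k0c _] : cvgn (abs_mpsum a k0) /\ mpsum a k0 @ \oo --> f (x + k0).
  by apply: H => i; rewrite mxE gtr0_norm.
have aC : abs_le (fun b : multi => a b * monom (fun=> r') b) (limn (abs_mpsum a k0)).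
  move=> s us; have [N0 /(_ _ (leqnn _)) sN] := box_cofinal s.
  apply: le_trans (sum_subset (F := fun b : multi => `|a b * monom (fun=> r') b|) us (box_uniq N0) sN _) _ => //.
  rewrite (sum_box (fun b => `|a b * monom (fun=> r') b|)).
  have -> : \sum_(k : {ffun 'I_n.+1 -> 'I_N0})
      `|a (fun i => val (k i)) * monom (fun=> r') (fun i => val (k i))| = abs_mpsum a k0 N0.
    by apply: eq_bigr => k _; do 2 congr (_ _); apply: eq_bigr => i _; rewrite mxE.
  apply: nondecreasing_cvgn_le => // m p mp; rewrite /abs_mpsum.
  rewrite -(sum_box (fun b => `|a b * monom (k0 0) b|)) -(sum_box (fun b => `|a b * monom (k0 0) b|)).
  apply: (sum_subset (F := fun b : multi => `|a b * monom (k0 0) b|)); rewrite ?box_uniq //.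
  by move=> b; rewrite !mem_box => /forallP bm; apply/forallP => i; apply: leq_trans mp.
exists r', (limn (abs_mpsum a k0)); split => //.
apply: (@ana_intro _ _ _ _ _ multi (fun b => a b) (fun b => b)) => // h hr.
have [S hS] : exists S, hsum (fun b : multi => a b * monom (h 0) b) S.
  apply: (@abs_le_hsum _ _ _ (limn (abs_mpsum a k0))).
  by apply: abs_leW aC => // b; apply: (@ler_term _ _ _ (@coords R n.+1)).
have hr' i : `|h 0 i| < r by apply: le_lt_trans (hr i) r'r.
have [_ ch] := H h hr'.
suff cS : mpsum a h @ \oo --> S by rewrite -(cvg_unique _ cS ch).
apply/cvgrPdist_le => e e0; have [s Hs] := hS _ e0.
have [N0 HN] := box_cofinal s; exists N0 => //= N /= NN.
rewrite distrC /mpsum -(sum_box (fun b => a b * monom (h 0) b)).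
by apply: Hs; [exact: box_uniq|exact: HN].
Qed.

(** Repeated monomials have to be collected: [a b] is the sum of the [c k] whose monomial is [b],
    and it converges because the weight of [b] at radius [r] is positive. *)
Lemma pana_real_analytic f x (r C : R) : 0 < r -> pana r C (fun h => f (x + h)) ->
  real_analytic_at f x.
Proof.
move=> r0 [c [al [cC cf]]].
pose al' k : multi := [ffun i => al k i].
have alE k : (al' k : _ -> _) = al k by apply/funext => i; rewrite ffunE.
have [a Ha] : exists a : multi -> R, forall b, hsum (fun k => (al' k == b)%:R * c k) (a b).
  suff /choice : forall b : multi, exists S, hsum (fun k => (al' k == b)%:R * c k) S.
    by case=> a Ha; exists a.
  move=> b; have rb : 0 < monom (fun=> r) b by apply: prodr_gt0 => i _; apply: exprn_gt0.
  apply: (@abs_le_hsum _ _ _ (C / monom (fun=> r) b)) => s us.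
  rewrite ler_pdivlMr // big_distrl; apply: (le_trans _ (cC s us)); apply: ler_sum => k _ /=.
  case: eqP => [<-|_]; rewrite ?mul0r ?normr0 ?mul0r // mul1r alE normrM.
  by rewrite ler_wpM2l // ler_norm.
pose a' (b : 'I_n.+1 -> nat) := a [ffun i => b i].
have a'E (b : multi) : a' b = a b by congr a; apply/ffunP => i; rewrite ffunE.
pose t h k := c k * monom (h 0) (al k).
have hbox h s : uniq s -> hsum (fun k => (al' k \in s)%:R * t h k)
    (\sum_(b <- s) a' b * monom (h 0) b).
  elim: s => [_|b s IH /andP[bs us]].
    rewrite big_nil; have := @hsum_finite R nat (fun=> 0) [::] isT.
    rewrite big_nil => /(_ (fun _ _ => erefl)); apply: eq_hsum => k.
    by rewrite in_nil mul0r.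
  rewrite big_cons a'E mulrC.
  apply: eq_hsum (hsumD (hsumZ (monom (h 0) b) (Ha b)) (IH us)) => k.
  rewrite inE; case: eqP => [ab|_]; last by rewrite mul0r mulr0 add0r.
  by rewrite ab (negbTE bs) mul0r addr0 /t -alE ab !mul1r mulrC.
exists a', r; split=> // h hr.
have hr' : in_polydisc r h by move=> i; apply: ltW.
have tC : abs_le (t h) C.
  by apply: abs_leW cC => // k; apply: (@ler_term _ _ _ (@coords R n.+1)).
split.
  apply: nondecreasing_is_cvgn.
    move=> m p mp; rewrite /abs_mpsum.
    rewrite -!(sum_box (fun b => `|a' b * monom (h 0) b|)).
    apply: (sum_subset (F := fun b : multi => `|a' b * monom (h 0) b|)); rewrite ?box_uniq //.
    by move=> b; rewrite !mem_box => /forallP bm; apply/forallP => i; apply: leq_trans mp.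
  exists C => _ [N _ <-]; rewrite /abs_mpsum -(sum_box (fun b => `|a' b * monom (h 0) b|)).
  have [B HB] : exists B : multi -> R, forall b, hsum (fun k => (al' k == b)%:R * `|t h k|) (B b).
    suff /choice : forall b : multi, exists S, hsum (fun k => (al' k == b)%:R * `|t h k|) S.
      by case=> B HB; exists B.
    move=> b; apply: (@abs_le_hsum _ _ _ C); apply: abs_leW tC => // k.
    by rewrite normrM normr_id; case: eqP; rewrite ?normr1 ?normr0 ?mul1r ?mul0r.
  have aB (b : multi) : `|a' b * monom (h 0) b| <= B b.
    have h1 := hsumZ (monom (h 0) b) (Ha b); rewrite a'E mulrC.
    apply: ler_norm_hsum h1 (HB b) => k.
    by case: eqP => [ab|_]; rewrite ?mul0r ?mulr0 ?normr0 // !mul1r /t -alE ab mulrC.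
  apply: (@le_trans _ _ (\sum_(b <- box N) B b)); first exact: ler_sum.
  have hB s : uniq s -> hsum (fun k => (al' k \in s)%:R * `|t h k|) (\sum_(b <- s) B b).
    elim: s => [_|b s IH /andP[bs us]].
      rewrite big_nil; have := @hsum_finite R nat (fun=> 0) [::] isT.
      rewrite big_nil => /(_ (fun _ _ => erefl)); apply: eq_hsum => k.
      by rewrite in_nil mul0r.
    rewrite big_cons; apply: eq_hsum (hsumD (HB b) (IH us)) => k.
    rewrite inE; case: eqP => [ab|_]; last by rewrite mul0r add0r.
    by rewrite ab (negbTE bs) mul0r addr0.
  apply: le_trans (ler_norm _) _; apply: hsum_le (hB _ (box_uniq N)).
  apply: abs_leW tC => // k.
  by rewrite normrM normr_id; case: (_ \in _); rewrite ?normr1 ?normr0 ?mul1r ?mul0r.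
(* Subtracting a box sum leaves the terms whose monomial is outside the box. Once the box contains
   the monomials of the list [s], these terms all belong to the tail. *)
apply/cvgrPdist_le => e e0; have [s us tail] := abs_le_tail tC e0.
have [N0 HN] := box_cofinal (map al' s); exists N0 => //= N /= NN.
rewrite /mpsum -(sum_box (fun b => a' b * monom (h 0) b)).
have := hsumD (cf h hr') (hsumZ (-1) (hbox h (box N) (box_uniq N))).
rewrite mulN1r; apply: hsum_le => u uu.
apply: (le_trans _ (tail [seq k <- u | k \notin s] _ _)); last 2 first.
- exact: filter_uniq.
- by move=> k; rewrite mem_filter => /andP[].
rewrite big_filter [X in _ <= X]big_mkcond ler_sum // => k _.
case: (boolP (k \in s)) => [ks|_].
  by rewrite (HN N NN) ?map_f // mul1r -/(t h k) mulN1r subrr normr0.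
rewrite -/(t h k) -[X in `|X + _|]mul1r mulrA -mulrDl normrM.
by case: (_ \in _); rewrite ?mulr1 ?mulr0 ?subrr ?addr0 ?normr0 ?normr1 ?mul0r ?mul1r.
Qed.

End Definition_of_analyticity.

(** * Germs of analytic functions *)

Section Polydiscs.
Context {R : realType} {n : nat}.
Implicit Types (x h : 'rV[R]_n.+1) (P : 'rV[R]_n.+1 -> Prop).

Lemma near_polydisc x (r : R) : 0 < r -> \forall y \near x, in_polydisc r (y - x).
Proof.
move=> r0; apply/nbhs_ballP; exists r => //= y [_ xy] i.
by have /ltW := xy 0 i; rewrite distrC !mxE.
Qed.

Lemma nbhs_polydisc x P : (\forall y \near x, P y) ->
  exists2 r : R, 0 < r & forall h, in_polydisc r h -> P (x + h).
Proof.
move=> /nbhs_ballP[r /= r0 xP]; exists (r / 2); first by rewrite divr_gt0.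
move=> h hr; apply: xP; split => // i j.
rewrite ord1 /ball /= !mxE opprD addrA subrr add0r normrN.
apply: le_lt_trans (hr j) _; lra.
Qed.

Lemma in_polydiscW (r s : R) h : r <= s -> in_polydisc r h -> in_polydisc s h.
Proof. by move=> rs hr i; apply: le_trans (hr i) rs. Qed.

End Polydiscs.

Lemma near_eq_diff {R : realType} {V W : normedModType R} (f g : V -> W) x :
  {near x, f =1 g} -> differentiable f x -> differentiable g x /\ 'd g x = 'd f x :> (V -> W).
Proof.
move=> fg df; apply: diff_epsilon; first exact: (diff_continuous df).
move=> e e0; have := diff_locally df => /eqaddoP/(_ e e0) H.
have fg0 : \forall v \near 0, f (v + x) = g (v + x).
  by move: fg; rewrite (near_shift 0) /= subr0.
apply: filterS2 H fg0 => v.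
by rewrite !fctE /= opprD addrA => h <-; rewrite -(nbhs_singleton fg).
Qed.

Section PartialDerivatives.
Context {R : realType} {n : nat}.
Implicit Types (f g : 'rV[R]_n.+1 -> R) (x h : 'rV[R]_n.+1).

Lemma near_eq_pd i f g x : {near x, f =1 g} -> pd i f x = pd i g x.
Proof. exact: near_eq_derive. Qed.

Lemma pd_shift i f x h : pd i (fun h => f (x + h)) h = pd i f (x + h).
Proof.
rewrite /pd /derive; set v := delta_mx 0 i.
have -> // : (fun t : R => t^-1 *: (((fun h => f (x + h)) \o shift h) (t *: v) - f (x + h))) =
    (fun t : R => t^-1 *: ((f \o shift (x + h)) (t *: v) - f (x + h))).
by apply/funext => t /=; rewrite (addrCA _ x).
Qed.

Lemma pdD i f g x : differentiable f x -> differentiable g x ->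
  pd i (fun h => f h + g h) x = pd i f x + pd i g x.
Proof. by move=> df dg; rewrite /pd -deriveD //; apply: diff_derivable. Qed.

Lemma pdB i f g x : differentiable f x -> differentiable g x ->
  pd i (fun h => f h - g h) x = pd i f x - pd i g x.
Proof. by move=> df dg; rewrite /pd -deriveB //; apply: diff_derivable. Qed.

Lemma pdM i f g x : differentiable f x -> differentiable g x ->
  pd i (fun h => f h * g h) x = pd i f x * g x + f x * pd i g x.
Proof.
move=> df dg; rewrite /pd (deriveM (diff_derivable df) (diff_derivable dg)).
by rewrite addrC; congr (_ + _); rewrite /GRing.scale /= mulrC.
Qed.

Lemma pd_cst i (c : R) x : pd i (fun=> c) x = 0.
Proof. exact: derive_cst. Qed.

Lemma pd_coord i j x : pd i (fun h => h 0 j) x = (i == j)%:R.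
Proof.
have dj : differentiable (fun h : 'rV[R]_n.+1 => h 0 j) x by apply: differentiable_coord.
rewrite /pd deriveE //.
have @L : {linear 'rV[R]_n.+1 -> R}.
  by exists (fun N : 'rV[R]_n.+1 => N 0 j); do 2![eexists]; do ?[constructor];
     rewrite ?mxE// => ? *; rewrite ?mxE//; move=> ?; rewrite !mxE.
have -> : (fun h : 'rV[R]_n.+1 => h 0 j) = L by [].
by rewrite diff_lin /= ?mxE ?eqxx 1?eq_sym //; apply: coord_continuous.
Qed.

End PartialDerivatives.

(* Keeps unification from unfolding partial derivatives into limits. *)
#[local] Opaque pd.

Section Germs.
Context {R : realType} {n : nat}.
Implicit Types (f g : 'rV[R]_n.+1 -> R) (x h : 'rV[R]_n.+1).
Local Notation an := (@real_analytic_at R n).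

Lemma pana_radius f (r s C : R) : 0 <= s -> s <= r -> pana r C f -> pana s C f.
Proof. by move=> s0 sr; apply: ana_radius => i; rewrite s0. Qed.

Lemma anP f x : an f x <-> exists r C, 0 < r /\ pana r C (fun h => f (x + h)).
Proof.
split; first exact: real_analytic_pana.
by case=> r [C [r0 fC]]; apply: pana_real_analytic fC.
Qed.

Lemma an_small f x : an f x -> exists r, 0 < r /\ forall s, 0 < s -> s <= r ->
  exists C, pana s C (fun h => f (x + h)).
Proof.
move=> /anP[r [C [r0 fC]]]; exists r; split=> // s s0 sr; exists C.
by apply: pana_radius fC => //; apply: ltW.
Qed.

Lemma an_common f g x : an f x -> an g x -> exists r C D, 
  [/\ 0 < r, pana r C (fun h => f (x + h)) & pana r D (fun h => g (x + h))].
Proof.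
move=> /an_small[r [r0 fr]] /an_small[s [s0 gs]].
have m0 : 0 < Num.min r s by rewrite lt_min r0.
have [mr ms] : Num.min r s <= r /\ Num.min r s <= s by rewrite !ge_min !lexx orbT.
have [C fC] := fr _ m0 mr; have [D gD] := gs _ m0 ms.
by exists (Num.min r s), C, D.
Qed.

Lemma near_eq_an f g x : {near x, f =1 g} -> an f x -> an g x.
Proof.
move=> /nbhs_polydisc[r r0 fg] /an_small[s [s0 fs]]; apply/anP.
have m0 : 0 < Num.min r s by rewrite lt_min r0.
have [mr ms] : Num.min r s <= r /\ Num.min r s <= s by rewrite !ge_min !lexx orbT.
have [C fC] := fs _ m0 ms.
exists (Num.min r s), C; split => //; apply: eq_ana fC => h hr.
by apply: fg; apply: in_polydiscW hr.
Qed.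

Lemma an_cst c x : an (fun=> c) x.
Proof. by apply/anP; exists 1, `|c|; split => //; apply: ana_cst. Qed.

Lemma an_coord i x : an (fun h => h 0 i) x.
Proof.
apply/anP; exists 1; eexists; split => //.
apply: eq_ana (anaD (ana_cst _ _ (x 0 i)) (ana_coord (@coords R n.+1) (ler01 : 0 <= (fun=> 1) i))).
by move=> h _; rewrite mxE.
Qed.

Lemma anD f g x : an f x -> an g x -> an (fun h => f h + g h) x.
Proof.
move=> af ag; have [r [C [D [r0 fC gD]]]] := an_common af ag.
by apply/anP; exists r, (C + D); split => //; apply: anaD.
Qed.

Lemma anM f g x : an f x -> an g x -> an (fun h => f h * g h) x.
Proof.
move=> af ag; have [r [C [D [r0 fC gD]]]] := an_common af ag.
by apply/anP; exists r, (C * D); split => //; apply: anaM.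
Qed.

Lemma anN f x : an f x -> an (fun h => - f h) x.
Proof.
by move=> /anP[r [C [r0 fC]]]; apply/anP; exists r, C; split => //; apply: anaN.
Qed.

Lemma anB f g x : an f x -> an g x -> an (fun h => f h - g h) x.
Proof. by move=> af /anN; apply: anD. Qed.

Lemma an_sum (I : Type) (s : seq I) (f : I -> 'rV[R]_n.+1 -> R) x :
  (forall i, an (f i) x) -> an (fun h => \sum_(i <- s) f i h) x.
Proof.
move=> af; elim: s => [|i s IH].
  by under [X in an X]funext do rewrite big_nil; apply: an_cst.
by under [X in an X]funext do rewrite big_cons; apply: anD.
Qed.

Lemma pana_translate f x h (r s C : R) : 0 <= s -> pana r C (fun h => f (x + h)) ->
  (forall i, `|h 0 i| + s <= r) -> pana s C (fun k => f (x + h + k)).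
Proof.
move=> s0 fC hr.
suff : pana s C ((fun h => f (x + h)) \o (fun k => h + k)).
  by apply: eq_ana => k _; rewrite /= addrA.
apply: ana_comp fC => i; apply: (ana_le (hr i)).
apply: eq_ana (anaD (ana_cst _ _ (h 0 i)) (ana_coord (@coords R n.+1) (s0 : 0 <= (fun=> s) i))).
by move=> k _; rewrite /coords mxE.
Qed.

Lemma an_near f x : an f x -> \forall y \near x, an f y.
Proof.
move=> /anP[r [C [r0 fC]]]; have r2 : 0 < r / 2 by rewrite divr_gt0.
apply: filterS (near_polydisc x r2) => y xy.
apply/anP; exists (r / 2), C; split => //.
rewrite -(subrK x y) addrC; apply: pana_translate fC _; first exact: ltW.
by move=> i; have := xy i; lra.
Qed.

Lemma pana_pd_half f x (r C : R) : 0 < r -> pana r C (fun h => f (x + h)) ->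
  (forall h, in_polydisc (r / 2) h -> differentiable f (x + h)) /\
  forall i, pana (r / 2) (C / (r / 2)) (fun h => pd i f (x + h)).
Proof.
move=> r0 fC; have r2 : 0 < r / 2 by rewrite divr_gt0.
have rr : r / 2 + r / 2 <= r by lra.
have [df dC _] := pana_pd fC (ltW r2) r2 rr.
split=> [h /df {}df|i].
  have := differentiable_comp (f := fun y => y - x) (g := fun h => f (x + h)) (x := x + h).
  have -> : (fun h => f (x + h)) \o (fun y => y - x) = f.
    by apply/funext => y /=; rewrite addrC subrK.
  by apply; [apply: differentiableB|rewrite addrAC subrr add0r].
by apply: eq_ana (dC i) => h _; rewrite pd_shift.
Qed.

Lemma an_diff f x : an f x -> differentiable f x.
Proof.
move=> /anP[r [C [r0 fC]]]; have [df _] := pana_pd_half r0 fC.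
rewrite -[x]addr0; apply: df => i; rewrite mxE normr0 ltW // divr_gt0 //.
Qed.

Lemma an_pd i f x : an f x -> an (pd i f) x.
Proof.
move=> /anP[r [C [r0 fC]]]; have [_ dC] := pana_pd_half r0 fC.
by apply/anP; exists (r / 2); eexists; split; [rewrite divr_gt0|apply: dC].
Qed.

Lemma an_smooth k (W : set 'rV[R]_n.+1) f : real_analytic_on W f -> Ck_on k W f.
Proof.
elim: k f => [|k IH] f af.
  by split=> // x /af/an_diff; apply: differentiable_continuous.
split=> [x /af/an_diff|i]; first exact: differentiable_continuous.
split=> [x /af/an_diff|]; first exact: diff_derivable.
by apply: IH => x /af; apply: an_pd.
Qed.

(** Convergence on every polydisc about 0 makes a single expansion serve at all base points, which
    is what the induction on polynomials in [commuting_monom] requires. *)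
Definition entire f := forall (r : R), 0 < r -> exists C, pana r C f.

Lemma entire_an f x : entire f -> an f x.
Proof.
(* This radius leaves room for the unit polydisc around [x]. *)
move=> ef; pose r := 1 + \sum_i `|x 0 i|.
have r0 : 0 < r by rewrite ltr_wpDr // sumr_ge0.
have [C fC] := ef r r0; apply/anP; exists 1, C; split=> //.
have -> : (fun h => f (x + h)) = (fun h => f (0 + x + h)) by apply/funext => h; rewrite add0r.
apply: (@pana_translate _ _ _ r) => //.
  by apply: eq_ana fC => h _; rewrite add0r.
by move=> i; rewrite /r addrC lerD2l (bigD1 i) //= lerDl sumr_ge0.
Qed.

Lemma entire_cst c : entire (fun=> c).
Proof. by move=> r r0; eexists; apply: ana_cst. Qed.

Lemma entire_coord i : entire (fun h => h 0 i).
Proof. by move=> r r0; exists r; exact: (ana_coord (@coords R n.+1) (ltW r0 : 0 <= (fun=> r) i)). Qed.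

Lemma entireM f g : entire f -> entire g -> entire (fun h => f h * g h).
Proof.
by move=> ef eg r r0; have [C fC] := ef r r0; have [D gD] := eg r r0; eexists; apply: (anaM fC gD).
Qed.

Lemma entireD f g : entire f -> entire g -> entire (fun h => f h + g h).
Proof.
by move=> ef eg r r0; have [C fC] := ef r r0; have [D gD] := eg r r0; eexists; apply: (anaD fC gD).
Qed.

Definition commuting f := entire f /\ forall i j h, pd i (pd j f) h = pd j (pd i f) h.

Lemma commuting_cst c : commuting (fun=> c).
Proof.
split=> [|i j h]; first exact: entire_cst.
have E k : pd k (fun=> c) = (fun=> 0) :> ('rV[R]_n.+1 -> R).
  by apply/funext => x; rewrite pd_cst.
by rewrite !E !pd_cst.
Qed.

Lemma commuting_coord k : commuting (fun h => h 0 k).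
Proof.
split=> [|i j h]; first exact: entire_coord.
have E l : pd l (fun h => h 0 k) = (fun=> (l == k)%:R) :> ('rV[R]_n.+1 -> R).
  by apply/funext => x; rewrite pd_coord.
by rewrite !E !pd_cst.
Qed.

Lemma commutingD f g : commuting f -> commuting g -> commuting (fun h => f h + g h).
Proof.
move=> [ef cf] [eg cg]; split=> [|i j h]; first exact: entireD.
have E l : pd l (fun h => f h + g h) = (fun h => pd l f h + pd l g h).
  by apply/funext => x; rewrite pdD //; apply/an_diff/entire_an.
have D k : differentiable (pd k f) h /\ differentiable (pd k g) h.
  by split; apply/an_diff/an_pd/entire_an.
have [dif dig] := D i; have [djf djg] := D j.
rewrite !E (@pdD _ _ i (pd j f) (pd j g) _ djf djg) (@pdD _ _ j (pd i f) (pd i g) _ dif dig).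
by rewrite (cf i j) (cg i j).
Qed.

Lemma commutingM f g : commuting f -> commuting g -> commuting (fun h => f h * g h).
Proof.
move=> [ef cf] [eg cg]; split=> [|i j h]; first exact: entireM.
have E l : pd l (fun h => f h * g h) = (fun h => pd l f h * g h + f h * pd l g h).
  by apply/funext => x; rewrite pdM //; apply/an_diff/entire_an.
have af x : an f x := entire_an x ef; have ag x : an g x := entire_an x eg.
have H k l : pd k (fun h => pd l f h * g h + f h * pd l g h) h =
    pd k (pd l f) h * g h + pd l f h * pd k g h + (pd k f h * pd l g h + f h * pd k (pd l g) h).
  have [df dg] : differentiable (pd l f) h /\ differentiable (pd l g) h.
    by split; apply/an_diff/an_pd.
  rewrite (@pdD _ _ _ (fun h => pd l f h * g h) (fun h => f h * pd l g h)).
  - by rewrite (@pdM _ _ _ (pd l f) g) ?(@pdM _ _ _ f (pd l g)) //; apply: an_diff.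
  - by apply/an_diff/anM => //; exact: an_pd.
  - by apply/an_diff/anM => //; exact: an_pd.
rewrite !E !H (cf i j) (cg i j).
move: (pd j (pd i f) h) (pd j (pd i g) h) (pd i f h) (pd j f h) (pd i g h) (pd j g h) (f h) (g h).
by move=> *; ring.
Qed.

Lemma commuting_monom al : commuting (fun h => monom (h 0) al).
Proof.
suff H s : commuting (fun h => \prod_(i <- s) h 0 i ^+ al i) by exact: H.
elim: s => [|i s IH].
  have -> : (fun h => \prod_(i <- [::]) h 0 i ^+ al i) = (fun=> 1 : R).
    by apply/funext => h; rewrite big_nil.
  exact: commuting_cst.
have -> : (fun h => \prod_(j <- i :: s) h 0 j ^+ al j) =
    (fun h => h 0 i ^+ al i * \prod_(j <- s) h 0 j ^+ al j).
  by apply/funext => h; rewrite big_cons.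
apply: commutingM; last exact: IH.
elim: (al i) => [|k IHk]; first exact: commuting_cst.
have -> : (fun h : 'rV[R]_n.+1 => h 0 i ^+ k.+1) = (fun h => h 0 i * h 0 i ^+ k).
  by apply/funext => h; rewrite exprS.
by apply: commutingM; [apply: commuting_coord|apply: IHk].
Qed.

(* Differentiation is bounded for the norms of [pana], so the identity passes
   from the truncations of the power series to its sum. *)
Lemma pd_comm i j f x : an f x -> pd i (pd j f) x = pd j (pd i f) x.
Proof.
suff P0 g : an g 0 -> pd i (pd j g) 0 = pd j (pd i g) 0.
  have E k g : pd k (fun h => g (x + h)) = (fun h => pd k g (x + h)).
    by apply/funext => h; rewrite pd_shift.
  move=> af; have := P0 (fun h => f (x + h)); rewrite !E addr0; apply.
  move: af => /anP[r [C [r0 fC]]]; apply/anP; exists r, C; split=> //.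
  by apply: eq_ana fC => h _; rewrite add0r.
move=> /anP[r [C [r0]]]; under [X in pana _ _ X]funext do rewrite add0r.
move=> gC; apply/eqP; rewrite -subr_eq0 -normr_le0; apply/ler_addgt0Pr => e e0; rewrite add0r.
(* Two derivatives, with radii going from [r] to [r / 2] to [r / 4], multiply the norm by
   [8 / r ^ 2]. A truncation error of [e * r ^ 2 / 16] thus gives second derivatives of size at most
   [e / 2], and two of them are compared. *)
have K0 : 0 < 16 / r ^+ 2 by rewrite divr_gt0 // exprn_gt0.
have [c [al [s tail]]] := ana_truncate gC (divr_gt0 e0 K0).
pose p h := \sum_(k <- s) c k * monom (coords h) (al k).
have cp : commuting p.
  rewrite /p; elim: s {tail p} => [|k s IH].
    have -> : (fun h => \sum_(k <- [::]) c k * monom (coords h) (al k)) = (fun=> 0).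
      by apply/funext => h; rewrite big_nil.
    exact: commuting_cst.
  have -> : (fun h => \sum_(k <- k :: s) c k * monom (coords h) (al k)) =
      (fun h => c k * monom (coords h) (al k) + \sum_(k <- s) c k * monom (coords h) (al k)).
    by apply/funext => h; rewrite big_cons.
  apply: commutingD; last exact: IH.
  by apply: commutingM; [apply: commuting_cst|apply: commuting_monom].
pose q h := g h - p h.
have qC : pana r (e / (16 / r ^+ 2)) (fun h => q (0 + h)).
  by apply: eq_ana tail => h _; rewrite add0r.
have [_ H1] := pana_pd_half r0 qC.
have r2 : 0 < r / 2 by rewrite divr_gt0.
have B k l : `|pd k (pd l q) 0| <= e / 2.
  have [_ H2] := pana_pd_half r2 (H1 l).
  have := ana_bound (p := 0) (H2 k); rewrite addr0.
  move=> /(_ (fun i => _)) h; apply: le_trans (h _) _.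
    by move=> i'; rewrite /coords mxE normr0 !divr_ge0 // ltW.
  rewrite le_eqVlt; apply/orP; left; apply/eqP; field; rewrite gt_eqF //.
have ag : an g 0 by apply/anP; exists r, C; split => //; apply: eq_ana gC => h _; rewrite add0r.
have E k l : pd k (pd l q) 0 = pd k (pd l g) 0 - pd k (pd l p) 0.
  have ap y : an p y by apply: entire_an; case: cp.
  rewrite -pdB; [|exact/an_diff/an_pd|exact/an_diff/an_pd].
  apply: near_eq_pd.
  apply: filterS (an_near ag) => y agy; rewrite /q pdB //; exact: an_diff.
have -> : pd i (pd j g) 0 - pd j (pd i g) 0 = pd i (pd j q) 0 - pd j (pd i q) 0.
  rewrite (E i j) (E j i); have [_ /(_ i j 0) ->] := cp.
  by rewrite opprB addrA subrK.
by rewrite (splitr e); apply: le_trans (ler_normB _ _) _; rewrite lerD.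
Qed.

End Germs.

(** * Geometrically convergent series of analytic functions *)

Section Geometric.
Context {R : realType}.

(** The second summand is the part of the geometric series still missing after [N] terms; with it
    the induction closes. *)
Lemma sum_geometric_tail (n N : nat) :
  \sum_(0 <= k < N) (if (k < n)%N then 0 else 2^-1 ^+ k) + 2 * 2^-1 ^+ maxn n N
    <= 2 * 2^-1 ^+ n :> R.
Proof.
elim: N => [|N IH]; first by rewrite big_nil add0r maxn0.
rewrite big_nat_recr //= -addrA; apply: le_trans IH; rewrite lerD2l.
case: ltnP => nN.
  by rewrite add0r (maxn_idPl nN).
rewrite (maxn_idPr (leqW nN)) exprS mulrA mulfV ?mul1r //.
by rewrite -mulr2n mulr_natl.
Qed.

Lemma abs_le_geometric_tail (C : R) n : 0 <= C ->
  abs_le (fun k => if (k < n)%N then 0 else C * 2^-1 ^+ k) (C * 2 * 2^-1 ^+ n).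
Proof.
move=> C0 s us; pose N := (\max_(i <- s) i).+1.
have sN : {subset s <= index_iota 0 N}.
  by move=> i si; rewrite mem_index_iota /= ltnS (big_rem i) //= leq_maxl.
pose F k := `|if (k < n)%N then 0 else C * 2^-1 ^+ k| : R.
apply: le_trans (sum_subset (F := F) us (iota_uniq _ _) sN _) _ => // [k|]; first exact: normr_ge0.
have -> : \sum_(i <- index_iota 0 N) F i =
    C * \sum_(0 <= k < N) (if (k < n)%N then 0 else 2^-1 ^+ k).
  rewrite big_distrr /=; apply: eq_bigr => k _; rewrite /F.
  by case: ifP => _; rewrite ?mulr0 ?normr0 // ger0_norm // mulr_ge0 ?exprn_ge0 ?invr_ge0.
rewrite -mulrA ler_wpM2l //; apply: le_trans (sum_geometric_tail n N).
by rewrite lerDl mulr_ge0 ?exprn_ge0 ?invr_ge0.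
Qed.

(** The estimate of every remainder is kept because the partial sums of the Lie series are later
    compared with its sum; [n = 0] says that [w] itself is analytic. *)
Lemma ana_geometric {T : Type} {V : finType} (X : T -> V -> R) (rho : V -> R)
    (f : nat -> T -> R) (C : R) : 0 <= C ->
  (forall k, ana X rho (C * 2^-1 ^+ k) (f k)) ->
  exists w : T -> R, (forall p, (forall i, `|X p i| <= rho i) -> hsum (fun k => f k p) (w p)) /\
    forall n, ana X rho (C * 2 * 2^-1 ^+ n) (fun p => w p - \sum_(0 <= k < n) f k p).
Proof.
move=> C0 fC; have := abs_le_geometric_tail 0 C0; rewrite expr0 mulr1 => aC.
have /choice[w Hw] : forall p, exists S, (forall i, `|X p i| <= rho i) ->
    hsum (fun k => f k p) S.
  move=> p; case: (pselect (forall i, `|X p i| <= rho i)) => [dp|]; last by exists 0.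
  have [S HS] : exists S, hsum (fun k => f k p) S.
    apply: (@abs_le_hsum _ _ _ (C * 2)); apply: abs_leW aC => // k.
    by apply: le_trans (ana_bound (fC k) dp) _; rewrite ler_norm.
  by exists S.
exists w; split => // n.
apply: (@ana_hsum _ _ _ X rho nat (fun k p => if (k < n)%N then 0 else f k p)
  (fun k => if (k < n)%N then 0 else C * 2^-1 ^+ k)).
- by move=> k; case: ifP => _; [apply: ana_0|apply: fC].
- exact: abs_le_geometric_tail.
- move=> p dp.
  have h : hsum (fun k => if (k < n)%N then f k p else 0) (\sum_(0 <= k < n) f k p).
    have := @hsum_finite _ _ (fun k => if (k < n)%N then f k p else 0) (index_iota 0 n) (iota_uniq _ _).
    rewrite (eq_big_seq (fun k => f k p)); last by move=> k; rewrite mem_index_iota /= => ->.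
    by apply => k; rewrite mem_index_iota /= => /negbTE ->.
  rewrite -mulN1r; apply: eq_hsum (hsumD (Hw p dp) (hsumZ (-1) h)) => k /=.
  by case: ifP => _; rewrite ?mulr0 ?addr0 // mulN1r subrr.
Qed.

End Geometric.

Local Notation an := real_analytic_at.

(** * Composition and reciprocals of analytic germs *)

Section CompositionAndInverse.
Context {R : realType} {n : nat}.
Implicit Types (f g : 'rV[R]_n.+1 -> R) (x h : 'rV[R]_n.+1).

(** Without its constant term the series has only monomials of degree at least 1, each of which
    gains a factor [s / r] when the radius shrinks from [r] to [s]. *)
Lemma pana_small f (r s C : R) : 0 < r -> 0 <= s -> s <= r -> pana r C f ->
  pana s (C * (s / r)) (fun h => f h - f 0).
Proof.
move=> r0 s0 sr [c [al [cC cf]]].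
pose z k := [forall i, al k i == 0%N].
apply: (@ana_intro _ _ _ _ _ nat (fun k => if z k then 0 else c k) al) => [t ut|h hs].
  apply: (@le_trans _ _ (\sum_(k <- t) `|c k * monom (fun=> r) (al k)| * (s / r))).
    apply: ler_sum => k _; rewrite /z; case: forallP => [_|nz].
      by rewrite mul0r normr0 mulr_ge0 // divr_ge0 // ltW.
    rewrite !normrM -mulrA ler_wpM2l // !ger0_norm ?monom_ge0 //; last by move=> _; apply: ltW.
    rewrite !monom_cst; case: (posnP (\sum_i al k i)) => [/eqP|].
      by rewrite sum_nat_eq0 => /forallP/= ak; case: nz.
    case: (\sum_i al k i)%N => // m _.
    have -> : r ^+ m.+1 * (s / r) = s * r ^+ m by rewrite exprS; field; rewrite gt_eqF.
    by rewrite exprS ler_wpM2l // lerXn2r // nnegrE ltW.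
  by rewrite -big_distrl /= ler_wpM2r ?divr_ge0 ?cC // ltW.
have h0 : in_polydisc r (0 : 'rV[R]_n.+1) by move=> i; rewrite mxE normr0 ltW.
have hr : in_polydisc r h by move=> i; apply: le_trans (hs i) sr.
rewrite -mulN1r; apply: eq_hsum (hsumD (cf h hr) (hsumZ (-1) (cf 0 h0))) => k.
rewrite /z; case: forallP => [ak|nz].
  have -> : al k = (fun=> 0%N) by apply/funext => i; apply/eqP.
  by rewrite !monom_0 mulN1r subrr mul0r.
have -> : monom (coords (0 : 'rV[R]_n.+1)) (al k) = 0; last by rewrite mulr0 mulr0 addr0.
move/forallP: nz; rewrite negb_forall => /existsP[i ai].
by apply/eqP/prodf_eq0; exists i => //; rewrite /coords mxE expr0n (negbTE ai).
Qed.

Lemma an_vanish f x (e : R) : an f x -> 0 < e -> exists2 r, 0 < r &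
  forall s, 0 < s -> s <= r -> pana s e (fun h => f (x + h) - f x).
Proof.
move=> /anP[r [C [r0 fC]]] e0.
have C0 : 0 <= C by apply: ana_ge0 fC.
have q0 : 0 < e * r / (C + 1) by rewrite divr_gt0 ?mulr_gt0 // ltr_wpDl.
exists (Num.min r (e * r / (C + 1))); first by rewrite lt_min r0.
move=> s s0; rewrite le_min => /andP[sr sq].
have := pana_small r0 (ltW s0) sr fC; rewrite addr0; apply: ana_le.
rewrite mulrA ler_pdivrMr //.
move: sq; rewrite ler_pdivlMr ?ltr_wpDl // => sq; nra.
Qed.

Lemma finite_radius (I : eqType) (t : seq I) (P : I -> R -> Prop) :
  (forall i, exists2 r, 0 < r & forall s, 0 < s -> s <= r -> P i s) ->
  exists2 r, 0 < r & forall s, 0 < s -> s <= r -> {in t, forall i, P i s}.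
Proof.
move=> H; elim: t => [|i t [r r0 Hr]]; first by exists 1.
have [r' r'0 Hi] := H i; exists (Num.min r r'); first by rewrite lt_min r0.
move=> s s0; rewrite le_min => /andP[sr sr'] j; rewrite inE => /orP[/eqP->|jt].
  exact: Hi.
exact: Hr.
Qed.

Lemma an_comp m (f : 'rV[R]_m.+1 -> R) (G : 'rV[R]_n.+1 -> 'rV[R]_m.+1) x :
  (forall i, an (fun y => G y 0 i) x) -> an f (G x) -> an (f \o G) x.
Proof.
move=> aG /anP[r [C [r0 fC]]].
have [s s0 Hs] := finite_radius (index_enum _) (fun i => an_vanish (aG i) r0).
apply/anP; exists s, C; split=> //.
suff : pana s C ((fun k => f (G x + k)) \o (fun h : 'rV[R]_n.+1 => G (x + h) - G x)).
  by apply: eq_ana => h _; rewrite /= addrC subrK.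
apply: ana_comp fC => i.
apply: eq_ana (Hs s s0 (lexx _) i (mem_index_enum i)) => h _.
by rewrite /coords !mxE.
Qed.

(** With [f = a + u] and [u] of norm at most [|a| / 2] on a small polydisc, the reciprocal is the
    geometric series of ratio [- u / a]. *)
Lemma an_inv f x : an f x -> f x != 0 -> an (fun h => (f h)^-1) x.
Proof.
move=> af fx0; set a := f x.
have a0 : 0 < `|a| by rewrite normr_gt0.
have e0 : 0 < `|a| / 2 by rewrite divr_gt0.
have [s s0 Hs] := an_vanish af e0.
pose u h := f (x + h) - a; have {}Hs : pana s (`|a| / 2) u := Hs s s0 (lexx _).
pose F k h := a^-1 * (- a^-1 * u h) ^+ k.
have FC k : pana s (`|a|^-1 * 2^-1 ^+ k) (F k).
  apply: ana_le (anaZ a^-1 (anaX k (anaZ (- a^-1) Hs))).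
  rewrite normrN normfV ler_wpM2l ?invr_ge0 //.
  by rewrite le_eqVlt; apply/orP; left; apply/eqP; congr (_ ^+ _); field; rewrite gt_eqF.
have [|w [Hw wC]] := ana_geometric _ FC; first by rewrite invr_ge0.
apply/anP; exists s; eexists; split => //.
apply: eq_ana (wC 0) => h hs; rewrite big_nil subr0.
have ub : `|u h| <= `|a| / 2 := ana_bound Hs hs.
have z1 : `|- a^-1 * u h| < 1.
  rewrite normrM normrN normfV mulrC ltr_pdivrMr // mul1r; lra.
have h1 := hsum_series (Hw h hs).
have h2 := cvg_geometric_series (a := a^-1) z1.
rewrite (cvg_unique _ h1 h2) //.
have fE : f (x + h) = a + u h by rewrite /u; ring.
have au : a + u h != 0.
  apply/eqP => au; have : `|u h| = `|a| by rewrite -[u h]opprK -normrN opprK; congr (`|_|); lra.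
  lra.
rewrite fE; field.
by rewrite fx0 au.
Qed.

End CompositionAndInverse.

(** * First-order equations and Lie series *)

(** The product of ['C(2k, k)] and [k!] is a product of [k] factors that are at least [k], and the
    binomial is at most [(1 + 1) ^ 2k = 4 ^ k]. *)
Lemma expnn_le_fact k : (k ^ k <= 4 ^ k * k`!)%N.
Proof.
have h1 : ('C(k.*2, k) <= 4 ^ k)%N.
  have -> : (4 ^ k = (1 + 1) ^ k.*2)%N by rewrite -mul2n expnM.
  have kk : (k < k.*2.+1)%N by rewrite ltnS -addnn leq_addr.
  by rewrite Pascal (bigD1 (Ordinal kk)) //= !exp1n !muln1 leq_addr.
apply: leq_trans (leq_mul h1 (leqnn _)).
rewrite bin_ffact ffact_prod.
have -> : (k ^ k = \prod_(i < k) k)%N by rewrite prod_nat_const card_ord.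
apply: leq_prod => i _; rewrite -addnn -addnBA ?leq_addr //.
exact: ltnW.
Qed.

Lemma geometric_le0 {R : realType} (x C : R) :
  (forall k, `|x| <= C * 2^-1 ^+ k) -> x = 0.
Proof.
move=> H; apply/eqP; rewrite -normr_le0; apply/ler_addgt0Pr => e e0; rewrite add0r.
have : geometric C (2^-1 : R) @ \oo --> 0.
  by apply: cvg_geometric; rewrite ger0_norm ?invr_ge0 // invf_lt1 // ltr1n.
move=> /cvgrPdist_le /(_ _ e0)[k _ /(_ k (leqnn k))] /=; rewrite sub0r normrN => he.
by apply: le_trans (H k) (le_trans (ler_norm _) he).
Qed.

Lemma pana_diff {R : realType} {n : nat} (f : 'rV[R]_n.+1 -> R) (r C : R) h : 0 < r ->
  pana r C f -> in_polydisc (r / 2) h -> differentiable f h.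
Proof.
move=> r0 fC; have r2 : 0 < r / 2 by rewrite divr_gt0.
have rr : r / 2 + r / 2 <= r by lra.
by have [df _ _] := pana_pd fC (ltW r2) r2 rr; apply: df.
Qed.

Section FirstOrder.
Context {R : realType} {n : nat}.
Local Notation F := ('rV[R]_n.+1 -> R).
Implicit Types (u v : F * F) (h : 'rV[R]_n.+1).
Local Notation N := n.+1.

Definition dirD (X : 'I_N -> F) (f : F) : F := fun h => \sum_i X i h * pd i f h.

(* The operator [Z + q] on complex functions [u.1 + i u.2], where [Z] is the
   complex vector field [A + i B] and [q] is the function [c + i d]. *)
Definition cop (A B : 'I_N -> F) (c d : F) u : F * F :=
  (fun h => dirD A u.1 h - dirD B u.2 h + (c h * u.1 h - d h * u.2 h),
   fun h => dirD A u.2 h + dirD B u.1 h + (c h * u.2 h + d h * u.1 h)).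

Definition cmul (t : F) u : F * F := (fun h => t h * u.1 h, fun h => t h * u.2 h).

Definition cadd u v : F * F := (fun h => u.1 h + v.1 h, fun h => u.2 h + v.2 h).

Definition pana2 (r C : R) u := pana r C u.1 /\ pana r C u.2.

Definition cdiff u h := differentiable u.1 h /\ differentiable u.2 h.

Variables (A B : 'I_N -> F) (c d : F) (tau : 'I_N -> R).
Local Notation L := (cop A B c d).

Definition lform h := \sum_i tau i * h 0 i.
Local Notation t := lform.

Lemma ana_lform s : 0 <= s -> pana s ((\sum_i `|tau i|) * s) t.
Proof.
move=> s0; rewrite big_distrl; apply: ana_sum => i; apply: anaZ.
exact: (ana_coord (@coords R N) (s0 : 0 <= (fun=> s) i)).
Qed.

Lemma entire_lform : entire t.
Proof. by move=> r r0; eexists; apply: ana_lform; apply: ltW. Qed.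

Lemma diff_lform h : differentiable t h.
Proof. by apply/an_diff/entire_an/entire_lform. Qed.

Lemma pd_sum (I : Type) (s : seq I) i (f : I -> F) h : (forall k, differentiable (f k) h) ->
  differentiable (fun h => \sum_(k <- s) f k h) h /\
  pd i (fun h => \sum_(k <- s) f k h) h = \sum_(k <- s) pd i (f k) h.
Proof.
move=> df; elim: s => [|k s [IH1 IH2]].
  have -> : (fun h => \sum_(k <- [::]) f k h) = (fun=> 0).
    by apply/funext => h'; rewrite big_nil.
  by rewrite big_nil pd_cst; split => //; apply: differentiable_cst.
have -> : (fun h => \sum_(k <- k :: s) f k h) = (fun h => f k h + \sum_(k <- s) f k h).
  by apply/funext => h'; rewrite big_cons.
rewrite big_cons pdD // IH2; split=> //.
exact: (differentiableD (df k) IH1).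
Qed.

Lemma pd_lform i h : pd i t h = tau i.
Proof.
have dc k : differentiable (fun h : 'rV[R]_N => h 0 k) h by apply: differentiable_coord.
have dk k : differentiable (fun h : 'rV[R]_N => tau k * h 0 k) h.
  by apply: (differentiableM (differentiable_cst _ _) (dc k)).
rewrite /lform (proj2 (@pd_sum _ (index_enum _) i (fun k h => tau k * h 0 k) h dk)).
rewrite (bigD1 i) //= big1 ?addr0 => [|k ki].
  by rewrite (@pdM _ _ i (fun=> tau i) _ h (differentiable_cst _ _) (dc i)) pd_cst pd_coord eqxx mul0r mulr1 add0r.
rewrite (@pdM _ _ i (fun=> tau k) _ h (differentiable_cst _ _) (dc k)) pd_cst pd_coord.
by rewrite eq_sym (negbTE ki) mul0r mulr0 addr0.
Qed.

Lemma dirDD X (f g : F) h : differentiable f h -> differentiable g h ->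
  dirD X (fun h => f h + g h) h = dirD X f h + dirD X g h.
Proof.
move=> df dg; rewrite /dirD -big_split; apply: eq_bigr => i _ /=.
by rewrite pdD // mulrDr.
Qed.

Lemma dirDM X (f g : F) h : differentiable f h -> differentiable g h ->
  dirD X (fun h => f h * g h) h = dirD X f h * g h + f h * dirD X g h.
Proof.
move=> df dg; rewrite /dirD big_distrl big_distrr -big_split; apply: eq_bigr => i _ /=.
by rewrite pdM //; ring.
Qed.

Lemma dirD_cst X (a : R) h : dirD X (fun=> a) h = 0.
Proof. by rewrite /dirD big1 // => i _; rewrite pd_cst mulr0. Qed.

Lemma copD u v h : cdiff u h -> cdiff v h ->
  (L (cadd u v)).1 h = (L u).1 h + (L v).1 h /\ (L (cadd u v)).2 h = (L u).2 h + (L v).2 h.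
Proof.
move=> [du1 du2] [dv1 dv2]; rewrite /cop /cadd /=.
by rewrite !dirDD //; split; ring.
Qed.

Lemma copM (f : F) u h : differentiable f h -> cdiff u h ->
  (L (cmul f u)).1 h = f h * (L u).1 h + (dirD A f h * u.1 h - dirD B f h * u.2 h) /\
  (L (cmul f u)).2 h = f h * (L u).2 h + (dirD A f h * u.2 h + dirD B f h * u.1 h).
Proof.
move=> df [du1 du2]; rewrite /cop /cmul /=.
by rewrite !dirDM //; split; ring.
Qed.

(* [Z t = 1], so that the commutator of [L] with multiplication by [t] is the
   identity. *)
Definition adapted h := \sum_i A i h * tau i = 1 /\ \sum_i B i h * tau i = 0.

Lemma copXM k u h : adapted h -> cdiff u h ->
  (L (cmul (fun h => t h ^+ k.+1) u)).1 h = t h ^+ k.+1 * (L u).1 h + k.+1%:R * t h ^+ k * u.1 h /\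
  (L (cmul (fun h => t h ^+ k.+1) u)).2 h = t h ^+ k.+1 * (L u).2 h + k.+1%:R * t h ^+ k * u.2 h.
Proof.
move=> [At Bt] du.
have dX m : differentiable (fun h => t h ^+ m) h.
  elim: m => [|m IH]; first exact: differentiable_cst.
  have -> : (fun h => t h ^+ m.+1) = (fun h => t h * t h ^+ m).
    by apply/funext => h'; rewrite exprS.
  exact: (differentiableM (diff_lform h) IH).
have E X : dirD X (fun h => t h ^+ k.+1) h = k.+1%:R * t h ^+ k * \sum_i X i h * tau i.
  elim: k => [|k IH].
    rewrite expr0 mulr1 mul1r; apply: eq_bigr => i _.
    by rewrite -(pd_lform i h).
  have -> : (fun h => t h ^+ k.+2) = (fun h => t h * t h ^+ k.+1).
    by apply/funext => h'; rewrite exprS.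
  rewrite dirDM // ?IH; last exact: diff_lform.
  have -> : dirD X t h = \sum_i X i h * tau i.
    by apply: eq_bigr => i _; rewrite pd_lform.
  have -> : k.+2%:R = k.+1%:R + 1 :> R by rewrite natr1.
  by rewrite exprS; ring.
have [-> ->] := copM (dX k.+1) du.
by rewrite !E At Bt; split; ring.
Qed.

Variables (r M : R).
Hypothesis (r0 : 0 < r).
Hypothesis (AM : forall i, pana r M (A i)) (BM : forall i, pana r M (B i)).
Hypothesis (cM : pana r M c) (dM : pana r M d).

(** The cost of one application of [L] is [K / e]. Two directional derivatives contribute
    [N * M * C / e] each; the two terms of order zero contribute [M * C] each, which is at most
    [M * r * C / e] because [e <= r]. *)
Let K := N%:R * M * 2 + M * r * 2.

Let M0 : 0 <= M. Proof. exact: ana_ge0 cM. Qed.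
Let K0 : 0 <= K.
Proof. by rewrite addr_ge0 ?mulr_ge0 // ltW. Qed.

Lemma pana2_cop u (s e C : R) : 0 <= s -> 0 < e -> s + e <= r -> pana2 (s + e) C u ->
  pana2 s (K * (C / e)) (L u) /\ forall h, in_polydisc s h -> cdiff u h.
Proof.
move=> s0 e0 ser [u1 u2].
have C0 : 0 <= C by apply: ana_ge0 u1.
have [d1 p1 _] := pana_pd u1 s0 e0 (lexx _).
have [d2 p2 _] := pana_pd u2 s0 e0 (lexx _).
have sr : s <= r by apply: le_trans ser; rewrite lerDl ltW.
have sse : s <= s + e by rewrite lerDl ltW.
split; last by move=> h hs; split; [apply: d1|apply: d2].
have D X f : (forall i, pana r M (X i)) -> (forall i, pana s (C / e) (pd i f)) ->
    pana s (N%:R * M * (C / e)) (dirD X f).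
  move=> XM fC; have -> : N%:R * M * (C / e) = \sum_(i < N) M * (C / e).
    by rewrite sumr_const card_ord -(mulr_natl (M * (C / e)) N) -mulrA.
  by apply: ana_sum => i; apply: anaM (fC i); apply: pana_radius (XM i).
have Z f g : pana r M f -> pana (s + e) C g -> pana s (M * C) (fun h => f h * g h).
  by move=> fM gC; apply: anaM; [apply: pana_radius fM|apply: pana_radius gC].
have E : N%:R * M * (C / e) + N%:R * M * (C / e) + (M * C + M * C) <= K * (C / e).
  rewrite /K mulrDl.
  have -> : N%:R * M * (C / e) + N%:R * M * (C / e) = N%:R * M * 2 * (C / e) by ring.
  rewrite lerD2l.
  have -> : M * C + M * C = (M * 2 * (C / e)) * e by field; rewrite gt_eqF.
  have -> : M * r * 2 * (C / e) = (M * 2 * (C / e)) * r by ring.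
  apply: ler_wpM2l; first by rewrite !mulr_ge0 ?invr_ge0 // ltW.
  by apply: le_trans ser; rewrite lerDr.
split; apply: (ana_le E).
- by apply: anaD; apply: anaB; [apply: D|apply: D|apply: Z|apply: Z].
- by apply: anaD; apply: anaD; [apply: D|apply: D|apply: Z|apply: Z].
Qed.

Lemma iter_cop u (C e : R) k : 0 < e -> k%:R * e <= r -> pana2 r C u ->
  pana2 (r - k%:R * e) ((K / e) ^+ k * C) (iter k L u).
Proof.
move=> e0 ker uC; elim: k ker => [|k IH] ker.
  by rewrite mul0r subr0 expr0 mul1r.
have ker' : k%:R * e <= r.
  by apply: le_trans ker; rewrite ler_wpM2r ?(ltW e0) // ler_nat.
have {IH} IH := IH ker'.
have E : r - k.+1%:R * e + e = r - k%:R * e by rewrite -natr1; ring.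
have -> : (K / e) ^+ k.+1 * C = K * ((K / e) ^+ k * C / e) by rewrite exprS; ring.
have [|||//] := @pana2_cop (iter k L u) (r - k.+1%:R * e) e ((K / e) ^+ k * C) _ e0.
- by rewrite subr_ge0.
- by rewrite E lerBlDr lerDl mulr_ge0 // ltW.
- by rewrite E.
Qed.

(** Half of the radius is divided equally among the [k] applications, so that [e = r / (2 k)]; this
    is where [k ^ k] appears. No radius is to be shared out when [k = 0], which is treated apart. *)
Lemma iter_cop_half u (C : R) k : pana2 r C u ->
  pana2 (r / 2) ((2 * k%:R * K / r) ^+ k * C) (iter k L u).
Proof.
move=> uC; have r2 : 0 <= r / 2 by rewrite divr_ge0 // ltW.
have r2r : r / 2 <= r by lra.
case: k => [|k].
  by rewrite expr0 mul1r /=; case: uC => u1 u2; split; [apply: pana_radius u1|apply: pana_radius u2].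
have e0 : 0 < r / (2 * k.+1%:R) by rewrite divr_gt0 // mulr_gt0.
have x0 : 0 < k.+1%:R :> R by [].
have E : k.+1%:R * (r / (2 * k.+1%:R)) = r / 2.
  by move: (k.+1%:R) x0 => x x0; field; rewrite gt_eqF.
have := @iter_cop u C _ k.+1 e0; rewrite E => /(_ r2r uC).
have -> : r - r / 2 = r / 2 by field.
suff -> : K / (r / (2 * k.+1%:R)) = 2 * k.+1%:R * K / r by [].
by move: (k.+1%:R) x0 => x x0; field; rewrite !gt_eqF.
Qed.

Let T : R := \sum_i `|tau i|.
Let T0 : 0 <= T. Proof. by rewrite sumr_ge0. Qed.

(* From [k ^ k <= 4 ^ k k!]: the loss of radius in [k] derivatives is
   compensated by the factorial of the Lie series. *)
Lemma lie_term u (C s : R) k m : pana2 r C u -> 0 < s -> s <= r / 2 ->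
  8 * T * K * s / r <= 4^-1 -> (k <= m)%N ->
  forall a : R, `|a| <= (m`!%:R)^-1 ->
  pana2 s ((8 * K / r) ^+ (m - k) * C * 4^-1 ^+ k)
    (cmul (fun h => a * t h ^+ k) (iter m L u)).
Proof.
move=> uC s0 sr2 sq km a am.
have C0 : 0 <= C by case: uC => /ana_ge0.
have [v1 v2] := iter_cop_half m uC.
have H f : pana (r / 2) ((2 * m%:R * K / r) ^+ m * C) f ->
    pana s ((8 * K / r) ^+ (m - k) * C * 4^-1 ^+ k) (fun h => a * t h ^+ k * f h).
  move=> fC; have fs := pana_radius (ltW s0) sr2 fC.
  apply: ana_le (anaM (anaZ a (anaX k (ana_lform (ltW s0)))) fs).
  rewrite -/T.
  have Kr : 0 <= K / r by rewrite divr_ge0 // ltW.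
  (* The factor [m ^ m / m!] is at most [4 ^ m], which turns 2 into 8. *)
  have B1 : `|a| * (2 * m%:R * K / r) ^+ m <= (8 * K / r) ^+ m.
    have y0 : 0 <= 2 * K / r by rewrite -mulrA mulr_ge0.
    have -> : 2 * m%:R * K / r = m%:R * (2 * K / r) by ring.
    have -> : 8 * K / r = 4 * (2 * K / r) by ring.
    move: (2 * K / r) y0 => y y0.
    rewrite !exprMn mulrA ler_wpM2r ?exprn_ge0 //.
    apply: le_trans (ler_wpM2r _ am) _; first by rewrite exprn_ge0.
    rewrite mulrC ler_pdivrMr ?ltr0n ?fact_gt0 //.
    by rewrite -!natrX -natrM ler_nat expnn_le_fact.
  have -> : `|a| * (T * s) ^+ k * ((2 * m%:R * K / r) ^+ m * C) =
      `|a| * (2 * m%:R * K / r) ^+ m * ((T * s) ^+ k * C) by ring.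
  have TsC : 0 <= (T * s) ^+ k * C by rewrite mulr_ge0 // exprn_ge0 // mulr_ge0 // ltW.
  apply: le_trans (ler_wpM2r TsC B1) _.
  (* Of the [m] factors [8 * K / r], [k] are paired with the powers of [t], which are small by the
     choice of [s]; the other [m - k] stay in the bound. Uniqueness uses [k = m] and existence
     [m = k + 1]. *)
  rewrite -{1}(subnK km) exprD.
  have -> : (8 * K / r) ^+ (m - k) * (8 * K / r) ^+ k * ((T * s) ^+ k * C) =
     (8 * K / r) ^+ (m - k) * C * (8 * T * K * s / r) ^+ k.
    have -> : 8 * T * K * s / r = (8 * K / r) * (T * s) by ring.
    by move: (8 * K / r) (T * s) => y z; rewrite (exprMn k y z); ring.
  have qq : 0 <= 8 * T * K * s / r by rewrite divr_ge0 ?mulr_ge0 // ltW.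
  apply: ler_wpM2l; first by rewrite mulr_ge0 // exprn_ge0 // divr_ge0 ?mulr_ge0 // ltW.
  by rewrite lerXn2r // nnegrE invr_ge0.
by split; [apply: H|apply: H].
Qed.

(** In the witness [r / (32 T K + 2)] the 32 is 8 times the required 4; the 2 gives [s <= r / 2] and
    keeps the denominator positive when [T * K = 0]. *)
Lemma radius_exists : exists s, [/\ 0 < s, s <= r / 2 & 8 * T * K * s / r <= 4^-1].
Proof.
have TK : 0 <= T * K by rewrite mulr_ge0.
have D0 : 0 < 32 * (T * K) + 2 by lra.
exists (r / (32 * (T * K) + 2)); split.
- by rewrite divr_gt0.
- by rewrite ler_pM2l // lef_pV2 ?posrE //; lra.
have -> : 8 * T * K * (r / (32 * (T * K) + 2)) / r = 8 * (T * K) / (32 * (T * K) + 2).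
  by field; rewrite !gt_eqF.
by rewrite ler_pdivrMr //; lra.
Qed.

Lemma copT u h : adapted h -> cdiff u h ->
  (L (cmul t u)).1 h = t h * (L u).1 h + u.1 h /\
  (L (cmul t u)).2 h = t h * (L u).2 h + u.2 h.
Proof.
move=> ah du; have [] := copXM 0 ah du; rewrite !expr0 !mul1r expr1.
by have -> : (fun h => t h ^+ 1) = t by apply/funext => h'; rewrite expr1.
Qed.

Lemma copZ a u h : cdiff u h ->
  (L (cmul (fun=> a) u)).1 h = a * (L u).1 h /\ (L (cmul (fun=> a) u)).2 h = a * (L u).2 h.
Proof.
move=> du; have [-> ->] := copM (differentiable_cst a h) du.
by rewrite !dirD_cst !mul0r subr0 !addr0.
Qed.

Lemma near_eq_cop u v h : {near h, u.1 =1 v.1} -> {near h, u.2 =1 v.2} ->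
  (L u).1 h = (L v).1 h /\ (L u).2 h = (L v).2 h.
Proof.
move=> uv1 uv2; rewrite /cop /dirD /=.
have E1 i := near_eq_pd i uv1; have E2 i := near_eq_pd i uv2.
under eq_bigr do rewrite E1; under [X in _ - X]eq_bigr do rewrite E2.
under [X in _ /\ X + _ + _ = _]eq_bigr do rewrite E2.
under [X in _ /\ _ + X + _ = _]eq_bigr do rewrite E1.
by rewrite (nbhs_singleton uv1) (nbhs_singleton uv2).
Qed.

Hypothesis adaptedr : forall h, in_polydisc r h -> adapted h.

(* Applying [L] repeatedly to [L (t u) = 0] gives
   [t L^(k+1) u + (k+1) L^k u = 0], hence [u = (-t)^k / k! L^k u] for all [k]. *)
Lemma cop_unique u C : pana2 r C u ->
  (forall h, in_polydisc r h -> (L (cmul t u)).1 h = 0 /\ (L (cmul t u)).2 h = 0) ->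
  exists2 s, 0 < s & forall h, in_polydisc s h -> u.1 h = 0 /\ u.2 h = 0.
Proof.
move=> uC Lu; have [s [s0 sr2 sq]] := radius_exists.
have r2 : 0 < r / 2 by rewrite divr_gt0.
(* The iterates are series on radius [r / 2], hence differentiable on half of it. The set is open
   because an identity must hold near a point before [L] is applied to it. *)
pose v k := iter k L u; pose O h := forall i : 'I_N, `|h 0 i| < r / 2 / 2.
have dv k h : O h -> cdiff (v k) h.
  move=> Oh; have [v1 v2] := iter_cop_half k uC.
  by split; [apply: (pana_diff r2 v1)|apply: (pana_diff r2 v2)] => i; apply: ltW.
have Or h : O h -> in_polydisc r h.
  by move=> Oh i; apply: le_trans (ltW (Oh i)) _; lra.
have nO h : O h -> \forall k \near h, O k.
  move=> Oh; have := @filter_forall _ _ (fun i (k : 'rV[R]_N) => `|k 0 i| < r / 2 / 2) (nbhs h) _.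
  apply => i; have : {for h, continuous (fun k : 'rV[R]_N => `|k 0 i|)}.
    apply: (@continuous_comp _ _ _ (fun k : 'rV[R]_N => k 0 i) (fun x : R => `|x|)).
      exact: coord_continuous.
    exact: norm_continuous.
  by move=> /cvgrPdist_lt /(_ (r / 2 / 2 - `|h 0 i|)); rewrite subr_gt0 => /(_ (Oh i));
    apply: filterS => k; rewrite distrC => /(le_lt_trans (ler_norm _)); lra.
have H k h : O h -> t h * (v k.+1).1 h + k.+1%:R * (v k).1 h = 0 /\
    t h * (v k.+1).2 h + k.+1%:R * (v k).2 h = 0.
  elim: k h => [|k IH] h Oh.
    have := Lu h (Or h Oh).
    by have [-> ->] := @copT u h (adaptedr (Or h Oh)) (dv 0%N h Oh); rewrite !mul1r.
  (* By induction [G] vanishes near [h], so [L G] vanishes at [h]; commuting [L] past [t] adds one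
     more [v k.+1], which raises the coefficient from [k.+1] to [k.+2]. *)
  pose G := cadd (cmul t (v k.+1)) (cmul (fun=> k.+1%:R) (v k)).
  have [] := @near_eq_cop G (cmul (fun=> 0) u) h.
  - by apply: filterS (nO h Oh) => y /IH[e _]; rewrite /= e mul0r.
  - by apply: filterS (nO h Oh) => y /IH[_ e]; rewrite /= e mul0r.
  have [-> ->] := @copZ 0 u h (dv 0%N h Oh); rewrite !mul0r.
  have [d1 d2] := dv k.+1 h Oh; have [d3 d4] := dv k h Oh.
  have [] := @copD (cmul t (v k.+1)) (cmul (fun=> k.+1%:R) (v k)) h.
  - by split; apply: (differentiableM (diff_lform h)).
  - by split; apply: (differentiableM (differentiable_cst _ h)).
  rewrite -/G => -> ->.
  have [-> ->] := copT (adaptedr (Or h Oh)) (dv k.+1 h Oh).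
  have [-> ->] := copZ k.+1%:R (dv k h Oh).
  rewrite -/(v k.+2) -/(v k.+1) -(natr1 k.+1) => e1 e2.
  by split; rewrite mulrDl mul1r (addrC (k.+1%:R * _)) addrA; [exact: e1|exact: e2].
have H' k h : O h -> (v 0%N).1 h = (-1) ^+ k / k`!%:R * t h ^+ k * (v k).1 h /\
    (v 0%N).2 h = (-1) ^+ k / k`!%:R * t h ^+ k * (v k).2 h.
  move=> Oh; elim: k => [|k [-> ->]].
    by rewrite fact0 divr1 !expr0 !mul1r.
  have [e1 e2] := H k h Oh.
  have kf0 : k`!%:R != 0 :> R by rewrite pnatr_eq0 -lt0n fact_gt0.
  have k0 : k.+1%:R != 0 :> R by rewrite pnatr_eq0.
  have v1 : (v k).1 h = - t h * (v k.+1).1 h / k.+1%:R.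
    by apply: (mulIf k0); rewrite divfK // mulNr mulrC; apply/eqP; rewrite -addr_eq0 addrC e1.
  have v2 : (v k).2 h = - t h * (v k.+1).2 h / k.+1%:R.
    by apply: (mulIf k0); rewrite divfK // mulNr mulrC; apply/eqP; rewrite -addr_eq0 addrC e2.
  rewrite v1 v2 factS natrM !exprS.
  by move: k0 kf0; move: (k.+1%:R) (k`!%:R) => x y x0 y0; split; field; rewrite x0 y0.
exists (Num.min s (r / 8)); first by rewrite lt_min s0 divr_gt0.
move=> h hs.
have hss : in_polydisc s h by apply: in_polydiscW hs; rewrite ge_min lexx.
have Oh : O h.
  move=> i; apply: le_lt_trans (hs i) _; rewrite gt_min; apply/orP; right; lra.
have Hb k : `|u.1 h| <= C * 4^-1 ^+ k /\ `|u.2 h| <= C * 4^-1 ^+ k.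
  have am : `|(-1) ^+ k / k`!%:R| <= (k`!%:R)^-1 :> R.
    by rewrite normrM normrX normrN1 expr1n mul1r ger0_norm // invr_ge0.
  have [] := lie_term uC s0 sr2 sq (leqnn k) am.
  rewrite subnn expr0 mul1r => b1 b2.
  have [e1 e2] := H' k h Oh; rewrite -[u]/(v 0%N) e1 e2.
  by split; [exact: (ana_bound b1 hss)|exact: (ana_bound b2 hss)].
have C0 : 0 <= C by case: uC => /ana_ge0.
have q42 k : C * 4^-1 ^+ k <= C * 2^-1 ^+ k.
  by rewrite ler_wpM2l // lerXn2r ?nnegrE ?invr_ge0 // lef_pV2 ?posrE // ler_nat.
by split; apply: (geometric_le0 (C := C)) => k; apply: le_trans (q42 k); have [] := Hb k.
Qed.

(* The solution is the Lie series [sum_k a_k t^k L^k F0] with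
   [a_k = (-1)^k / k!]: [L] maps its partial sum up to [m] to [a_m t^m L^(m+1) F0]. *)
Lemma cop_exists (F0 : F * F) C : pana2 r C F0 -> exists s C' w,
  [/\ 0 < s, pana2 s C' w &
     forall h, in_polydisc s h -> (L (cadd F0 (cmul t w))).1 h = 0 /\
                                  (L (cadd F0 (cmul t w))).2 h = 0].
Proof.
move=> FC; have [s [s0 sr2 sq]] := radius_exists.
have C0 : 0 <= C by case: FC => /ana_ge0.
have sr : s <= r by lra.
pose v k := iter k L F0; pose a k : R := (-1) ^+ k / k`!%:R.
have am k : `|a k| <= (k`!%:R)^-1.
  by rewrite normrM normrX normrN1 expr1n mul1r ger0_norm // invr_ge0.
(* One factor [t] is held back, so that [t * f k] is the term of order [k + 1] and the solution
   takes the form [F0 + t w], with prescribed values on [t = 0]. *)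
pose f k := cmul (fun h => a k.+1 * t h ^+ k) (v k.+1).
pose C1 := 8 * K / r * C.
have C10 : 0 <= C1 by rewrite mulr_ge0 ?divr_ge0 ?mulr_ge0 // ltW.
have fC4 k : pana2 s (C1 * 4^-1 ^+ k) (f k).
  by have := lie_term FC s0 sr2 sq (leqnSn k) (am k.+1); rewrite subSn // subnn expr1.
have q42 k : C1 * 4^-1 ^+ k <= C1 * 2^-1 ^+ k.
  by rewrite ler_wpM2l // lerXn2r ?nnegrE ?invr_ge0 // lef_pV2 ?posrE // ler_nat.
have f1 k : pana s (C1 * 2^-1 ^+ k) (f k).1 by apply: ana_le (q42 k) _; case: (fC4 k).
have f2 k : pana s (C1 * 2^-1 ^+ k) (f k).2 by apply: ana_le (q42 k) _; case: (fC4 k).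
have [w1 [_ w1C]] := ana_geometric C10 f1.
have [w2 [_ w2C]] := ana_geometric C10 f2.
pose w : F * F := (w1, w2).
pose S m : F * F := (fun h => \sum_(0 <= k < m) (f k).1 h, fun h => \sum_(0 <= k < m) (f k).2 h).
(* [F0 + t w] splits as [U m + E m]: on the partial sum [U m] the operator is computed exactly, on
   the remainder [E m] it is only estimated. *)
pose U m := cadd F0 (cmul t (S m)).
pose E m : F * F := cmul t (fun h => w1 h - (S m).1 h, fun h => w2 h - (S m).2 h).
have s2 : 0 < s / 2 by rewrite divr_gt0.
exists (s / 2), (C1 * 2 * 2^-1 ^+ 0), w; split => //.
  have w1' : pana s (C1 * 2 * 2^-1 ^+ 0) w1.
    by apply: eq_ana (w1C 0%N) => h _; rewrite big_nil subr0.
  have w2' : pana s (C1 * 2 * 2^-1 ^+ 0) w2.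
    by apply: eq_ana (w2C 0%N) => h _; rewrite big_nil subr0.
  by split; [apply: pana_radius w1'|apply: pana_radius w2']; rewrite ?ltW //; lra.
move=> h hs; have hr : in_polydisc r h by apply: in_polydiscW hs; lra.
have hss : in_polydisc s h by apply: in_polydiscW hs; lra.
have dt := diff_lform h.
have dF : cdiff F0 h.
  by case: FC => F1 F2; split; [apply: (pana_diff r0 F1)|apply: (pana_diff r0 F2)];
    apply: in_polydiscW hs; lra.
have df k : cdiff (f k) h.
  by split; [apply: (pana_diff s0 (f1 k))|apply: (pana_diff s0 (f2 k))].
have dv k : cdiff (v k) h.
  have r2 : 0 < r / 2 by rewrite divr_gt0.
  have [v1 v2] := iter_cop_half k FC.
  by split; [apply: (pana_diff r2 v1)|apply: (pana_diff r2 v2)]; apply: in_polydiscW hs; lra.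
have dtf k : cdiff (cmul t (f k)) h.
  by have [d1 d2] := df k; split; apply: (differentiableM dt).
have US m : U m.+1 = cadd (U m) (cmul t (f m)).
  by congr (_, _); apply/funext => y /=; rewrite big_nat_recr //=; ring.
have dU m : cdiff (U m) h.
  elim: m => [|m [IH1 IH2]].
    have -> : U 0%N = F0; last by [].
    rewrite [F0]surjective_pairing; congr (_, _); apply/funext => y /=;
      by rewrite big_nil mulr0 addr0.
  by rewrite US; have [d1 d2] := dtf m; split; apply: differentiableD.
have LU m : (L (U m)).1 h = a m * t h ^+ m * (v m.+1).1 h /\
    (L (U m)).2 h = a m * t h ^+ m * (v m.+1).2 h.
  elim: m => [|m [IH1 IH2]].
    have -> : U 0%N = F0.
      rewrite [F0]surjective_pairing; congr (_, _); apply/funext => y /=;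
        by rewrite big_nil mulr0 addr0.
    by rewrite /a fact0 !expr0 divr1 !mul1r.
  rewrite US; have [-> ->] := copD (dU m) (dtf m); rewrite IH1 IH2.
  have -> : cmul t (f m) = cmul (fun=> a m.+1) (cmul (fun h => t h ^+ m.+1) (v m.+1)).
    by congr (_, _); apply/funext => y /=; rewrite exprS; ring.
  have dX : differentiable (fun h => t h ^+ m.+1) h.
    elim: (m.+1) => [|k IH]; first exact: differentiable_cst.
    have -> : (fun h => t h ^+ k.+1) = (fun h => t h * t h ^+ k).
      by apply/funext => h'; rewrite exprS.
    exact: (differentiableM dt IH).
  have dXv : cdiff (cmul (fun h => t h ^+ m.+1) (v m.+1)) h.
    by have [d1 d2] := dv m.+1; split; apply: (differentiableM dX).
  have [-> ->] := copZ (a m.+1) dXv.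
  have [-> ->] := copXM m (adaptedr hr) (dv m.+1).
  have aS : a m = - (a m.+1 * m.+1%:R).
    rewrite /a factS natrM exprS.
    have kf0 : m`!%:R != 0 :> R by rewrite pnatr_eq0 -lt0n fact_gt0.
    have k0 : m.+1%:R != 0 :> R by rewrite pnatr_eq0.
    by move: k0 kf0; move: (m.+1%:R) (m`!%:R) => x y x0 y0; field; rewrite x0 y0.
  rewrite aS -/(v m.+2) exprS; split; ring.
have Lb m : `|a m * t h ^+ m * (v m.+1).1 h| <= C1 * 2^-1 ^+ m /\
    `|a m * t h ^+ m * (v m.+1).2 h| <= C1 * 2^-1 ^+ m.
  have aS : a m = - m.+1%:R * a m.+1.
    rewrite /a factS natrM exprS.
    have kf0 : m`!%:R != 0 :> R by rewrite pnatr_eq0 -lt0n fact_gt0.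
    have k0 : m.+1%:R != 0 :> R by rewrite pnatr_eq0.
    by move: k0 kf0; move: (m.+1%:R) (m`!%:R) => x y x0 y0; field; rewrite x0 y0.
  (* The ratio of consecutive Lie coefficients brings a factor [m + 1]. It is absorbed in passing
     from [4^-m] to [2^-m], the reason for the ratio 1/4 in [lie_term]. *)
  have m2 : m.+1%:R * 4^-1 ^+ m <= 2^-1 ^+ m :> R.
    have -> : 4^-1 ^+ m = 2^-1 ^+ m * 2^-1 ^+ m :> R by rewrite -exprMn; congr (_ ^+ _); field.
    rewrite mulrA ger_pMl ?exprn_gt0 ?invr_gt0 //.
    by rewrite exprVn ler_pdivrMr ?exprn_gt0 // mul1r -natrX ler_nat ltn_expl.
  have Bx x : `|a m.+1 * t h ^+ m * x| <= C1 * 4^-1 ^+ m ->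
      `|a m * t h ^+ m * x| <= C1 * 2^-1 ^+ m.
    move=> xb; rewrite aS.
    have -> : - m.+1%:R * a m.+1 * t h ^+ m * x = - m.+1%:R * (a m.+1 * t h ^+ m * x) by ring.
    rewrite normrM normrN normr_nat; apply: le_trans (ler_wpM2l _ xb) _ => //.
    by rewrite mulrCA ler_wpM2l.
  by have [b1 b2] := fC4 m; split; apply: Bx; [exact: (ana_bound b1 hss)|exact: (ana_bound b2 hss)].
have EC m : pana2 s (T * s * (C1 * 2 * 2^-1 ^+ m)) (E m).
  by split; [apply: anaM (w1C m)|apply: anaM (w2C m)]; apply: ana_lform; apply: ltW.
have UE m : cadd F0 (cmul t w) = cadd (U m) (E m).
  by congr (_, _); apply/funext => y /=; ring.
have ss : s / 2 + s / 2 = s by rewrite -splitr.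
have Eb m : pana2 (s / 2) (K * (T * s * (C1 * 2 * 2^-1 ^+ m) / (s / 2))) (L (E m)) /\
    cdiff (E m) h.
  have [|//|||p dE] := @pana2_cop (E m) (s / 2) (s / 2) (T * s * (C1 * 2 * 2^-1 ^+ m)).
  - exact: ltW.
  - by rewrite ss.
  - by rewrite ss.
  - by split => //; apply: dE.
(* Independent of [m]: the first summand bounds [L (U m)], the second the Cauchy estimate of
   [L (E m)], both up to the factor [2^-m]. *)
pose C2 := C1 + K * T * s * C1 * 2 / (s / 2).
have Fin m : `|(L (cadd F0 (cmul t w))).1 h| <= C2 * 2^-1 ^+ m /\
    `|(L (cadd F0 (cmul t w))).2 h| <= C2 * 2^-1 ^+ m.
  rewrite (UE m); have [[E1 E2] dE] := Eb m; have [-> ->] := copD (dU m) dE.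
  have [-> ->] := LU m; have [l1 l2] := Lb m.
  have -> : C2 * 2^-1 ^+ m = C1 * 2^-1 ^+ m + K * (T * s * (C1 * 2 * 2^-1 ^+ m) / (s / 2)).
    by rewrite /C2; ring.
  by split; apply: le_trans (ler_normD _ _) _; apply: lerD => //;
    [exact: (ana_bound E1 hs)|exact: (ana_bound E2 hs)].
by split; apply: (geometric_le0 (C := C2)) => m; have [] := Fin m.
Qed.

End FirstOrder.

(** * Existence and uniqueness for germs at an arbitrary base point *)

Section GermCauchyKovalevskaya.
Context {R : realType} {n : nat}.
Local Notation F := ('rV[R]_n.+1 -> R).
Implicit Types (f g : F) (x : 'rV[R]_n.+1).

Lemma near_near x (P : 'rV[R]_n.+1 -> Prop) : (\forall y \near x, P y) ->
  \forall y \near x, \forall z \near y, P z.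
Proof. by move=> /nbhs_interior. Qed.

Lemma near_pd i f g x : {near x, f =1 g} -> \forall y \near x, pd i f y = pd i g y.
Proof. by move=> /near_near; apply: filterS => y; apply: near_eq_pd. Qed.

Lemma near_shift_polydisc x (P : 'rV[R]_n.+1 -> Prop) (s : R) : 0 < s ->
  (forall h, in_polydisc s h -> P (x + h)) -> \forall y \near x, P y.
Proof.
move=> s0 H; apply: filterS (near_polydisc x s0) => y /H.
by rewrite addrC subrK.
Qed.

Lemma an_family (I : finType) (f : I -> F) x : (forall i, an (f i) x) ->
  exists2 r, 0 < r & exists M, forall i s, 0 < s -> s <= r ->
    pana s M (fun h => f i (x + h)).
Proof.
move=> af; have /choice[rC H] : forall i, exists rC : R * R,
    0 < rC.1 /\ pana rC.1 rC.2 (fun h => f i (x + h)).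
  by move=> i; have /anP[r [C rCf]] := af i; exists (r, C).
have P0 i : exists2 r, 0 < r & forall s, 0 < s -> s <= r -> pana s (rC i).2 (fun h => f i (x + h)).
  have [ri fi] := H i; exists (rC i).1 => // s s0 sr.
  by apply: pana_radius fi => //; apply: ltW.
have [r r0 Hr] := finite_radius (index_enum I) P0.
exists r => //; exists (\sum_i (rC i).2) => i s s0 sr.
apply: ana_le (Hr s s0 sr i (mem_index_enum i)).
rewrite (bigD1 i) //= lerDl sumr_ge0 // => j _.
by have [_ /ana_ge0] := H j.
Qed.

Variables (A B : 'I_n.+1 -> F) (c d : F) (tau : 'I_n.+1 -> R) (x0 : 'rV[R]_n.+1).
Local Notation L := (cop A B c d).

Definition tfun x : R := lform tau (x - x0).

Hypotheses (aA : forall i, an (A i) x0) (aB : forall i, an (B i) x0).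
Hypotheses (ac : an c x0) (ad : an d x0).
Hypothesis adapted0 : \forall x \near x0, adapted A B tau x.

Let tr (X : 'I_n.+1 -> F) i h := X i (x0 + h).
Let sh (f : F) : F := fun h => f (x0 + h).
Let sh2 (u : F * F) : F * F := (sh u.1, sh u.2).

Lemma cop_shift u h :
  (cop (tr A) (tr B) (sh c) (sh d) (sh2 u)).1 h = (L u).1 (x0 + h) /\
  (cop (tr A) (tr B) (sh c) (sh d) (sh2 u)).2 h = (L u).2 (x0 + h).
Proof.
have E X f : dirD (tr X) (sh f) h = dirD X f (x0 + h).
  by apply: eq_bigr => i _; rewrite pd_shift.
by rewrite /cop /= !E.
Qed.

Lemma tfun_shift h : tfun (x0 + h) = lform tau h.
Proof. by rewrite /tfun addrAC subrr add0r. Qed.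

Let common (u : F * F) : an u.1 x0 -> an u.2 x0 -> exists r M : R,
  [/\ 0 < r, (forall i, pana r M (tr A i)), (forall i, pana r M (tr B i)),
      pana r M (sh c) & pana r M (sh d)] /\
  [/\ pana2 r M (sh2 u) & forall h, in_polydisc r h -> adapted A B tau (x0 + h)].
Proof.
(* All the data are packed into one finite family to obtain a common radius and bound. The default
   value [u.2] of [nth] is the fourth member, read at index 3. *)
move=> a1 a2; pose f (j : 'I_n.+1 + 'I_n.+1 + 'I_4) : F := match j with
  | inl (inl i) => A i | inl (inr i) => B i
  | inr k => nth u.2 [:: c; d; u.1] k end.
have af j : an (f j) x0.
  by case: j => [[i|i]|[[|[|[|[|k]]]] lk]] //=.
have [r r0 [M HM]] := an_family af.
have [s s0 Hs] := nbhs_polydisc adapted0.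
have m0 : 0 < Num.min r s by rewrite lt_min r0.
have [mr ms] : Num.min r s <= r /\ Num.min r s <= s by rewrite !ge_min !lexx orbT.
have {}HM j := HM j _ m0 mr; exists (Num.min r s), M; split; split => //.
- by move=> i; apply: (HM (inl (inl i))).
- by move=> i; apply: (HM (inl (inr i))).
- exact: (HM (inr (Ordinal (isT : 0 < 4)%N))).
- exact: (HM (inr (Ordinal (isT : 1 < 4)%N))).
- split; first exact: (HM (inr (Ordinal (isT : 2 < 4)%N))).
  exact: (HM (inr (Ordinal (isT : 3 < 4)%N))).
- by move=> h hr; apply: Hs; apply: in_polydiscW hr.
Qed.

Theorem germ_cop_exists (u : F * F) : an u.1 x0 -> an u.2 x0 ->
  exists w : F * F, [/\ an w.1 x0, an w.2 x0 &
    \forall x \near x0, (L (cadd u (cmul tfun w))).1 x = 0 /\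
                        (L (cadd u (cmul tfun w))).2 x = 0].
Proof.
move=> a1 a2; have [r [M [[r0 AM BM cM dM] [uM adr]]]] := common a1 a2.
have adr' h : in_polydisc r h -> adapted (tr A) (tr B) tau h by move/adr.
have [s [C [w [s0 [w1 w2] Hw]]]] := cop_exists r0 AM BM cM dM adr' uM.
pose w' : F * F := (fun x => w.1 (x - x0), fun x => w.2 (x - x0)).
have E f : (fun h => f (x0 + h - x0)) = f :> F.
  by apply/funext => h; rewrite addrAC subrr add0r.
exists w'; split.
- by apply/anP; exists s, C; rewrite /= E.
- by apply/anP; exists s, C; rewrite /= E.
apply: near_shift_polydisc s0 _ => h hs.
have [<- <-] := cop_shift (cadd u (cmul tfun w')) h.
suff -> : sh2 (cadd u (cmul tfun w')) = cadd (sh2 u) (cmul (lform tau) w) by apply: Hw.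
by congr (_, _); apply/funext => k; rewrite /sh /= tfun_shift addrAC subrr add0r.
Qed.

Theorem germ_cop_unique (w : F * F) : an w.1 x0 -> an w.2 x0 ->
  (\forall x \near x0, (L (cmul tfun w)).1 x = 0 /\ (L (cmul tfun w)).2 x = 0) ->
  \forall x \near x0, w.1 x = 0 /\ w.2 x = 0.
Proof.
move=> a1 a2 /nbhs_polydisc[e e0 He].
have [r [M [[r0 AM BM cM dM] [wM adr]]]] := common a1 a2.
pose m := Num.min r e.
have m0 : 0 < m by rewrite lt_min r0.
have [mr me] : m <= r /\ m <= e by rewrite !ge_min !lexx orbT.
have P f : pana r M f -> pana m M f by apply: pana_radius => //; apply: ltW.
have adr' h : in_polydisc m h -> adapted (tr A) (tr B) tau h.
  by move=> hm; apply: adr; apply: in_polydiscW hm.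
have wm : pana2 m M (sh2 w) by case: wM => /P w1 /P w2.
have [|s s0 Hs] := cop_unique m0 (fun i => P _ (AM i)) (fun i => P _ (BM i)) (P _ cM) (P _ dM) adr' wm.
  move=> h hm; have [] := He h (in_polydiscW me hm).
  have [<- <-] := cop_shift (cmul tfun w) h.
  suff -> : sh2 (cmul tfun w) = cmul (lform tau) (sh2 w) by [].
  by congr (_, _); apply/funext => k; rewrite /sh /= tfun_shift.
by apply: near_shift_polydisc s0 _ => h /Hs.
Qed.

Lemma pd_tfun i x : pd i tfun x = tau i.
Proof.
have e : x0 + (x - x0) = x by rewrite addrC subrK.
have := pd_shift i tfun x0 (x - x0); rewrite e => <-.
have -> : (fun h => tfun (x0 + h)) = lform tau.
  by apply/funext => h; exact: tfun_shift.
exact: pd_lform.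
Qed.

Lemma an_tfun x : an tfun x.
Proof.
have -> : tfun = (fun x => lform tau x + - lform tau x0).
  apply/funext => y; rewrite /tfun /lform -sumrB; apply: eq_bigr => i _.
  by rewrite !mxE mulrBr.
by apply: anD; [apply/entire_an/entire_lform|apply: an_cst].
Qed.

End GermCauchyKovalevskaya.

(** * Vector calculus in three dimensions *)

Definition o0 : 'I_3 := Ordinal (isT : 0 < 3)%N.
Definition o1 : 'I_3 := Ordinal (isT : 1 < 3)%N.
Definition o2 : 'I_3 := Ordinal (isT : 2 < 3)%N.

Lemma sum3 (V : nmodType) (F : 'I_3 -> V) : \sum_i F i = F o0 + F o1 + F o2.
Proof.
rewrite !big_ord_recl big_ord0 addr0 addrA.
by congr (F _ + F _ + F _); apply: val_inj.
Qed.

Lemma all3 (P : 'I_3 -> Prop) : P o0 -> P o1 -> P o2 -> forall i, P i.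
Proof.
move=> P0 P1 P2 [[|[|[|m]]] lm] //.
- by rewrite (_ : Ordinal lm = o0) //; apply: val_inj.
- by rewrite (_ : Ordinal lm = o1) //; apply: val_inj.
- by rewrite (_ : Ordinal lm = o2) //; apply: val_inj.
Qed.

(** The cyclic successor, with which the three components of the cross product share one formula. *)
Definition nxt (i : 'I_3) : 'I_3 := if i == o0 then o1 else if i == o1 then o2 else o0.

Lemma nxtE : (nxt o0 = o1) * (nxt o1 = o2) * (nxt o2 = o0).
Proof. by []. Qed.

Definition cross {R : realType} (u v : 'I_3 -> R) (i : 'I_3) : R :=
  u (nxt i) * v (nxt (nxt i)) - u (nxt (nxt i)) * v (nxt i).

Definition det3 {R : realType} (u v w : 'I_3 -> R) : R := \sum_i u i * cross v w i.

Section Algebra.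
Context {R : realType}.
Implicit Types (p q u v w Z tau : 'I_3 -> R).

Lemma cross_parallel (p1 p2 q1 q2 Z1 Z2 tau : 'I_3 -> R) (C1 C2 : 'I_3 -> R) :
  \sum_i Z1 i * p1 i - \sum_i Z2 i * p2 i = 0 -> \sum_i Z1 i * p2 i + \sum_i Z2 i * p1 i = 0 ->
  \sum_i Z1 i * q1 i - \sum_i Z2 i * q2 i = 0 -> \sum_i Z1 i * q2 i + \sum_i Z2 i * q1 i = 0 ->
  \sum_i Z1 i * tau i = 1 -> \sum_i Z2 i * tau i = 0 ->
  (forall i, C1 i = cross p1 q1 i - cross p2 q2 i) ->
  (forall i, C2 i = cross p1 q2 i + cross p2 q1 i) ->
  forall i, C1 i = Z1 i * (\sum_j tau j * C1 j) - Z2 i * (\sum_j tau j * C2 j) /\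
    C2 i = Z1 i * (\sum_j tau j * C2 j) + Z2 i * (\sum_j tau j * C1 j).
Proof.
(* [tau x (Z x (p x q))] is [Z (tau.(p x q)) - (p x q) (tau.Z)] and
   [Z x (p x q)] is [p (Z.q) - q (Z.p)], over the complex numbers. *)
move=> h1 h2 h3 h4 h5 h6 E1 E2 i.
pose zp1 := \sum_i Z1 i * p1 i - \sum_i Z2 i * p2 i.
pose zp2 := \sum_i Z1 i * p2 i + \sum_i Z2 i * p1 i.
pose zq1 := \sum_i Z1 i * q1 i - \sum_i Z2 i * q2 i.
pose zq2 := \sum_i Z1 i * q2 i + \sum_i Z2 i * q1 i.
pose tz1 := \sum_i Z1 i * tau i; pose tz2 := \sum_i Z2 i * tau i.
have I1 : C1 i = Z1 i * (\sum_j tau j * C1 j) - Z2 i * (\sum_j tau j * C2 j)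
    + C1 i * (1 - tz1) + C2 i * tz2
    - cross tau (fun j => p1 j * zq1 - p2 j * zq2 - q1 j * zp1 + q2 j * zp2) i.
  rewrite /zp1 /zp2 /zq1 /zq2 /tz1 /tz2 !sum3 !E1 !E2.
  by elim/all3: i; rewrite /cross !nxtE; ring.
have I2 : C2 i = Z1 i * (\sum_j tau j * C2 j) + Z2 i * (\sum_j tau j * C1 j)
    + C2 i * (1 - tz1) - C1 i * tz2
    - cross tau (fun j => p1 j * zq2 + p2 j * zq1 - q1 j * zp2 - q2 j * zp1) i.
  rewrite /zp1 /zp2 /zq1 /zq2 /tz1 /tz2 !sum3 !E1 !E2.
  by elim/all3: i {I1}; rewrite /cross !nxtE; ring.
split; [rewrite {1}I1|rewrite {1}I2];
  by rewrite /zp1 /zp2 /zq1 /zq2 /tz1 /tz2 h1 h2 h3 h4 h5 h6 /cross; ring.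
Qed.

(** If [a] and [b] are not orthogonal, [a] itself works; otherwise [a + b] pairs with them to their
    squared lengths. *)
Lemma exists_transverse a b : (exists i, a i != 0) -> (exists i, b i != 0) ->
  exists tau, \sum_i tau i * a i != 0 /\ \sum_i tau i * b i != 0.
Proof.
have pos u : (exists i, u i != 0) -> 0 < \sum_i u i * u i.
  move=> [i ui]; rewrite (bigD1 i) //= ltr_pwDl // ?sumr_ge0 // => [|j _].
    by rewrite -expr2 exprn_even_gt0.
  by rewrite -expr2 sqr_ge0.
move=> /pos a0 /pos b0; case: (eqVneq (\sum_i a i * b i) 0) => [ab|ab]; last first.
  by exists a; rewrite gt_eqF.
exists (fun i => a i + b i); move: a0 b0 ab; rewrite !sum3 => a0 b0 ab.
by split; apply: lt0r_neq0; nra.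
Qed.

(** The witnesses are chosen so that their cross product is the [i]-th basis vector divided by
    [tau i], for a nonzero entry [tau i]. *)
Lemma exists_unimodular tau : (exists i, tau i != 0) -> exists l1 l2, det3 tau l1 l2 = 1.
Proof.
case=> i; elim/all3: i => t0.
- exists (nth 0 [:: 0; (tau o0)^-1; 0]), (nth 0 [:: 0; 0; 1]).
  by rewrite /det3 sum3 /cross !nxtE /=; field.
- exists (nth 0 [:: 0; 0; (tau o1)^-1]), (nth 0 [:: 1; 0; 0]).
  by rewrite /det3 sum3 /cross !nxtE /=; field.
- exists (nth 0 [:: (tau o2)^-1; 0; 0]), (nth 0 [:: 0; 1; 0]).
  by rewrite /det3 sum3 /cross !nxtE /=; field.
Qed.

End Algebra.

Section VectorCalculus.
Context {R : realType}.
Local Notation F := ('rV[R]_3 -> R).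
Implicit Types (f g u v : F) (X : 'I_3 -> F) (x : 'rV[R]_3).

Definition divg X x : R := \sum_i pd i (X i) x.

Definition grad u x (i : 'I_3) : R := pd i u x.

Lemma divgM f X x : differentiable f x -> (forall i, differentiable (X i) x) ->
  divg (fun i y => X i y * f y) x = dirD X f x + divg X x * f x.
Proof.
move=> df dX; rewrite /divg /dirD big_distrl -big_split; apply: eq_bigr => i _ /=.
by rewrite pdM // addrC.
Qed.

Lemma divgD X Y x : (forall i, differentiable (X i) x) -> (forall i, differentiable (Y i) x) ->
  divg (fun i y => X i y + Y i y) x = divg X x + divg Y x.
Proof. by move=> dX dY; rewrite /divg -big_split; apply: eq_bigr => i _; rewrite pdD. Qed.

Lemma divgB X Y x : (forall i, differentiable (X i) x) -> (forall i, differentiable (Y i) x) ->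
  divg (fun i y => X i y - Y i y) x = divg X x - divg Y x.
Proof. by move=> dX dY; rewrite /divg -sumrB; apply: eq_bigr => i _; rewrite pdB. Qed.

Lemma near_divg X Y x : (forall i, {near x, X i =1 Y i}) ->
  \forall y \near x, divg X y = divg Y y.
Proof.
move=> XY; have H i := near_pd i (XY i).
by apply: filterS3 (H o0) (H o1) (H o2) => y e0 e1 e2; rewrite /divg !sum3 e0 e1 e2.
Qed.

Lemma an_cross (u v : 'I_3 -> F) i x : (forall i, an (u i) x) -> (forall i, an (v i) x) ->
  an (fun y => cross (u^~ y) (v^~ y) i) x.
Proof.
by move=> au av; apply: anB; apply: anM; (apply: au || apply: av).
Qed.

(** This is d(du /\ dv) = 0: the second derivatives cancel in pairs by [pd_comm]. *)
Lemma divg_cross u v x : an u x -> an v x ->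
  divg (fun i y => cross (grad u y) (grad v y) i) x = 0.
Proof.
move=> au av.
have E i : pd i (fun y => cross (grad u y) (grad v y) i) x =
    pd i (pd (nxt i) u) x * pd (nxt (nxt i)) v x + pd (nxt i) u x * pd i (pd (nxt (nxt i)) v) x -
    (pd i (pd (nxt (nxt i)) u) x * pd (nxt i) v x + pd (nxt (nxt i)) u x * pd i (pd (nxt i) v) x).
  have du j := an_diff (an_pd j au); have dv j := an_diff (an_pd j av).
  rewrite /cross /grad.
  rewrite (@pdB _ _ i (fun y => pd (nxt i) u y * pd (nxt (nxt i)) v y) (fun y => pd (nxt (nxt i)) u y * pd (nxt i) v y)).
  - by rewrite (@pdM _ _ i (pd (nxt i) u) (pd (nxt (nxt i)) v)) // (@pdM _ _ i (pd (nxt (nxt i)) u) (pd (nxt i) v)).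
  - exact: differentiableM.
  - exact: differentiableM.
rewrite /divg sum3 !E !nxtE.
rewrite (pd_comm o1 o0 au) (pd_comm o2 o0 au) (pd_comm o2 o1 au).
rewrite (pd_comm o1 o0 av) (pd_comm o2 o0 av) (pd_comm o2 o1 av).
move: (pd o0 (pd o1 u) x) (pd o0 (pd o2 u) x) (pd o1 (pd o2 u) x) => u01 u02 u12.
move: (pd o0 (pd o1 v) x) (pd o0 (pd o2 v) x) (pd o1 (pd o2 v) x) => v01 v02 v12.
move: (pd o0 u x) (pd o1 u x) (pd o2 u x) (pd o0 v x) (pd o1 v x) (pd o2 v x) => u0 u1 u2 v0 v1 v2.
ring.
Qed.

End VectorCalculus.

(** * Divergence-free rescaling and the complex first integrals *)

Section LocalPotentials.
Context {R : realType}.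
Local Notation F := ('rV[R]_3 -> R).
Implicit Types (x y : 'rV[R]_3).

Lemma an_divg (X : 'I_3 -> F) x : (forall i, an (X i) x) -> an (divg X) x.
Proof. by move=> aX; apply: an_sum => i; apply: an_pd. Qed.

Lemma near_forall3 x (P : 'I_3 -> 'rV[R]_3 -> Prop) :
  (forall i, \forall y \near x, P i y) -> \forall y \near x, forall i, P i y.
Proof.
by move=> H; apply: filterS3 (H o0) (H o1) (H o2) => y p0 p1 p2; apply: all3.
Qed.

(** For [f = 1 + t w] the condition reads [a . grad f + (div a) f = 0]. This is the complex equation
    with [B = 0] and [d = 0], solved from the initial function 1 and read on its real part. *)
Lemma exists_divergence_free (a : 'I_3 -> F) (tau : 'I_3 -> R) x0 :
  (forall i, an (a i) x0) -> (\forall x \near x0, \sum_i a i x * tau i = 1) ->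
  exists2 w, an w x0 &
    \forall x \near x0, divg (fun i y => a i y * (1 + tfun tau x0 y * w y)) x = 0.
Proof.
move=> aa at1.
have a0 (i : 'I_3) : an (fun=> 0 : R) x0 by apply: an_cst.
have adp : \forall x \near x0, adapted a (fun _ _ => 0) tau x.
  apply: filterS at1 => x e; split => //.
  by rewrite big1 // => i _; rewrite mul0r.
have [w [w1 _ Hw]] := germ_cop_exists aa a0 (an_divg aa) (an_cst 0 x0) adp
  (u := (fun=> 1, fun=> 0)) (an_cst 1 x0) (an_cst 0 x0).
exists w.1 => //.
have an1 : an (fun y => 1 + tfun tau x0 y * w.1 y) x0.
  by apply: anD; [apply: an_cst|apply: anM => //; apply: an_tfun].
have aan := near_forall3 (fun i => an_near (aa i)).
apply: filterS3 Hw (an_near an1) aan => x [+ _] d1 da.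
rewrite divgM; last 2 first.
- exact: an_diff.
- by move=> i; apply: an_diff.
rewrite /cop /cadd /cmul /=.
have -> : dirD (fun _ _ => 0) (fun h => 0 + tfun tau x0 h * w.2 h) x = 0.
  by rewrite /dirD big1 // => i _; rewrite mul0r.
by rewrite subr0 mul0r subr0.
Qed.

(** The product rule for the divergence of [(A + i B) (m1 + i m2)]. It is applied to the curl-like
    field [C1 + i C2] and to [P + i S], which puts both factors under one uniqueness statement. *)
Lemma pde_of_divergence_free (A B X1 X2 : 'I_3 -> F) (m1 m2 : F) x0 :
  (forall i, an (A i) x0) -> (forall i, an (B i) x0) -> an m1 x0 -> an m2 x0 ->
  (\forall x \near x0, forall i, X1 i x = A i x * m1 x - B i x * m2 x /\
                                 X2 i x = A i x * m2 x + B i x * m1 x) ->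
  (\forall x \near x0, divg X1 x = 0 /\ divg X2 x = 0) ->
  \forall x \near x0, (cop A B (divg A) (divg B) (m1, m2)).1 x = 0 /\
                      (cop A B (divg A) (divg B) (m1, m2)).2 x = 0.
Proof.
move=> aA aB am1 am2 E D.
have E1 i : {near x0, X1 i =1 fun x => A i x * m1 x - B i x * m2 x}.
  by apply: filterS E => x /(_ i)[].
have E2 i : {near x0, X2 i =1 fun x => A i x * m2 x + B i x * m1 x}.
  by apply: filterS E => x /(_ i)[].
have dA : \forall x \near x0, forall i, differentiable (A i) x /\ differentiable (B i) x.
  apply: near_forall3 => i.
  by apply: filterS2 (an_near (aA i)) (an_near (aB i)) => x /an_diff ? /an_diff.
have dm : \forall x \near x0, differentiable m1 x /\ differentiable m2 x.
  by apply: filterS2 (an_near am1) (an_near am2) => x /an_diff ? /an_diff.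
have {}D : \forall x \near x0, divg (fun i x => A i x * m1 x - B i x * m2 x) x = 0 /\
    divg (fun i x => A i x * m2 x + B i x * m1 x) x = 0.
  by apply: filterS3 D (near_divg E1) (near_divg E2) => x [d1 d2] <- <-.
apply: filterS3 dA dm D => x dAB [d1 d2].
have dM (X : 'I_3 -> F) m : (forall i, differentiable (X i) x) -> differentiable m x ->
    forall i, differentiable (fun x => X i x * m x) x.
  by move=> dX dm i; apply: differentiableM.
have dA' i : differentiable (A i) x by case: (dAB i).
have dB' i : differentiable (B i) x by case: (dAB i).
rewrite (@divgB _ (fun i x => A i x * m1 x) (fun i x => B i x * m2 x)); try exact: dM.
rewrite (@divgD _ (fun i x => A i x * m2 x) (fun i x => B i x * m1 x)); try exact: dM.
rewrite !divgM // /cop /= => -[e1 e2].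
by split; [rewrite -[RHS]e1|rewrite -[RHS]e2]; ring.
Qed.

Lemma an_det3 (a b e : 'I_3 -> F) x : (forall i, an (a i) x) -> (forall i, an (b i) x) ->
  (forall i, an (e i) x) -> an (fun y => det3 (a^~ y) (b^~ y) (e^~ y)) x.
Proof. by move=> aa ab ae; apply: an_sum => i; apply: anM => //; apply: an_cross. Qed.

(** The explicit quotient by [t] of a determinant of gradients minus its value on [t = 0], which
    replaces a division of analytic germs by [t]. *)
Definition det3_rest (tau l l' : 'I_3 -> R) (t u u' : F) x : R :=
  det3 tau (grad u x) l' + det3 tau l (grad u' x) + t x * det3 tau (grad u x) (grad u' x).

Lemma an_det3_rest tau l l' (t u u' : F) x : an t x -> an u x -> an u' x ->
  an (det3_rest tau l l' t u u') x.
Proof.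
move=> at_ au au'.
have ac (k : 'I_3 -> R) i : an (fun=> k i) x by apply: an_cst.
have ag i : an (fun y => grad u y i) x by apply: an_pd.
have ag' i : an (fun y => grad u' y i) x by apply: an_pd.
apply: anD; last first.
  by apply: anM => //; apply: (an_det3 (ac tau) ag ag').
by apply: anD; [apply: (an_det3 (ac tau) ag (ac l'))|apply: (an_det3 (ac tau) (ac l) ag')].
Qed.

(* The gradients are those of [l + t u] and [l' + t u'], when [t] has gradient
   [tau]; the determinant is affine in [t] up to the second order term. *)
Lemma det3_expand tau l l' (t u u' : F) x :
  det3 tau (fun i => l i + (tau i * u x + t x * grad u x i))
           (fun i => l' i + (tau i * u' x + t x * grad u' x i)) =
  det3 tau l l' + t x * det3_rest tau l l' t u u' x.
Proof.
rewrite /det3_rest; move: (grad u x) (grad u' x) (u x) (u' x) (t x) => p q y z s.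
by rewrite /det3 !sum3 /cross !nxtE; ring.
Qed.

Lemma an_neq0 (f : F) x : an f x -> f x != 0 -> \forall y \near x, f y != 0.
Proof.
by move=> /an_diff/differentiable_continuous cf fx; exact: (cvgr_neq0 _ cf fx).
Qed.

Lemma pd_transverse (tau : 'I_3 -> R) (h w : F) x0 x i :
  differentiable h x -> an w x ->
  pd i (fun y => h y + tfun tau x0 y * w y) x =
    pd i h x + (tau i * w x + tfun tau x0 x * pd i w x).
Proof.
move=> dh /an_diff dw; have dt := an_diff (an_tfun tau x0 x).
rewrite pdD //; last exact: differentiableM.
by rewrite (@pdM _ _ i (tfun tau x0) w) // pd_tfun.
Qed.

Lemma cop_eq0 (A B : 'I_3 -> F) (c d : F) (u v : F) x :
  c x = 0 -> d x = 0 ->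
  (cop A B c d (u, v)).1 x = 0 -> (cop A B c d (u, v)).2 x = 0 ->
  \sum_i A i x * pd i u x - \sum_i B i x * pd i v x = 0 /\
  \sum_i A i x * pd i v x + \sum_i B i x * pd i u x = 0.
Proof. by rewrite /cop /= => -> ->; rewrite !mul0r subr0 !addr0. Qed.

Lemma nearI x (P Q : 'rV[R]_3 -> Prop) : (\forall y \near x, P y) ->
  (\forall y \near x, Q y) -> \forall y \near x, P y /\ Q y.
Proof. exact: filterI. Qed.

(* [Z = f a' + i g b'] is divergence free, [A + i B] is [Z / (Z t)], and the
   complex functions [z1 = y0 + i y1], [z2 = y2 + i y3] are first integrals of
   it.  The cross product [C1 + i C2] of their gradients is [(A + i B) m] with
   [m = tau . C].  Both [m] and [Z t = f + i g] solve the transport equation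
   expressing that [(A + i B) m] is divergence free, and they agree on [t = 0]. *)
Lemma exists_potentials (a b : 'I_3 -> F) x0 :
  (forall i, an (a i) x0) -> (forall i, an (b i) x0) ->
  (forall s t : R, (forall i, s * a i x0 + t * b i x0 = 0) -> s = 0 /\ t = 0) ->
  exists y0 y1 y2 y3 f g : F,
    [/\ an y0 x0, an y1 x0, an y2 x0 & an y3 x0] /\
    [/\ an f x0, an g x0, f x0 != 0, g x0 != 0 &
     \forall x \near x0, forall i,
       cross (grad y0 x) (grad y2 x) i - cross (grad y1 x) (grad y3 x) i = f x * a i x /\
       cross (grad y0 x) (grad y3 x) i + cross (grad y1 x) (grad y2 x) i = g x * b i x].
Proof.
move=> aa ab indep.
have a0 : exists i, a i x0 != 0.
  apply/existsP; apply: contraT; rewrite negb_exists => /forallP a0.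
  have [|/eqP] := indep 1 0; last by rewrite oner_eq0.
  by move=> i; have /negPn/eqP -> := a0 i; rewrite mulr0 mul0r addr0.
have b0 : exists i, b i x0 != 0.
  apply/existsP; apply: contraT; rewrite negb_exists => /forallP b0.
  have [|_ /eqP] := indep 0 1; last by rewrite oner_eq0.
  by move=> i; have /negPn/eqP -> := b0 i; rewrite mulr0 mul0r addr0.
have [tau [ta0 tb0]] := exists_transverse a0 b0.
have tau0 : exists i, tau i != 0.
  apply/existsP; apply: contraT; rewrite negb_exists => /forallP t0.
  by move: ta0; rewrite big1 ?eqxx // => i _; have /negPn/eqP -> := t0 i; rewrite mul0r.
have [l1 [l2 l12]] := exists_unimodular tau0.
pose t := tfun tau x0; have at_ : an t x0 by apply: an_tfun.
have t0 : t x0 = 0 by rewrite /t /tfun subrr /lform big1 // => i _; rewrite mxE mulr0.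
pose al y := \sum_i tau i * a i y; pose be y := \sum_i tau i * b i y.
have aal : an al x0 by apply: an_sum => i; apply: anM => //; apply: an_cst.
have abe : an be x0 by apply: an_sum => i; apply: anM => //; apply: an_cst.
(* Both fields are normalised to have derivative 1 on [t], as the transport equations for [f] and
   [g] require. *)
pose a' i y := a i y * (al y)^-1; pose b' i y := b i y * (be y)^-1.
have aa' i : an (a' i) x0 by apply: anM => //; apply: an_inv.
have ab' i : an (b' i) x0 by apply: anM => //; apply: an_inv.
have Nal := an_neq0 aal ta0; have Nbe := an_neq0 abe tb0.
have Na' : \forall x \near x0, \sum_i a' i x * tau i = 1.
  apply: filterS Nal => x alx; rewrite -[RHS](divff alx) /al big_distrl /=.
  by apply: eq_bigr => i _; rewrite /a' mulrAC (mulrC (a i x)).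
have Nb' : \forall x \near x0, \sum_i b' i x * tau i = 1.
  apply: filterS Nbe => x bex; rewrite -[RHS](divff bex) /be big_distrl /=.
  by apply: eq_bigr => i _; rewrite /b' mulrAC (mulrC (b i x)).
have [wf awf Nf] := exists_divergence_free aa' Na'.
have [wg awg Ng] := exists_divergence_free ab' Nb'.
pose f y := 1 + t y * wf y; pose g y := 1 + t y * wg y.
have af : an f x0 by apply: anD; [apply: an_cst|apply: anM].
have ag : an g x0 by apply: anD; [apply: an_cst|apply: anM].
have f0 : f x0 = 1 by rewrite /f t0 mul0r addr0.
have g0 : g x0 = 1 by rewrite /g t0 mul0r addr0.
pose P i y := a' i y * f y; pose S i y := b' i y * g y.
have aP i : an (P i) x0 by apply: anM.
have aS i : an (S i) x0 by apply: anM.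
pose m y := f y * f y + g y * g y.
have am : an m x0 by apply: anD; apply: anM.
have m0 : m x0 != 0 by rewrite /m f0 g0 mulr1 -[1 + 1]/(2%:R) pnatr_eq0.
have Nm := an_neq0 am m0.
have ami := an_inv am m0.
(* [A + i B] is [(P + i S) / (f + i g)], computed with the conjugate; [m] is the squared modulus of
   [f + i g], equal to 2 at [x0]. *)
pose A i y := (f y * P i y + g y * S i y) * (m y)^-1.
pose B i y := (f y * S i y - g y * P i y) * (m y)^-1.
have aA i : an (A i) x0.
  by apply: anM => //; apply: anD; apply: anM.
have aB i : an (B i) x0.
  by apply: anM => //; apply: anB; apply: anM.
have Nad : \forall x \near x0, adapted A B tau x.
  apply: filterS3 Na' Nb' Nm => x a1 b1 mx.
  have e1 : \sum_i P i x * tau i = f x.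
    by rewrite -[RHS]mul1r -a1 big_distrl /=; apply: eq_bigr => i _; rewrite /P mulrAC.
  have e2 : \sum_i S i x * tau i = g x.
    by rewrite -[RHS]mul1r -b1 big_distrl /=; apply: eq_bigr => i _; rewrite /S mulrAC.
  split.
    transitivity ((f x * (\sum_i P i x * tau i) + g x * (\sum_i S i x * tau i)) * (m x)^-1).
      by rewrite !sum3 /A; ring.
    by rewrite e1 e2 divff.
  transitivity ((f x * (\sum_i S i x * tau i) - g x * (\sum_i P i x * tau i)) * (m x)^-1).
    by rewrite !sum3 /B; ring.
  by rewrite e1 e2 (mulrC (g x)) subrr mul0r.
have al1 : an (lform l1) x0 by apply/entire_an/entire_lform.
have al2 : an (lform l2) x0 by apply/entire_an/entire_lform.
(* On [t = 0] the first integrals are [z1 = (1 + i) l1] and [z2 = l2]. Since [det3 tau l1 l2 = 1],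
   the factor [m1 + i m2] equals [1 + i] there, which is the value of [f + i g]. *)
have [v [av1 av2 Nv]] := germ_cop_exists aA aB (an_cst 0 x0) (an_cst 0 x0) Nad
  (u := (lform l1, lform l1)) al1 al1.
have [w [aw1 aw2 Nw]] := germ_cop_exists aA aB (an_cst 0 x0) (an_cst 0 x0) Nad
  (u := (lform l2, fun=> 0)) al2 (an_cst 0 x0).
pose y0 y := lform l1 y + t y * v.1 y; pose y1 y := lform l1 y + t y * v.2 y.
pose y2 y := lform l2 y + t y * w.1 y; pose y3 y := 0 + t y * w.2 y.
have ay0 : an y0 x0 by apply: anD => //; apply: anM.
have ay1 : an y1 x0 by apply: anD => //; apply: anM.
have ay2 : an y2 x0 by apply: anD => //; apply: anM.
have ay3 : an y3 x0 by apply: anD; [apply: an_cst|apply: anM].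
pose C1 i y := cross (grad y0 y) (grad y2 y) i - cross (grad y1 y) (grad y3 y) i.
pose C2 i y := cross (grad y0 y) (grad y3 y) i + cross (grad y1 y) (grad y2 y) i.
have acr u u' i : an u x0 -> an u' x0 -> an (fun y => cross (grad u y) (grad u' y) i) x0.
  by move=> au au'; apply: an_cross => j; apply: an_pd.
have aC1 i : an (C1 i) x0 by apply: anB; apply: acr.
have aC2 i : an (C2 i) x0 by apply: anD; apply: acr.
pose m1 y := \sum_i tau i * C1 i y; pose m2 y := \sum_i tau i * C2 i y.
have am1 : an m1 x0 by apply: an_sum => i; apply: anM => //; apply: an_cst.
have am2 : an m2 x0 by apply: an_sum => i; apply: anM => //; apply: an_cst.
have NC : \forall x \near x0, forall i, C1 i x = A i x * m1 x - B i x * m2 x /\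
    C2 i x = A i x * m2 x + B i x * m1 x.
  apply: filterS3 Nad Nv Nw => x [tA tB] [v1 v2] [w1 w2].
  have [p1 p2] := cop_eq0 erefl erefl v1 v2.
  have [q1 q2] := cop_eq0 erefl erefl w1 w2.
  exact: (cross_parallel p1 p2 q1 q2 tA tB (fun=> erefl) (fun=> erefl)).
have NdC : \forall x \near x0, divg C1 x = 0 /\ divg C2 x = 0.
  have N4 := nearI (nearI (an_near ay0) (an_near ay1)) (nearI (an_near ay2) (an_near ay3)).
  apply: filterS N4 => x [[n0 n1] [n2 n3]].
  have dcr u u' i : an u x -> an u' x -> differentiable (fun y => cross (grad u y) (grad u' y) i) x.
    by move=> au au'; apply/an_diff/an_cross => j; apply: an_pd.
  rewrite (@divgB _ (fun i y => cross (grad y0 y) (grad y2 y) i) (fun i y => cross (grad y1 y) (grad y3 y) i));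
    try by move=> i; apply: dcr.
  rewrite (@divgD _ (fun i y => cross (grad y0 y) (grad y3 y) i) (fun i y => cross (grad y1 y) (grad y2 y) i));
    try by move=> i; apply: dcr.
  by rewrite !divg_cross // subr0 addr0.
have Lm := pde_of_divergence_free aA aB am1 am2 NC NdC.
have NP : \forall x \near x0, forall i, P i x = A i x * f x - B i x * g x /\
    S i x = A i x * g x + B i x * f x.
  apply: filterS Nm => x mx i; rewrite /A /B; move: mx; rewrite /m.
  move: (P i x) (S i x) (f x) (g x) => p s y z mx.
  by split; field.
have Nfg : \forall x \near x0, divg P x = 0 /\ divg S x = 0.
  by apply: filterS2 Nf Ng.
have Ls := pde_of_divergence_free aA aB af ag NP Nfg.
have adA := an_divg aA; have adB := an_divg aB.
(* Real and imaginary parts of [(m1 + i m2 - f - i g) / t], read off from the expansions of the four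
   determinants and from [f = 1 + t wf], [g = 1 + t wg]. *)
pose k1 y := det3_rest tau l1 l2 t v.1 w.1 y -
  det3_rest tau l1 (fun=> 0) t v.2 w.2 y - wf y.
pose k2 y := det3_rest tau l1 (fun=> 0) t v.1 w.2 y +
  det3_rest tau l1 l2 t v.2 w.1 y - wg y.
have ak1 : an k1 x0.
  by apply: anB => //; apply: anB; apply: an_det3_rest.
have ak2 : an k2 x0.
  by apply: anB => //; apply: anD; apply: an_det3_rest.
have Nk : \forall x \near x0, m1 x - f x = t x * k1 x /\ m2 x - g x = t x * k2 x.
  have N4 := nearI (nearI (an_near av1) (an_near av2)) (nearI (an_near aw1) (an_near aw2)).
  apply: filterS N4 => x [[n0 n1] [n2 n3]].
  have dl l : differentiable (lform l : F) x by apply: diff_lform.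
  have g0' : grad y0 x = (fun i => l1 i + (tau i * v.1 x + t x * grad v.1 x i)).
    by apply/funext => i; rewrite /grad pd_transverse // pd_lform.
  have g1' : grad y1 x = (fun i => l1 i + (tau i * v.2 x + t x * grad v.2 x i)).
    by apply/funext => i; rewrite /grad pd_transverse // pd_lform.
  have g2' : grad y2 x = (fun i => l2 i + (tau i * w.1 x + t x * grad w.1 x i)).
    by apply/funext => i; rewrite /grad pd_transverse // pd_lform.
  have g3' : grad y3 x = (fun i => 0 + (tau i * w.2 x + t x * grad w.2 x i)).
    by apply/funext => i; rewrite /grad (@pd_transverse tau (fun=> 0) w.2 x0 x i _ n3) ?pd_cst.
  have z0 : det3 tau l1 (fun=> 0) = 0.
    by rewrite /det3 sum3 /cross; ring.
  have e1 : m1 x = det3 tau (grad y0 x) (grad y2 x) - det3 tau (grad y1 x) (grad y3 x).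
    by rewrite /det3 -sumrB; apply: eq_bigr => i _; rewrite -mulrBr.
  have e2 : m2 x = det3 tau (grad y0 x) (grad y3 x) + det3 tau (grad y1 x) (grad y2 x).
    by rewrite /det3 -big_split /=; apply: eq_bigr => i _; rewrite -mulrDr.
  rewrite e1 e2 g0' g1' g2' g3' (det3_expand tau l1 l2 t v.1 w.1)
    (det3_expand tau l1 (fun=> 0) t v.2 w.2) (det3_expand tau l1 (fun=> 0) t v.1 w.2)
    (det3_expand tau l1 l2 t v.2 w.1) l12 z0 /k1 /k2 /f /g.
  move: (det3_rest _ _ _ _ _ _ x) (det3_rest _ _ _ _ v.2 _ x) (det3_rest _ _ _ _ v.1 _ x)
    (det3_rest _ _ _ _ _ _ x) (wf x) (wg x) (t x) => r1 r2 r3 r4 z z' s.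
  by split; ring.
(* Near each point [t (k1 + i k2)] is the difference of two solutions of the same linear equation,
   hence a solution; uniqueness then forces [k1] and [k2] to vanish. *)
have NK : \forall x \near x0,
    (cop A B (divg A) (divg B) (cmul t (k1, k2))).1 x = 0 /\
    (cop A B (divg A) (divg B) (cmul t (k1, k2))).2 x = 0.
  have dmf : \forall x \near x0, cdiff (m1, m2) x /\ cdiff (f, g) x.
    apply: filterS2 (nearI (an_near am1) (an_near am2)) (nearI (an_near af) (an_near ag)).
    by move=> x [n1 n2] [n3 n4]; do 2 split; apply: an_diff.
  have N4 := nearI (nearI Lm Ls) (nearI dmf (near_near Nk)).
  apply: filterS N4 => x [[[Lm1 Lm2] [Ls1 Ls2]] [[dm dfg] kx]].
  have [] := @near_eq_cop _ _ A B (divg A) (divg B) (cmul t (k1, k2))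
    (cadd (m1, m2) (cmul (fun=> -1) (f, g))) x.
  - by apply: filterS kx => y [e _] /=; rewrite -e mulN1r.
  - by apply: filterS kx => y [_ e] /=; rewrite -e mulN1r.
  move=> -> ->; have [] := @copD _ _ A B (divg A) (divg B) (m1, m2) (cmul (fun=> -1) (f, g)) x dm.
    by case: dfg => d1 d2; split; apply: (differentiableM (differentiable_cst _ x)).
  move=> -> ->; have [-> ->] := copZ A B (divg A) (divg B) (-1) dfg.
  by rewrite Lm1 Lm2 Ls1 Ls2 !mulr0 !addr0.
have Nk0 := germ_cop_unique aA aB adA adB Nad (w := (k1, k2)) ak1 ak2 NK.
(* The normalisations of [a'] and [b'] are undone, so that the factors refer to the original
   fields. *)
exists y0, y1, y2, y3, (fun y => (al y)^-1 * f y), (fun y => (be y)^-1 * g y).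
split=> //; split.
- by apply: anM => //; apply: an_inv.
- by apply: anM => //; apply: an_inv.
- by rewrite f0 mulr1 invr_eq0.
- by rewrite g0 mulr1 invr_eq0.
apply: filterS2 (nearI Nk Nk0) (nearI NC NP) => x [[e1 e2] [z1 z2]] [cx px] i.
have m1f : m1 x = f x by apply/eqP; rewrite -subr_eq0 e1 [k1 x]z1 mulr0.
have m2g : m2 x = g x by apply/eqP; rewrite -subr_eq0 e2 [k2 x]z2 mulr0.
have [c1 c2] := cx i; have [p1 p2] := px i.
rewrite -/(C1 i x) -/(C2 i x) c1 c2 m1f m2g -p1 -p2 /P /S /a' /b'.
by split; ring.
Qed.

End LocalPotentials.

(** * Immersions *)

Section RowVectors.
Context {R : realType}.

Lemma norm_row_le {n} (v : 'rV[R]_n) (e : R) : 0 <= e -> (forall i, `|v 0 i| <= e) -> `|v| <= e.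
Proof.
move=> e0 ve; rewrite [leLHS]/Num.norm /= mx_normrE.
by apply/bigmax_leP; split => // -[i j] _ /=; rewrite ord1.
Qed.

Lemma differentiable_row {n m} (G : 'rV[R]_n.+1 -> 'rV[R]_m.+1) x :
  (forall j, differentiable (fun y => G y 0 j) x) ->
  differentiable G x /\ forall v j, ('d G x v) 0 j = 'd (fun y => G y 0 j) x v.
Proof.
move=> dG.
have -> : G = (fun y => \sum_j G y 0 j *: delta_mx 0 j).
  by apply/funext => y; rewrite -row_sum_delta.
have dG' : differentiable (fun y => \sum_j G y 0 j *: delta_mx 0 j : 'rV[R]_m.+1) x.
  have := @differentiable_sum _ _ _ m.+1 (fun j y => G y 0 j *: (delta_mx 0 j : 'rV[R]_m.+1)) x.
  have -> : \sum_(i < m.+1) (fun y => G y 0 i *: (delta_mx 0 i : 'rV[R]_m.+1)) =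
      (fun y => \sum_j G y 0 j *: delta_mx 0 j).
    by apply/funext => y; rewrite fct_sumE.
  by apply => j; apply: differentiableZl.
split=> // v j.
have E : (fun y => (\sum_j G y 0 j *: delta_mx 0 j : 'rV[R]_m.+1) 0 j) =
    (fun N : 'rV[R]_m.+1 => N 0 j : R^o) \o (fun y => \sum_j G y 0 j *: delta_mx 0 j : 'rV[R]_m.+1).
  by [].
rewrite [in RHS]E diff_comp //; last exact: differentiable_coord.
have @L : {linear 'rV[R]_m.+1 -> R^o}.
  by exists (fun N : 'rV[R]_m.+1 => N 0 j); do 2![eexists]; do ?[constructor];
     rewrite ?mxE// => ? *; rewrite ?mxE//; move=> ?; rewrite !mxE.
have e := @diff_lin _ _ _ L (\sum_j G x 0 j *: delta_mx 0 j) (@coord_continuous R 1 m.+1 0 j).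
exact: (esym (congr1 (fun g : _ -> _ => g _) e)).
Qed.

Lemma differentiable_rowP {n m} (G : 'rV[R]_n.+1 -> 'rV[R]_m.+1) x :
  (forall j, an (fun y => G y 0 j) x) ->
  differentiable G x /\
  forall v j, ('d G x v) 0 j = \sum_i v 0 i * pd i (fun y => G y 0 j) x.
Proof.
move=> aG; have [dG E] := differentiable_row (fun j => an_diff (aG j)).
by split=> // v j; rewrite E diff_pd //; apply: an_diff.
Qed.

Lemma norm_mulmx_le {n m} (L : 'M[R]_(n, m)) (y : 'rV[R]_n) :
  `|y *m L| <= `|y| * \sum_j \sum_i `|L j i|.
Proof.
apply: norm_row_le => [|i].
  by rewrite mulr_ge0 // sumr_ge0 // => j _; rewrite sumr_ge0.
rewrite mxE big_distrr (le_trans (ler_norm_sum _ _ _)) //= ler_sum // => j _.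
rewrite normrM ler_pM ?norm_coord //.
by rewrite (bigD1 i) //= lerDl sumr_ge0.
Qed.

End RowVectors.

(** * Quantitative local injectivity of analytic immersions *)

Section LocalInjectivity.
Context {R : realType} {n m : nat}.

(** Taylor expansion at [k] with increment [h - k]. Partial derivatives below [1 / (4 (n + 1))]
    bound the linear part by [|h - k| / 4]; the radius [q] makes the quadratic remainder at most
    another [|h - k| / 4]. *)
Lemma lipschitz_small (f : 'rV[R]_n.+1 -> R) x : an f x -> (forall i, pd i f x = 0) ->
  exists2 r, 0 < r & forall h k, in_polydisc r h -> in_polydisc r k ->
    `|f (x + h) - f (x + k)| <= `|h - k| / 2.
Proof.
move=> af f0; have e0 : 0 < (4 * n.+1%:R)^-1 :> R by rewrite invr_gt0 mulr_gt0.
have [s s0 Hs] := finite_radius (index_enum _) (fun i => an_vanish (an_pd i af) e0).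
have {}Hs := Hs s s0 (lexx _).
have /anP[r [C [r0 fC]]] := af.
have C0 : 0 <= C := ana_ge0 fC.
have r2 : 0 < r / 2 by rewrite divr_gt0.
have rr : r / 2 + r / 2 <= r by lra.
have [_ _ T] := pana_pd fC (ltW r2) r2 rr.
pose q := r ^+ 2 / (32 * C + 1).
have C1 : 0 < 32 * C + 1 by lra.
have q0 : 0 < q by rewrite divr_gt0 // exprn_gt0.
exists (Num.min s (Num.min (r / 4) q)).
  by rewrite !lt_min s0 q0 divr_gt0.
move=> h k hm km.
have [hs hr hq] : [/\ in_polydisc s h, in_polydisc (r / 4) h & in_polydisc q h].
  by split; apply: in_polydiscW hm; rewrite !ge_min lexx ?orbT.
have [ks kr kq] : [/\ in_polydisc s k, in_polydisc (r / 4) k & in_polydisc q k].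
  by split; apply: in_polydiscW km; rewrite !ge_min lexx ?orbT.
pose v := h - k; pose eta := `|v|.
have vq : eta <= 2 * q.
  apply: norm_row_le => [|i]; first by rewrite mulr_ge0 // ltW.
  by rewrite !mxE (le_trans (ler_normB _ _)) // mulr_natl mulr2n lerD.
have vr : eta <= r / 2.
  apply: norm_row_le => [|i]; first exact: ltW.
  rewrite !mxE (le_trans (ler_normB _ _)) //.
  by have := hr i; have := kr i; lra.
have kr2 : in_polydisc (r / 2) k by apply: in_polydiscW kr; lra.
have := T k v eta kr2 (norm_coord v) (normr_ge0 _) vr.
have -> : k + v = h by rewrite /v addrC subrK.
set D := \sum_i _ => HT.
have HD : `|D| <= eta / 4.
  apply: le_trans (ler_norm_sum _ _ _) _.
  apply: (@le_trans _ _ (\sum_(i < n.+1) eta * (4 * n.+1%:R)^-1)).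
    apply: ler_sum => i _; rewrite normrM ler_pM ?norm_coord //.
    have := ana_bound (Hs i (mem_index_enum i)) ks; rewrite f0 subr0.
    by rewrite pd_shift.
  rewrite sumr_const card_ord -(mulr_natr (eta * _) n.+1).
  have n0 : n.+1%:R != 0 :> R by rewrite pnatr_eq0.
  rewrite le_eqVlt; apply/orP; left; apply/eqP.
  by move: (n.+1%:R) n0 => y y0; field.
have HC : C * (eta / (r / 2)) ^+ 2 <= eta / 4.
  have -> : C * (eta / (r / 2)) ^+ 2 = eta * (4 * C * eta / r ^+ 2) by field; rewrite gt_eqF.
  rewrite ler_wpM2l // ?normr_ge0 // ler_pdivrMr ?exprn_gt0 //.
  apply: (@le_trans _ _ (4 * C * (2 * q))).
    by rewrite ler_wpM2l // mulr_ge0.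
  rewrite /q; have -> : 4 * C * (2 * (r ^+ 2 / (32 * C + 1))) = r ^+ 2 * (8 * C / (32 * C + 1)).
    by field; rewrite gt_eqF.
  rewrite mulrC ler_wpM2r ?exprn_ge0 ?(ltW r0) // ler_pdivrMr //; lra.
have -> : f (x + h) - f (x + k) = (f (x + h) - f (x + k) - D) + D by rewrite subrK.
apply: le_trans (ler_normD _ _) _.
have -> : `|h - k| / 2 = eta / 4 + eta / 4 by rewrite -/v -/eta; field.
by apply: lerD => //; apply: le_trans HT HC.
Qed.

(** If [L] is a left inverse of the differential at [x], then [Phi *m L] minus the identity has zero
    derivative there, hence Lipschitz constant 1/2 nearby. The inequality yields both the
    injectivity of the embedding and its openness onto the image. *)
Lemma immersion_left_inverse (Phi : 'rV[R]_n.+1 -> 'rV[R]_m.+1) x :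
  (forall j, an (fun y => Phi y 0 j) x) -> (forall v, 'd Phi x v = 0 -> v = 0) ->
  exists (L : 'M[R]_(m.+1, n.+1)) (r : R), 0 < r /\
    forall y z, in_polydisc r (y - x) -> in_polydisc r (z - x) ->
      `|y - z| <= 2 * `|Phi y *m L - Phi z *m L|.
Proof.
move=> aPhi inj; have [_ dE] := differentiable_rowP aPhi.
pose J : 'M[R]_(n.+1, m.+1) := \matrix_(i, j) pd i (fun y => Phi y 0 j) x.
have JE v : 'd Phi x v = v *m J.
  by apply/rowP => j; rewrite dE mxE; apply: eq_bigr => i _; rewrite mxE.
have fJ : row_free J by apply: inj_row_free => v; rewrite -JE => /inj.
have [L JL] : exists L, J *m L = 1%:M by exists (pinvmx J); apply: mulmxVp.
pose psi i y : R := (Phi y *m L) 0 i - y 0 i.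
have aPL i : an (fun y => (Phi y *m L) 0 i) x.
  have -> : (fun y => (Phi y *m L) 0 i) = (fun y => \sum_j Phi y 0 j * L j i).
    by apply/funext => y; rewrite mxE.
  by apply: an_sum => j; apply: anM => //; apply: an_cst.
have apsi i : an (psi i) x by apply: anB => //; apply: an_coord.
have psi0 i k : pd k (psi i) x = 0.
  rewrite /psi pdB ?pd_coord; [|exact: an_diff|exact/an_diff/an_coord].
  have -> : (fun y => (Phi y *m L) 0 i) = (fun y => \sum_j Phi y 0 j * L j i).
    by apply/funext => y; rewrite mxE.
  have dP j : differentiable (fun y => Phi y 0 j) x := an_diff (aPhi j).
  have dPL j : differentiable (fun y => Phi y 0 j * L j i) x.
    exact: (differentiableM (dP j) (differentiable_cst _ _)).
  rewrite (proj2 (pd_sum _ k (f := fun j y => Phi y 0 j * L j i) dPL)).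
  have -> : \sum_j pd k (fun y => Phi y 0 j * L j i) x = (J *m L) k i.
    rewrite mxE; apply: eq_bigr => j _; rewrite mxE.
    have e := pdM k (dP j) (differentiable_cst (L j i) x).
    by rewrite pd_cst mulr0 addr0 in e; exact: e.
  by rewrite JL mxE subrr.
have H i : exists2 r, 0 < r & forall s, 0 < s -> s <= r -> forall h k,
    in_polydisc s h -> in_polydisc s k -> `|psi i (x + h) - psi i (x + k)| <= `|h - k| / 2.
  have [r r0 Hr] := lipschitz_small (apsi i) (psi0 i).
  by exists r => // s s0 sr h k hs ks; apply: Hr; [apply: in_polydiscW hs|apply: in_polydiscW ks].
have [r r0 Hr] := finite_radius (index_enum _) H.
exists L, r; split=> // y z yr zr.
set w := Phi y *m L - Phi z *m L.
have h2 : `|y - z - w| <= `|y - z| / 2.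
  apply: norm_row_le => [|i]; first by rewrite divr_ge0.
  have := Hr r r0 (lexx _) i (mem_index_enum i) _ _ yr zr.
  have e u : x + (u - x) = u by rewrite addrC subrK.
  rewrite !e /psi; have -> : y - x - (z - x) = y - z by rewrite opprB addrA subrK.
  suff -> : (Phi y *m L) 0 i - y 0 i - ((Phi z *m L) 0 i - z 0 i) = - (y - z - w) 0 i.
    by rewrite normrN.
  by rewrite /w; move: (Phi y *m L) (Phi z *m L) => P Q; rewrite !mxE; ring.
have := ler_normD (y - z - w) w; rewrite subrK; lra.
Qed.

End LocalInjectivity.

(** * Coframes and charts *)

Definition dot3 {R : realType} (u v : 'I_3 -> R) : R := \sum_i u i * v i.

Section Coframe.
Context {R : realType}.
Implicit Types (a b e u v w : 'I_3 -> R) (f g D : R).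

(** When [u + i u'] and [v + i v'] are the gradients of z1 and z2, the left side is the real part of
    dz1 /\ dz2 on [(x, y)]; [dot3_crossD] is the imaginary part. *)
Lemma dot3_crossB u v w u' v' :
  (forall i, cross u v i - cross u' v' i = w i) -> forall x y,
  dot3 u x * dot3 v y - dot3 u' x * dot3 v' y - (dot3 u y * dot3 v x - dot3 u' y * dot3 v' x) =
  dot3 w (cross x y).
Proof.
move=> E x y; rewrite /dot3 !sum3 -!E /cross !nxtE; ring.
Qed.

(* [omega = f det(a, ., .)] and [phi = g det(b, ., .)] in terms of the coframe
   dual to the frame [(a, b, e)]. *)
Definition coframe1 a b e f : 'I_3 -> R := fun i => - (f / det3 a b e) * cross e a i.
Definition coframe3 a b e g : 'I_3 -> R := fun i => (g / det3 a b e) * cross b e i.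

Lemma dot3_coframe1 a b e f v : dot3 (coframe1 a b e f) v = - (f / det3 a b e) * dot3 (cross e a) v.
Proof. by rewrite /dot3 big_distrr; apply: eq_bigr => i _ /=; rewrite mulrA. Qed.

Lemma dot3_coframe3 a b e g v : dot3 (coframe3 a b e g) v = (g / det3 a b e) * dot3 (cross b e) v.
Proof. by rewrite /dot3 big_distrr; apply: eq_bigr => i _ /=; rewrite mulrA. Qed.

Lemma wedge_coframe1 a b e f v w : det3 a b e != 0 ->
  f * det3 a v w = dot3 (cross a b) v * dot3 (coframe1 a b e f) w -
                   dot3 (cross a b) w * dot3 (coframe1 a b e f) v.
Proof.
move=> D0; rewrite !dot3_coframe1.
have P : det3 a b e * det3 a v w =
    dot3 (cross a b) w * dot3 (cross e a) v - dot3 (cross a b) v * dot3 (cross e a) w.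
  by rewrite /det3 /dot3 !sum3 /cross !nxtE; ring.
have -> : f * det3 a v w = f / det3 a b e * (det3 a b e * det3 a v w) by field.
by rewrite P; ring.
Qed.

Lemma wedge_coframe3 a b e g v w : det3 a b e != 0 ->
  g * det3 b v w = dot3 (cross a b) v * dot3 (coframe3 a b e g) w -
                   dot3 (cross a b) w * dot3 (coframe3 a b e g) v.
Proof.
move=> D0; rewrite !dot3_coframe3.
have P : det3 a b e * det3 b v w =
    dot3 (cross a b) v * dot3 (cross b e) w - dot3 (cross a b) w * dot3 (cross b e) v.
  by rewrite /det3 /dot3 !sum3 /cross !nxtE; ring.
have -> : g * det3 b v w = g / det3 a b e * (det3 a b e * det3 b v w) by field.
by rewrite P; ring.
Qed.

Lemma cramer3 a b e v i : det3 a b e * v i =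
  dot3 (cross b e) v * a i + dot3 (cross e a) v * b i + dot3 (cross a b) v * e i.
Proof.
by elim/all3: i; rewrite /det3 /dot3 !sum3 /cross !nxtE; ring.
Qed.

Lemma dual_coframe a b e :
  [/\ dot3 (cross a b) a = 0, dot3 (cross a b) b = 0 & dot3 (cross a b) e = det3 a b e].
Proof. by split; rewrite /det3 /dot3 !sum3 /cross !nxtE; ring. Qed.

Lemma det3_rot a b e : det3 b e a = det3 a b e.
Proof. by rewrite /det3 !sum3 /cross !nxtE; ring. Qed.

(** Each vector of the frame [(a, b, e)] is killed by two of the three forms but not by the third,
    so evaluation on the frame isolates the coefficients. *)
Lemma coframe_independent a b e f g : det3 a b e != 0 -> f != 0 -> g != 0 ->
  forall s1 s2 s3, (forall v, s1 * dot3 (coframe1 a b e f) v + s2 * dot3 (cross a b) v +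
    s3 * dot3 (coframe3 a b e g) v = 0) -> [/\ s1 = 0, s2 = 0 & s3 = 0].
Proof.
move=> D0 f0 g0 s1 s2 s3 H.
have [h1 h2 h3] := dual_coframe a b e.
have [k1 k2 k3] := dual_coframe b e a; rewrite det3_rot in k3.
have [l1 l2 l3] := dual_coframe e a b; rewrite det3_rot det3_rot in l3.
have := H a; have := H b; have := H e.
rewrite !dot3_coframe1 !dot3_coframe3 h1 h2 h3 k1 k2 k3 l1 l2 l3 !mulr0 !addr0 !add0r.
move=> e2 e1 e3; split.
- move/eqP: e1; rewrite mulf_eq0 => /orP[/eqP//|].
  by rewrite mulf_eq0 oppr_eq0 mulf_eq0 invr_eq0 (negbTE f0) (negbTE D0).
- by move/eqP: e2; rewrite mulf_eq0 (negbTE D0) orbF => /eqP.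
- move/eqP: e3; rewrite mulf_eq0 => /orP[/eqP//|].
  by rewrite mulf_eq0 mulf_eq0 invr_eq0 (negbTE g0) (negbTE D0).
Qed.

Lemma kernel_coframe1 a b e f v : det3 a b e != 0 -> f != 0 ->
  (dot3 (coframe1 a b e f) v = 0 /\ dot3 (cross a b) v = 0) <-> exists t, forall i, v i = t * a i.
Proof.
move=> D0 f0; rewrite dot3_coframe1; split=> [[/eqP]|[t vt]].
  rewrite mulf_eq0 oppr_eq0 mulf_eq0 invr_eq0 (negbTE f0) (negbTE D0) /= => /eqP h1 h2.
  exists (dot3 (cross b e) v / det3 a b e) => i; apply: (mulfI D0).
  by rewrite cramer3 h1 h2 !mul0r !addr0; field.
rewrite (funext vt); split; rewrite /dot3 !sum3 /cross !nxtE; ring.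
Qed.

Lemma kernel_coframe3 a b e g v : det3 a b e != 0 -> g != 0 ->
  (dot3 (cross a b) v = 0 /\ dot3 (coframe3 a b e g) v = 0) <-> exists t, forall i, v i = t * b i.
Proof.
move=> D0 g0; rewrite dot3_coframe3; split=> [[h2 /eqP]|[t vt]].
  rewrite mulf_eq0 mulf_eq0 invr_eq0 (negbTE g0) (negbTE D0) /= => /eqP h1.
  exists (dot3 (cross e a) v / det3 a b e) => i; apply: (mulfI D0).
  by rewrite cramer3 h1 h2 !mul0r add0r addr0; field.
rewrite (funext vt); split; rewrite /dot3 !sum3 /cross !nxtE; ring.
Qed.

(** The coordinates of [v] in the frame [(a, b, e)] are, up to sign and the factor [det3 a b e],
    values of the contractions of [v] with the two determinants. *)
Lemma det3_nondegenerate a b e v : det3 a b e != 0 ->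
  (forall w, det3 a v w = 0) -> (forall w, det3 b v w = 0) -> forall i, v i = 0.
Proof.
move=> D0 ha hb i; apply: (mulfI D0); rewrite cramer3 mulr0.
have -> : dot3 (cross b e) v = - det3 b v e by rewrite /det3 /dot3 !sum3 /cross !nxtE; ring.
have -> : dot3 (cross e a) v = det3 a v e by rewrite /det3 /dot3 !sum3 /cross !nxtE; ring.
have -> : dot3 (cross a b) v = - det3 a v b by rewrite /det3 /dot3 !sum3 /cross !nxtE; ring.
by rewrite !ha hb oppr0 !mul0r !addr0.
Qed.

(** The determinant is the squared length of [cross a b]. If it vanishes, then
    [b i * a - a i * b = 0] for each [i], and independence forces [a = 0], a contradiction. *)
Lemma det3_cross_neq0 a b : (forall s t, (forall i, s * a i + t * b i = 0) -> s = 0 /\ t = 0) ->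
  det3 a b (cross a b) != 0.
Proof.
move=> indep; apply/eqP => D0.
have E : cross a b o0 ^+ 2 + cross a b o1 ^+ 2 + cross a b o2 ^+ 2 = 0.
  by rewrite -D0 /det3 sum3 /cross !nxtE; ring.
have c0 : forall i, cross a b i = 0.
  move: E; move: (cross a b) => c E.
  have := sqr_ge0 (c o0); have := sqr_ge0 (c o1); have := sqr_ge0 (c o2) => h2 h1 h0.
  by apply: all3; apply/eqP; rewrite -sqrf_eq0; apply/eqP; lra.
have ai i : a i = 0.
  have := c0 o0; have := c0 o1; have := c0 o2; rewrite /cross !nxtE => h2 h1 h0.
  have [|_ /eqP] := indep (b i) (- a i).
    by elim/all3: i => /=; apply: all3; lra.
  by rewrite oppr_eq0 => /eqP.
have [|/eqP] := indep 1 0; last by rewrite oner_eq0.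
by move=> i; rewrite ai mulr0 mul0r addr0.
Qed.

End Coframe.

(** The image point [y] is a separate variable so that differentials based at [chart_map d q] need
    no rewriting of their base point. *)
Lemma diff_comp_at {R : realType} {V1 V2 V3 : normedModType R} (f : V1 -> V2) (g : V2 -> V3)
    x y v : f x = y -> differentiable f x -> differentiable g y ->
  differentiable (g \o f) x /\ 'd (g \o f) x v = 'd g y ('d f x v).
Proof.
move=> <- df dg; split; first exact: differentiable_comp.
by rewrite diff_comp.
Qed.

Lemma near_eq_diff_at {R : realType} {V W : normedModType R} (f g : V -> W) x v :
  {near x, f =1 g} -> differentiable f x -> 'd g x v = 'd f x v.
Proof. by move=> fg df; have [_ ->] := near_eq_diff fg df. Qed.

(** * Tangent vectors and changes of chart *)

Section Charts.
Context {R : realType} {M : topologicalType}.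
Variable A : set (chart R M).
Hypothesis hM : analytic_manifold A.
Implicit Types (c d e : chart R M) (q : M).

Lemma charts_at_transition c d q j : charts_at A q c -> charts_at A q d ->
  an (fun x => transition c d x 0 j) (chart_map c q).
Proof. by case: hM => _ _ _ H [Ac qc] [Ad qd]; apply: H. Qed.

Lemma open_chart_image c (U : set M) : open U -> open (chart_map c @` (U `&` chart_dom c)).
Proof.
move=> oU; rewrite openE => _ [q [Uq qc] <-].
have ic := @chart_inv_continuous _ _ c.
rewrite continuous_open_subspace in ic; last exact: chart_image_open.
have cq : chart_map c q \in chart_map c @` chart_dom c by rewrite inE; exists q.
have N1 : nbhs (chart_map c q) (chart_inv c @^-1` (U `&` chart_dom c)).
  apply: (ic _ cq); rewrite chart_mapK //; apply: open_nbhs_nbhs; split => //.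
  by apply: openI => //; apply: chart_dom_open.
have N2 : nbhs (chart_map c q) (chart_map c @` chart_dom c).
  by apply: open_nbhs_nbhs; split; [apply: chart_image_open|exists q].
apply: filterS2 N1 N2 => x /= Ux [q' q'c xE]; exists q' => //; split => //.
by move: Ux; rewrite -xE chart_mapK // => -[].
Qed.

Lemma near_chart c (U : set M) q : open U -> U q -> chart_dom c q ->
  \forall x \near chart_map c q, exists q', [/\ U q', chart_dom c q' & x = chart_map c q'].
Proof.
move=> oU Uq qc.
have : nbhs (chart_map c q) (chart_map c @` (U `&` chart_dom c)).
  by apply: open_nbhs_nbhs; split; [apply: open_chart_image|exists q].
by apply: filterS => x [q' [Uq' q'c] <-]; exists q'.
Qed.

Lemma open_chart_preimage c (N : set 'rV[R]_3) : open N ->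
  open (chart_dom c `&` chart_map c @^-1` N).
Proof.
move=> oN; have cc := @chart_map_continuous _ _ c.
rewrite continuous_open_subspace in cc; last exact: chart_dom_open.
rewrite openE => q [qc Nq].
have qi : q \in chart_dom c by rewrite inE.
have N1 : nbhs q (chart_map c @^-1` N) by apply: (cc _ qi); apply: open_nbhs_nbhs.
have N2 : nbhs q (chart_dom c) by apply: open_nbhs_nbhs; split => //; apply: chart_dom_open.
by apply: filterS2 N2 N1.
Qed.

Lemma transition_id c q : chart_dom c q ->
  {near chart_map c q, transition c c =1 id}.
Proof.
move=> qc; apply: filterS (near_chart (@openT M) I qc) => x [q' [_ q'c ->]].
by rewrite /transition /= chart_mapK.
Qed.

Lemma transition_comp c d e q : chart_dom c q -> chart_dom d q ->
  {near chart_map c q, transition d e \o transition c d =1 transition c e}.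
Proof.
move=> qc qd; apply: filterS (near_chart (chart_dom_open d) qd qc) => x [q' [q'd q'c ->]].
by rewrite /transition /= !chart_mapK.
Qed.

Lemma transition_chart c d q : chart_dom c q -> transition c d (chart_map c q) = chart_map d q.
Proof. by move=> qc; rewrite /transition /= chart_mapK. Qed.

Lemma transition_diff c d q : charts_at A q c -> charts_at A q d ->
  differentiable (transition c d) (chart_map c q).
Proof.
by move=> cq dq; have [] := differentiable_rowP (fun j => charts_at_transition j cq dq).
Qed.

Lemma diff_transition_comp c d e q u : charts_at A q c -> charts_at A q d -> charts_at A q e ->
  'd (transition d e) (chart_map d q) ('d (transition c d) (chart_map c q) u) =
  'd (transition c e) (chart_map c q) u.
Proof.
move=> cq dq eq; have [qc qd] : chart_dom c q /\ chart_dom d q by case: cq dq => _ ? [].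
have dcd := transition_diff cq dq; have dde := transition_diff dq eq.
have [dcomp E] := diff_comp_at u (transition_chart d qc) dcd dde.
exact: (etrans (esym E) (esym (near_eq_diff_at u (transition_comp e qc qd) dcomp))).
Qed.

Lemma diff_transition_id c q u : charts_at A q c ->
  'd (transition c c) (chart_map c q) u = u.
Proof.
move=> [_ qc]; have did : differentiable (id : 'rV[R]_3 -> 'rV[R]_3) (chart_map c q) by [].
have N : {near chart_map c q, id =1 transition c c}.
  by apply: filterS (transition_id qc) => x ->.
exact: (etrans (near_eq_diff_at u N did) (congr1 (fun g : _ -> _ => g u) (diff_val (f := id)))).
Qed.

(** One chart around [q] determines the components in all the others through the transition
    differentials, and away from [q] the families are 0 by convention. Equalities of families are
    reduced to coordinates this way. *)
Lemma tangent_eq q c v w : charts_at A q c -> tangent A q v -> tangent A q w ->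
  v c = w c -> v = w.
Proof.
move=> cq [v1 v2] [w1 w2] vw; apply/funext => d.
have [dq|ndq] := pselect (charts_at A q d); last by rewrite v2 ?w2.
by rewrite (v1 c d) // (w1 c d) // vw.
Qed.

Lemma tangent_ofE c d q u : charts_at A q d ->
  tangent_of A c q u d = 'd (transition c d) (chart_map c q) u.
Proof. by move=> dq; rewrite /tangent_of /patch mem_set. Qed.

Lemma tangent_of_tangent c q u : charts_at A q c -> tangent A q (tangent_of A c q u).
Proof.
move=> cq; split=> [d e dq eq|d ndq].
  rewrite (tangent_ofE c u dq) (tangent_ofE c u eq).
  exact: esym (diff_transition_comp u cq dq eq).
by rewrite /tangent_of /patch memNset.
Qed.

Lemma tangent_ofK c q u : charts_at A q c -> tangent_of A c q u c = u.
Proof. by move=> cq; rewrite (tangent_ofE c u cq); exact: diff_transition_id. Qed.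

Lemma tangentZ q v (t : R) : tangent A q v -> tangent A q (t *: v).
Proof.
move=> [v1 v2]; split=> [c d cq dq|c ncq].
  by rewrite /= [in RHS]linearZ -v1.
exact: (etrans (congr1 ( *:%R t) (v2 c ncq)) (scaler0 _ t)).
Qed.

(** The chain rule through the transition to [c0], absorbed by the transformation law of [v]. Every
    computation with the embedding then takes place in the single chart [c0]. *)
Lemma differentialE {m} (Phi : 'rV[R]_3 -> 'rV[R]_m.+1) c c0 q v :
  charts_at A q c -> charts_at A q c0 ->
  (forall j, an (fun x => Phi x 0 j) (chart_map c0 q)) -> tangent A q v ->
  differential (Phi \o chart_map c0) c q v = 'd Phi (chart_map c0 q) (v c0).
Proof.
move=> cq c0q aPhi [v1 _]; have [_ qc] := cq.
have dT := transition_diff cq c0q.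
have [dPhi _] := differentiable_rowP aPhi.
have [_ E] := diff_comp_at (v c) (transition_chart c0 qc) dT dPhi.
by rewrite /differential (v1 c c0 cq c0q); exact: E.
Qed.

End Charts.

(** * Restriction, forms and line fields *)

Lemma Ck_on_subset {R : realType} {n : nat} k (W W' : set 'rV[R]_n.+1) f :
  W' `<=` W -> Ck_on k W f -> Ck_on k W' f.
Proof.
move=> WW'; elim: k f => [|k IH] f [cf df]; split; try by move=> x /WW'; apply: cf.
  by [].
move=> i; have [d1 d2] := df i; split; last exact: IH.
by move=> x /WW'; apply: d1.
Qed.

Section Restriction.
Context {R : realType} {M : topologicalType}.
Variable A : set (chart R M).

Lemma vector_field_subset (V V' : set M) X : V' `<=` V ->
  vector_field smooth_on A V X -> vector_field smooth_on A V' X.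
Proof.
move=> VV' [X1 X2]; split=> [q /VV'|c Ac j]; first exact: X1.
move=> k; apply: Ck_on_subset (X2 c Ac j k) => _ [q [V'q qc] <-].
by exists q => //; split => //; apply: VV'.
Qed.

Lemma line_subbundle_subset (U U' : set M) P : open U' -> U' `<=` U ->
  line_subbundle smooth_on A U P -> line_subbundle smooth_on A U' P.
Proof.
move=> oU' UU' H p U'p; have [V [X [oV Vp VU vX HX]]] := H p (UU' p U'p).
exists (V `&` U'), X; split => //.
- exact: openI.
- by apply: vector_field_subset vX => q [].
- by move=> q [/HX].
Qed.

Lemma plane_subbundle_subset (U U' : set M) P : open U' -> U' `<=` U ->
  plane_subbundle smooth_on A U P -> plane_subbundle smooth_on A U' P.
Proof.
move=> oU' UU' H p U'p; have [V [X [Y [oV Vp VU [vX vY] HX]]]] := H p (UU' p U'p).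
exists (V `&` U'), X, Y; split => //.
- exact: openI.
- by split; [apply: vector_field_subset vX => q []|apply: vector_field_subset vY => q []].
- by move=> q [/HX].
Qed.

Lemma path_geometry_subset (U U' : set M) P1 P2 : open U' -> U' `<=` U ->
  path_geometry A U P1 P2 -> path_geometry A U' P1 P2.
Proof.
move=> oU' UU' [l1 l2 [pl ni]]; split; try exact: line_subbundle_subset UU' _.
split; first exact: plane_subbundle_subset UU' _.
by move=> V X Y oV VU'; apply: ni => //; apply: subset_trans UU'.
Qed.

End Restriction.

Section Forms.
Context {R : realType} {M : topologicalType}.
Variable A : set (chart R M).
Hypothesis hM : analytic_manifold A.
Local Notation family := (chart R M -> 'rV[R]_3).
Implicit Types (v w : family).

Definition chart_form (c0 : chart R M) (th : 'rV[R]_3 -> 'I_3 -> R) (q : M) v : R :=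
  dot3 (th (chart_map c0 q)) (v c0 0).

(** In another chart the coefficients are those of [th] composed with the transition and contracted
    with its Jacobian. They are analytic, and smoothness follows. *)
Lemma one_form_chart_form c0 (V : set M) th : A c0 -> open V -> V `<=` chart_dom c0 ->
  (forall q, V q -> forall i, an (fun x => th x i) (chart_map c0 q)) ->
  one_form smooth_on A V (chart_form c0 th).
Proof.
move=> Ac0 oV Vc0 ath; split=> [q Vq t v w _ _|c Ac u].
  by rewrite /chart_form /dot3 big_distrr -big_split; apply: eq_bigr => i _ /=; rewrite !mxE; ring.
suff ran : real_analytic_on (chart_map c @` (V `&` chart_dom c))
    (fun x => chart_form c0 th (chart_inv c x) (tangent_of A c (chart_inv c x) u)).
  by move=> k; apply: an_smooth.
move=> _ [q [Vq qc] <-].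
pose T := transition c c0.
have cq : charts_at A q c by []; have c0q : charts_at A q c0 by split => //; apply: Vc0.
apply: (@near_eq_an _ _ (fun x => \sum_i th (T x) i * \sum_j u 0 j * pd j (fun y => T y 0 i) x)).
  apply: filterS (near_chart oV Vq qc) => x [q' [Vq' q'c ->]].
  have cq' : charts_at A q' c by []; have c0q' : charts_at A q' c0 by split => //; apply: Vc0.
  have [_ dT] := differentiable_rowP (fun j => charts_at_transition hM j cq' c0q').
  rewrite /chart_form chart_mapK // (tangent_ofE c u c0q') -(transition_chart c0 q'c).
  by apply: eq_bigr => i _; rewrite -dT.
apply: an_sum => i; apply: anM.
  apply: (@an_comp _ _ _ (fun x => th x i) T) => [j|].
    exact: (charts_at_transition hM j cq c0q).
  by rewrite /T transition_chart //; apply: ath.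
apply: an_sum => j; apply: anM; first exact: an_cst.
by apply: an_pd; exact: (charts_at_transition hM i cq c0q).
Qed.

End Forms.

Section LineFields.
Context {R : realType} {M : topologicalType}.
Local Notation family := (chart R M -> 'rV[R]_3).
Implicit Types (v w X Y : family).

(** Expressing each pair through the other gives two 2 by 2 matrices, inverse to each other because
    [X] and [Y] are independent. Their determinants multiply to 1, so a relation between [v1] and
    [v2] is trivial. *)
Lemma span_independent (P1 P2 : set family) (X Y v1 v2 : family) :
  independent2 X Y ->
  [set v | exists u1 u2, [/\ P1 u1, P2 u2 & v = u1 + u2]] = [set v | exists s t : R, v = s *: X + t *: Y] ->
  P1 = [set v | exists t : R, v = t *: v1] -> P2 = [set v | exists t : R, v = t *: v2] ->
  independent2 v1 v2.
Proof.
move=> ind E E1 E2 s t st.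
have span v : (exists s t : R, v = s *: v1 + t *: v2) <-> exists s t : R, v = s *: X + t *: Y.
  have -> : (exists s t : R, v = s *: X + t *: Y) =
     [set v | exists u1 u2, [/\ P1 u1, P2 u2 & v = u1 + u2]] v by rewrite E.
  rewrite E1 E2 /=; split=> [[s' [t' ->]]|[_ [_ [[s' ->] [t' ->] ->]]]]; last by exists s', t'.
  by exists (s' *: v1), (t' *: v2); split => //; [exists s'|exists t'].
have [s1 [t1 e1]] : exists s t : R, v1 = s *: X + t *: Y.
  by apply/span; exists 1, 0; rewrite scale1r scale0r addr0.
have [s2 [t2 e2]] : exists s t : R, v2 = s *: X + t *: Y.
  by apply/span; exists 0, 1; rewrite scale1r scale0r add0r.
have [a1 [b1 f1]] : exists s t : R, X = s *: v1 + t *: v2.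
  by apply/span; exists 1, 0; rewrite scale1r scale0r addr0.
have [a2 [b2 f2]] : exists s t : R, Y = s *: v1 + t *: v2.
  by apply/span; exists 0, 1; rewrite scale1r scale0r add0r.
have L x y : x *: v1 + y *: v2 = (x * s1 + y * s2) *: X + (x * t1 + y * t2) *: Y.
  by rewrite e1 e2 !scalerDr !scalerA addrACA -!scalerDl.
have [z1 z2] : s * s1 + t * s2 = 0 /\ s * t1 + t * t2 = 0 by apply: ind; rewrite -L.
have [w1 w2] : a1 * s1 + b1 * s2 - 1 = 0 /\ a1 * t1 + b1 * t2 = 0.
  by apply: ind; rewrite scalerBl scale1r addrAC -L -f1 subrr.
have [w3 w4] : a2 * s1 + b2 * s2 = 0 /\ a2 * t1 + b2 * t2 - 1 = 0.
  by apply: ind; rewrite scalerBl scale1r addrA -L -f2 subrr.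
have w1' : a1 * s1 + b1 * s2 = 1 by apply/eqP; rewrite -subr_eq0 w1.
have w4' : a2 * t1 + b2 * t2 = 1 by apply/eqP; rewrite -subr_eq0 w4.
have D : (s1 * t2 - s2 * t1) * (a1 * b2 - a2 * b1) = 1.
  transitivity ((a1 * s1 + b1 * s2) * (a2 * t1 + b2 * t2) - (a2 * s1 + b2 * s2) * (a1 * t1 + b1 * t2)); first by ring.
  by rewrite w1' w4' w3 w2 mul0r subr0 mulr1.
have D0 : s1 * t2 - s2 * t1 != 0 by apply/eqP => D0; move/eqP: D; rewrite D0 mul0r eq_sym oner_eq0.
split; apply: (mulIf D0); rewrite mul0r.
  transitivity (t2 * (s * s1 + t * s2) - s2 * (s * t1 + t * t2)); first by ring.
  by rewrite z1 z2 !mulr0 subr0.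
transitivity (s1 * (s * t1 + t * t2) - t1 * (s * s1 + t * s2)); first by ring.
by rewrite z1 z2 !mulr0 subr0.
Qed.

End LineFields.

(** * The embedding *)

Section LocalEmbedding.
Context {R : realType}.
Local Notation F := ('rV[R]_3 -> R).

Lemma dot3_crossD (u v u' v' w : 'I_3 -> R) :
  (forall i, cross u v i + cross u' v' i = w i) -> forall x y,
  dot3 u x * dot3 v y + dot3 u' x * dot3 v' y - (dot3 u y * dot3 v x + dot3 u' y * dot3 v' x) =
  dot3 w (cross x y).
Proof. by move=> E x y; rewrite /dot3 !sum3 -!E /cross !nxtE; ring. Qed.

Lemma det3Z f (a v w : 'I_3 -> R) : dot3 (fun i => f * a i) (cross v w) = f * det3 a v w.
Proof. by rewrite /det3 /dot3 big_distrr; apply: eq_bigr => i _ /=; rewrite mulrA. Qed.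

(** All that the embedding needs at a point, gathered so that one neighbourhood serves for every
    condition. *)
Record good_point (a b : 'I_3 -> F) (Phi : 'rV[R]_3 -> 'rV[R]_4) (f g : F)
    (x : 'rV[R]_3) : Prop := GoodPoint {
  good_a : forall i, an (a i) x;
  good_b : forall i, an (b i) x;
  good_Phi : forall j, an (fun y => Phi y 0 j) x;
  good_f : an f x;
  good_g : an g x;
  good_f0 : f x != 0;
  good_g0 : g x != 0;
  good_det : det3 (a^~ x) (b^~ x) (cross (a^~ x) (b^~ x)) != 0;
  good_omega : forall v w : 'rV[R]_3,
    omega0 ('d Phi x v) ('d Phi x w) = f x * det3 (a^~ x) (v 0) (w 0);
  good_phi : forall v w : 'rV[R]_3,
    phi0 ('d Phi x v) ('d Phi x w) = g x * det3 (b^~ x) (v 0) (w 0) }.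

Lemma good_point_immersion a b Phi f g x : good_point a b Phi f g x ->
  forall v, 'd Phi x v = 0 -> v = 0.
Proof.
move=> [_ _ _ _ _ f0 g0 D0 om ph] v v0.
have z (w : 'rV[R]_4) : dz1_dz2 0 w = 0.
  by rewrite /dz1_dz2 /z1 /z2 !mxE -[Complex 0 0]/(0 : R[i]) mul0r mulr0 subrr.
apply/rowP => i; rewrite mxE.
have row u : exists w : 'rV[R]_3, w 0 = u.
  by exists (\row_i u i); apply/funext => k; rewrite mxE.
apply: (det3_nondegenerate D0) i => u; have [w <-] := row u.
  by apply: (mulfI f0); rewrite -om v0 /omega0 z mulr0.
by apply: (mulfI g0); rewrite -ph v0 /phi0 z mulr0.
Qed.

Lemma exists_good_map (a b : 'I_3 -> F) x0 :
  (forall i, an (a i) x0) -> (forall i, an (b i) x0) ->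
  (forall s t : R, (forall i, s * a i x0 + t * b i x0 = 0) -> s = 0 /\ t = 0) ->
  exists Phi f g, \forall x \near x0, good_point a b Phi f g x.
Proof.
move=> aa ab indep.
have [y0 [y1 [y2 [y3 [f [g [[ay0 ay1 ay2 ay3] [af ag f0 g0 N]]]]]]]] := exists_potentials aa ab indep.
(* The default value [y3] of [nth] is the fourth component. *)
pose Phi x : 'rV[R]_4 := \row_j nth y3 [:: y0; y1; y2] j x.
exists Phi, f, g.
have PhiE (j : 'I_4) : (fun y => Phi y 0 j) = nth y3 [:: y0; y1; y2] j.
  by apply/funext => y; rewrite mxE.
have aPhi j : an (fun y => Phi y 0 j) x0.
  by rewrite PhiE; case: j => [[|[|[|[|j]]]] lj].
have D0 := det3_cross_neq0 indep.
have aD : an (fun y => det3 (a^~ y) (b^~ y) (cross (a^~ y) (b^~ y))) x0.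
  by apply: an_det3 => // i; apply: an_cross.
have N1 : \forall x \near x0, forall i, an (a i) x /\ an (b i) x.
  by apply: near_forall3 => i; apply: nearI; apply: an_near.
have N2 : \forall x \near x0, (an y0 x /\ an y1 x) /\ (an y2 x /\ an y3 x).
  by apply: nearI; apply: nearI; apply: an_near.
have N3 : \forall x \near x0, (an f x /\ f x != 0) /\ (an g x /\ g x != 0).
  by apply: nearI; apply: nearI; (exact: an_near || exact: an_neq0).
apply: filterS2 (nearI N1 N2) (nearI N3 (nearI N (an_neq0 aD D0))).
move=> x [abx [[n0 n1] [n2 n3]]] [[[fx fx0] [gx gx0]] [E Dx]].
have aPhix j : an (fun y => Phi y 0 j) x.
  by rewrite PhiE; case: j => [[|[|[|[|j]]]] lj].
have [_ dE] := differentiable_rowP aPhix.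
have dPhi (v : 'rV[R]_3) j : ('d Phi x v) 0 j = dot3 (grad (nth y3 [:: y0; y1; y2] j) x) (v 0).
  by rewrite dE /dot3; apply: eq_bigr => i _; rewrite mulrC PhiE.
split=> //; try by move=> i; have [] := abx i.
- move=> v w; rewrite -det3Z -(dot3_crossB (fun i => proj1 (E i))).
  by rewrite /omega0 /dz1_dz2 /z1 /z2 !dPhi /=.
- move=> v w; rewrite -det3Z -(dot3_crossD (fun i => proj2 (E i))).
  by rewrite /phi0 /dz1_dz2 /z1 /z2 !dPhi /=.
Qed.

End LocalEmbedding.

Lemma tangent_field_span {R : realType} {M : topologicalType} (A : set (chart R M))
    c q (v X : chart R M -> 'rV[R]_3) : charts_at A q c -> tangent A q v -> tangent A q X ->
  (exists t, forall i, v c 0 i = t * X c 0 i) <-> (exists t : R, v = t *: X).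
Proof.
move=> cq tv tX; split=> [[t E]|[t ->]]; last first.
  by exists t => i; rewrite -[(t *: X) c]/(t *: X c) mxE.
exists t; apply: (tangent_eq cq tv (tangentZ t tX)).
by apply/rowP => i; rewrite E -[(t *: X) c]/(t *: X c) mxE.
Qed.

Theorem theorem2 (R : realType) (M : topologicalType) (A : set (chart R M))
    (P1 P2 : M -> set (chart R M -> 'rV[R]_3))
    (hM : analytic_manifold A)
    (hP : analytic_path_geometry A [set: M] P1 P2) :
  forall p : M, exists (U : set M) (phi : M -> 'rV[R]_4),
    [/\ open U, U p, analytic_embedding A U phi &
        induced_path_geometry A U phi P1 P2].
Proof.
move=> p; have [pg l1 l2] := hP.
have [_ _ /(_ p)[c0 Ac0 pc0] _] := hM.
have c0p : charts_at A p c0 by [].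
pose x0 := chart_map c0 p.
have [V1 [X1 [oV1 V1p _ [tX1 rX1] hX1]]] := l1 p I.
have [V2 [X2 [oV2 V2p _ [tX2 rX2] hX2]]] := l2 p I.
pose a i x := X1 (chart_inv c0 x) c0 0 i; pose b i x := X2 (chart_inv c0 x) c0 0 i.
have aE q : chart_dom c0 q -> (a^~ (chart_map c0 q)) = X1 q c0 0.
  by move=> qc; apply/funext => i; rewrite /a chart_mapK.
have bE q : chart_dom c0 q -> (b^~ (chart_map c0 q)) = X2 q c0 0.
  by move=> qc; apply/funext => i; rewrite /b chart_mapK.
have aa i : an (a i) x0 by apply: (rX1 c0 Ac0 i); exists p.
have ab i : an (b i) x0 by apply: (rX2 c0 Ac0 i); exists p.
(* The two lines are independent because their sum is a plane subbundle, hence has rank two at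
   [p]. *)
have indep s t : (forall i, s * a i x0 + t * b i x0 = 0) -> s = 0 /\ t = 0.
  move=> st; have [_ _ [pl _]] := pg; have [V [X [Y [_ Vp _ _ /(_ p Vp)[ind E]]]]] := pl p I.
  have [_ E1] := hX1 p V1p; have [_ E2] := hX2 p V2p.
  apply: (span_independent ind E E1 E2).
  have e : s *: X1 p = (- t) *: X2 p.
    apply: (tangent_eq c0p (tangentZ s (tX1 p V1p)) (tangentZ (- t) (tX2 p V2p))).
    apply/rowP => i; rewrite -[(s *: X1 p) c0]/(s *: X1 p c0) -[(- t *: X2 p) c0]/(- t *: X2 p c0) !mxE.
    have := st i; rewrite /a /b /x0 chart_mapK // => e.
    by rewrite mulNr; apply/eqP; rewrite -addr_eq0 e.
  by rewrite e scaleNr addNr.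
have [Phi [f [g N]]] := exists_good_map aa ab indep.
have G0 : good_point a b Phi f g x0 := nbhs_singleton N.
have [L [r [r0 HL]]] := immersion_left_inverse (good_Phi G0) (good_point_immersion G0).
have N' : nbhs x0 [set x | good_point a b Phi f g x /\ in_polydisc r (x - x0)].
  exact: nearI N (near_polydisc x0 r0).
(* The interior makes [U] open; the polydisc condition puts [U] within reach of the inequality of
   [immersion_left_inverse]. *)
pose O := [set x | good_point a b Phi f g x /\ in_polydisc r (x - x0)]°.
pose U := (chart_dom c0 `&` chart_map c0 @^-1` O) `&` (V1 `&` V2).
have oU : open U.
  apply: openI; last exact: openI.
  exact/open_chart_preimage/open_interior.
have Up : U p by [].
have UG q : U q -> [/\ charts_at A q c0, good_point a b Phi f g (chart_map c0 q),
    in_polydisc r (chart_map c0 q - x0), V1 q & V2 q].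
  by move=> [[qc /interior_subset[Gq rq]] [q1 q2]].
pose phi := Phi \o chart_map c0.
have lip q q' : U q -> U q' -> `|chart_map c0 q - chart_map c0 q'| <= 2 * `|phi q *m L - phi q' *m L|.
  by move=> /UG[_ _ rq _ _] /UG[_ _ rq' _ _]; apply: HL.
have chart_inj q q' : U q -> U q' -> chart_map c0 q = chart_map c0 q' -> q = q'.
  move=> /UG[[_ qc] _ _ _ _] /UG[[_ qc'] _ _ _ _] e.
  by rewrite -(chart_mapK qc) e chart_mapK.
have dphi q c v : U q -> charts_at A q c -> tangent A q v ->
    differential phi c q v = 'd Phi (chart_map c0 q) (v c0).
  move=> /UG[c0q Gq _ _ _] cq tv.
  exact: (differentialE hM cq c0q (good_Phi Gq) tv).
exists U, phi; split => //.
  split.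
  - move=> c Ac j _ [q [Uq qc] <-]; have [c0q Gq _ _ _] := UG q Uq.
    apply: (@an_comp _ _ _ (fun x => Phi x 0 j) (transition c c0)) => [i|].
      exact: (charts_at_transition hM i (conj Ac qc) c0q).
    by rewrite transition_chart //; apply: good_Phi Gq j.
  - move=> q c Uq cq v tv; rewrite dphi // => /(good_point_immersion _) v0.
    have [c0q Gq _ _ _] := UG q Uq.
    have t0 : tangent A q (0 *: v) := tangentZ 0 tv.
    have -> : v = 0 *: v.
      apply: (tangent_eq c0q tv t0); rewrite (v0 _ _ _ _ Gq).
      by rewrite -[(0 *: v) c0]/(0 *: v c0) scale0r.
    by rewrite scale0r.
  - move=> q q'; rewrite !inE => Uq Uq' e; apply: chart_inj => //.
    apply/eqP; rewrite -subr_eq0 -normr_le0.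
    by have := lip q q' Uq Uq'; rewrite e subrr normr0 mulr0.
  move=> V oV VU.
  (* A union of preimages under [L] of balls of radius [e / 2], where the [e]-ball about the
     coordinates of [q] meets [U] inside [V]. The factor 2 in [lip] brings a point of [U] with image
     in [W] within [e] of [q], hence into [V]. *)
  pose W := [set y : 'rV[R]_4 | exists q e, [/\ V q, 0 < e,
    (forall q', U q' -> `|chart_map c0 q - chart_map c0 q'| < e -> V q') &
    `|phi q *m L - y *m L| < e / 2]].
  exists W.
    rewrite openE => y [q [e [Vq e0 He hy]]]; rewrite /interior.
    pose K := \sum_(j < 4) \sum_(i < 3) `|L j i|.
    have K0 : 0 <= K by rewrite sumr_ge0 // => j _; rewrite sumr_ge0.
    pose d := (e / 2 - `|phi q *m L - y *m L|) / (K + 1).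
    have d0 : 0 < d by rewrite divr_gt0 ?subr_gt0 // ltr_wpDl.
    apply/nbhs_ballP; exists d => //= z; rewrite -ball_normE /= => yz.
    exists q, e; split => //.
    have -> : phi q *m L - z *m L = (phi q *m L - y *m L) + (y - z) *m L.
      by rewrite mulmxBl addrA subrK.
    apply: le_lt_trans (ler_normD _ _) _; rewrite -ltrBrDl.
    apply: le_lt_trans (norm_mulmx_le L (y - z)) _.
    have dK : d * (K + 1) = e / 2 - `|phi q *m L - y *m L|.
      by rewrite /d mulfVK // gt_eqF // ltr_wpDl.
    rewrite -dK; apply: (@le_lt_trans _ _ (`|y - z| * (K + 1))).
      by rewrite ler_wpM2l // lerDl.
    by rewrite ltr_pM2r // ltr_wpDl.
  apply/seteqP; split=> [_ [q Vq <-]|y [[q' Uq' <-] [q [e [Vq e0 He hy]]]]].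
    split; first by exists q => //; apply: VU.
    have [[_ qc0] _ _ _ _] := UG q (VU q Vq).
    have : nbhs (chart_map c0 q) (chart_map c0 @` (V `&` chart_dom c0)).
      by apply: open_nbhs_nbhs; split; [apply: open_chart_image|exists q].
    move=> /nbhs_ballP[e /= e0 He]; exists q, e; split => //.
      move=> q' Uq' hq'; have [|q'' [Vq'' _] e''] := He (chart_map c0 q').
        by rewrite -ball_normE.
      by rewrite -(chart_inj q'' q' (VU _ Vq'') Uq' e'').
    by rewrite subrr normr0 divr_gt0.
  exists q' => //; apply: (He q' Uq').
  apply: le_lt_trans (lip q q' (VU q Vq) Uq') _.
  by move: hy; rewrite ltr_pdivlMr // mulrC.
split; first exact: path_geometry_subset oU (@subsetT _ _) pg.
move=> q0 Uq0.
(* The frame [(a, b)] is completed by its cross product, whose determinant is nonzero by [good_det];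
   the same vector, read as a covector, is the middle form [th2]. *)
pose e x : 'I_3 -> R := cross (a^~ x) (b^~ x).
pose th1 x := coframe1 (a^~ x) (b^~ x) (e x) (f x).
pose th2 x := cross (a^~ x) (b^~ x).
pose th3 x := coframe3 (a^~ x) (b^~ x) (e x) (g x).
have Uc0 : U `<=` chart_dom c0 by move=> q [[]].
exists U, (chart_form c0 th1), (chart_form c0 th2), (chart_form c0 th3); split; first by split.
have ath2 q : U q -> forall i, an (fun x => th2 x i) (chart_map c0 q).
  by move=> /UG[_ Gq _ _ _] i; apply: an_cross => j; [apply: good_a Gq j|apply: good_b Gq j].
have aD q : U q -> an (fun x => (det3 (a^~ x) (b^~ x) (e x))^-1) (chart_map c0 q).
  move=> Uq; have [_ Gq _ _ _] := UG q Uq; apply: an_inv; last exact: good_det Gq.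
  by apply: an_det3 => i; [apply: good_a Gq i|apply: good_b Gq i|apply: ath2].
have ath1 q : U q -> forall i, an (fun x => th1 x i) (chart_map c0 q).
  move=> Uq i; have [_ Gq _ _ _] := UG q Uq; apply: anM.
    by apply: anN; apply: anM; [apply: good_f Gq|apply: aD].
  by apply: (an_cross (u := fun i x => e x i)) => j; [apply: ath2|apply: good_a Gq j].
have ath3 q : U q -> forall i, an (fun x => th3 x i) (chart_map c0 q).
  move=> Uq i; have [_ Gq _ _ _] := UG q Uq; apply: anM.
    by apply: anM; [apply: good_g Gq|apply: aD].
  by apply: (an_cross (v := fun i x => e x i)) => j; [apply: good_b Gq j|apply: ath2].
split.
- split.
  + exact: one_form_chart_form.
  + exact: one_form_chart_form.
  + exact: one_form_chart_form.
  move=> q Uq s1 s2 s3 H; have [c0q Gq _ _ _] := UG q Uq.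
  apply: (coframe_independent (good_det Gq) (good_f0 Gq) (good_g0 Gq)) => u.
  pose w : 'rV[R]_3 := \row_i u i.
  have wu : w 0 = u by apply/funext => i; rewrite mxE.
  have := H (tangent_of A c0 q w) (tangent_of_tangent hM w c0q).
  by rewrite /chart_form (tangent_ofK w c0q) wu.
- move=> q c Uq cq v w tv tw; have [_ Gq _ _ _] := UG q Uq.
  rewrite (dphi q c v Uq cq tv) (dphi q c w Uq cq tw) (good_omega Gq).
  exact: (wedge_coframe1 _ _ _ (good_det Gq)).
- move=> q c Uq cq v w tv tw; have [_ Gq _ _ _] := UG q Uq.
  rewrite (dphi q c v Uq cq tv) (dphi q c w Uq cq tw) (good_phi Gq).
  exact: (wedge_coframe3 _ _ _ (good_det Gq)).
move=> q Uq; have [c0q Gq _ V1q V2q] := UG q Uq; have [_ qc0] := c0q.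
have [_ E1] := hX1 q V1q; have [_ E2] := hX2 q V2q.
split; apply/seteqP; split => v.
- rewrite E1 => vt; have tv : tangent A q v by case: vt => t ->; apply: tangentZ; apply: tX1.
  have /(tangent_field_span c0q tv (tX1 q V1q)) := vt; rewrite -(aE q qc0).
  by move=> /(kernel_coframe1 _ (good_det Gq) (good_f0 Gq))[k1 k2].
- move=> [tv k1 k2]; rewrite E1; apply/(tangent_field_span c0q tv (tX1 q V1q)).
  by rewrite -(aE q qc0); apply/(kernel_coframe1 _ (good_det Gq) (good_f0 Gq)).
- rewrite E2 => vt; have tv : tangent A q v by case: vt => t ->; apply: tangentZ; apply: tX2.
  have /(tangent_field_span c0q tv (tX2 q V2q)) := vt; rewrite -(bE q qc0).
  by move=> /(kernel_coframe3 _ (good_det Gq) (good_g0 Gq))[k1 k2].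
- move=> [tv k1 k2]; rewrite E2; apply/(tangent_field_span c0q tv (tX2 q V2q)).
  by rewrite -(bE q qc0); apply/(kernel_coframe3 _ (good_det Gq) (good_g0 Gq)).
Qed.
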